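(* Let $\lambda<1$ and let $\mathcal{S}(\lambda)=\bigcup_{\alpha\in(-\pi/2,\pi/2)}\mathcal{S}^*_\alpha(\lambda)$. Then the set of $\gamma\in\mathbb{C}$ such that $J_\gamma[f]\in\mathcal{S}$ for every $f\in\mathcal{S}(\lambda)$ equals $\{\gamma\in\mathbb{C}: |\gamma|\le \frac{1}{2(1-\lambda)}\}$.
   Context: $\mathbb{D}$ is the open unit disk; $\mathcal{A}$ the class of analytic $f$ on $\mathbb{D}$ with $f(0)=0$, $f'(0)=1$; $\mathcal{S}\subset\mathcal{A}$ the univalent functions. For $\alpha\in(-\pi/2,\pi/2)$, $\lambda<1$, $\mathcal{S}^*_\alpha(\lambda)=\{f\in\mathcal{A}: f(z)\neq0 \text{ for } z\ne 0,\ \mathrm{Re}\,(e^{i\alpha}zf'(z)/f(z))>\lambda\cos\alpha \text{ on }\mathbb{D}\}$. For $\gamma\in\mathbb{C}$, $J_\gamma[f](z)=\int_0^z (f(w)/w)^\gamma\,dw$, with the branch of $(f(w)/w)^\gamma$ equal to $1$ at $w=0$. *)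

(* Defs.v *)
From Stdlib Require Import Reals.
From Coquelicot Require Import Coquelicot.
Open Scope R_scope.

Definition cexp (z : C) : C :=
  (exp (Re z) * cos (Im z), exp (Re z) * sin (Im z)).

Definition in_disk (z : C) : Prop := Cmod z < 1.

Definition analytic_on_disk (f : C -> C) : Prop :=
  forall z : C, in_disk z -> ex_derive (K := C_AbsRing) (V := C_NormedModule) f z.

Definition classA (f : C -> C) : Prop :=
  analytic_on_disk f /\ f (RtoC 0) = RtoC 0 /\
  is_derive (K := C_AbsRing) (V := C_NormedModule) f (RtoC 0) (RtoC 1).

Definition classS (f : C -> C) : Prop :=
  classA f /\ forall z w : C, in_disk z -> in_disk w -> f z = f w -> z = w.

(* S*_alpha(lambda).  At z = 0 the quotient z f'(z)/f(z) equals 1 (by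
   continuity), and Re (e^{i alpha}) = cos alpha > lambda cos alpha always
   holds, so the condition is only imposed for z <> 0. *)
Definition spirallike (alpha lambda : R) (f : C -> C) : Prop :=
  classA f /\
  (forall z : C, in_disk z -> z <> RtoC 0 -> f z <> RtoC 0) /\
  (forall z l : C, in_disk z -> z <> RtoC 0 ->
     is_derive (K := C_AbsRing) (V := C_NormedModule) f z l ->
     Re (cexp (0, alpha) * (z * l / f z))%C > lambda * cos alpha).

Definition classS_lambda (lambda : R) (f : C -> C) : Prop :=
  exists alpha : R, - (PI / 2) < alpha < PI / 2 /\ spirallike alpha lambda f.

(* h is the branch of log (f(w)/w) on D with h(0) = 0 (which is then the
   branch of (f(w)/w)^gamma := exp (gamma h(w)) equal to 1 at w = 0). *)
Definition log_branch (f h : C -> C) : Prop :=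
  analytic_on_disk h /\ h (RtoC 0) = RtoC 0 /\
  forall w : C, in_disk w -> w <> RtoC 0 -> cexp (h w) = (f w / w)%C.

(* J_gamma[f](z) = \int_0^z (f(w)/w)^gamma dw, integrated along the segment
   [0, z]:  \int_0^1 exp (gamma h(t z)) z dt. *)
Definition Jgamma (gamma : C) (h : C -> C) (z : C) : C :=
  @RInt C_R_CompleteNormedModule
    (fun t : R => (cexp (gamma * h (RtoC t * z)) * z)%C) 0 1.

Definition J_in_S (gamma : C) (f : C -> C) : Prop :=
  forall h : C -> C, log_branch f h -> classS (Jgamma gamma h).

(* Main.v *)
Require Import Defs.
From Stdlib Require Import Reals Lra Psatz ClassicalEpsilon.
From Coquelicot Require Import Coquelicot.
Open Scope R_scope.

(** Sufficiency.  Let [E = exp (gamma h) = J'].  The spirallikeness condition and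
    the Schwarz lemma give [z E' / E = (c / 2) v] with [|c| <= 1] and
    [|v| <= |z| |v + 2|].  This is the hypothesis of Ahlfors' univalence criterion
    [|(1 - |z|^2) z E' / E + k |z|^2| <= 1] with [k = - c]; taking [k = - r^2 c] makes it
    strict on the disk of radius [r].  The criterion is proved with the Loewner chain
    [(1 + k) J(z) + tau z J'(z)] on [|z|^2 (1 + tau) <= r^2]: two distinct points with the
    same image can be continued from [tau] to [tau + delta], with [delta]
    independent of [tau], until [tau] is so large that the chain is visibly injective.

    Necessity.  For [f(z) = z (1 - z)^(-b)] with [b = 2 (1 - lambda) cos alpha e^(-i alpha)],
    [J] is an affine function of [(1 - z)^(1 - gamma b)], which is not injective as soon as
    [|gamma b| > 1] and [|gamma b - 2| > 1]; some [alpha] achieves both. *)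

(** The bound on gamma comes from a normalisation. With [A = (1 - lambda) cos alpha], the spirallike
    condition says that v = e^(i alpha) z h' / A has Re v > -1, and gamma z h' = (c / 2) v for c = 2
    gamma A e^(-i alpha). As cos alpha <= 1, |gamma| <= 1 / (2 (1 - lambda)) forces |c| <= 1 for
    every alpha at once. The non-strict criterion gives no uniform lower bound for the derivative of
    the chain. On the disk of radius r < 1 there is one, and a slightly larger disk leaves room for
    Newton iterates, so the step length can be fixed in advance. The step constants involve bounds
    on E, 1/E and E' and a Lipschitz constant of E', while h is only assumed complex differentiable;
    hence the passage through Goursat's theorem and Cauchy's formula. In the other direction, gamma
    b = G cos alpha e^(-i alpha) with G = 2 (1 - lambda) gamma. As alpha varies it runs over the
    circle having the segment from 0 to G as a diameter, without the point 0. For |G| > 1 this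
    circle is not covered by the two closed unit disks centred at 0 and 2. *)

Local Open Scope C_scope.

(** * Derivatives and the exponential *)

(* [D i f t l]: [l] is the derivative of [f] at [t] with respect to the
   coordinate [i].  With [i] the identity of [C] this is the complex derivative,
   with [i = RtoC] the derivative of a curve. *)
Definition D {T : Type} (i f : T -> C) (t : T) (l : C) : Prop :=
  forall e : R, (0 < e)%R -> exists d : R, (0 < d)%R /\ forall t' : T,
    (Cmod (i t' - i t) < d)%R ->
    (Cmod (f t' - f t - l * (i t' - i t)) <= e * Cmod (i t' - i t))%R.

Definition Ct {T : Type} (i f : T -> C) (t : T) : Prop :=
  forall e : R, (0 < e)%R -> exists d : R, (0 < d)%R /\ forall t' : T,
    (Cmod (i t' - i t) < d)%R -> (Cmod (f t' - f t) < e)%R.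

Notation Did := (D (fun z : C => z)).
Notation DR := (D RtoC).
Notation Cid := (Ct (fun z : C => z)).
Notation CR := (Ct RtoC).

Lemma Cmod_triangle3 (a b c : C) :
  (Cmod (a + b + c) <= Cmod a + Cmod b + Cmod c)%R.
Proof.
  pose proof (Cmod_triangle (a + b) c). pose proof (Cmod_triangle a b). lra.
Qed.

Lemma Cmod_sub_sym (a b : C) : Cmod (a - b) = Cmod (b - a).
Proof. rewrite <- Cmod_opp. f_equal. ring. Qed.

Lemma Cmod_sub_triangle (a b c : C) :
  (Cmod (a - c) <= Cmod (a - b) + Cmod (b - c))%R.
Proof.
  replace (a - c) with ((a - b) + (b - c)) by ring. apply Cmod_triangle.
Qed.

Lemma Cmod_reverse_triangle (a b : C) : (Cmod a - Cmod b <= Cmod (a - b))%R.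
Proof.
  pose proof (Cmod_triangle (a - b) b) as H.
  replace (a - b + b) with a in H by ring. lra.
Qed.

Lemma Cmod_sub_le (a b : C) : (Cmod (a - b) <= Cmod a + Cmod b)%R.
Proof. rewrite <- (Cmod_opp b). apply Cmod_triangle. Qed.

Section Rules.
Context {T : Type} (i : T -> C).
Implicit Types (f g : T -> C) (t : T).

Lemma D_lipschitz f t l : D i f t l ->
  exists d : R, (0 < d)%R /\ forall t', (Cmod (i t' - i t) < d)%R ->
    (Cmod (f t' - f t) <= (Cmod l + 1) * Cmod (i t' - i t))%R.
Proof.
  intros H. destruct (H 1%R Rlt_0_1) as (d & Hd & H1).
  exists d; split; auto. intros t' Ht. specialize (H1 t' Ht).
  replace (f t' - f t) with ((f t' - f t - l * (i t' - i t)) + l * (i t' - i t)) by ring.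
  eapply Rle_trans. apply Cmod_triangle. rewrite Cmod_mult. lra.
Qed.

Lemma D_Ct f t l : D i f t l -> Ct i f t.
Proof.
  intros H e He. destruct (D_lipschitz _ _ _ H) as (d & Hd & H1).
  pose proof (Cmod_ge_0 l).
  exists (Rmin d (e / (Cmod l + 1))); split.
  - apply Rmin_glb_lt; auto. apply Rdiv_lt_0_compat; lra.
  - intros t' Ht. eapply Rle_lt_trans. apply H1.
    eapply Rlt_le_trans. apply Ht. apply Rmin_l.
    assert (Cmod (i t' - i t) < e / (Cmod l + 1))%R.
    { eapply Rlt_le_trans. apply Ht. apply Rmin_r. }
    apply Rmult_lt_compat_l with (r := (Cmod l + 1)%R) in H2; [|lra].
    replace ((Cmod l + 1) * (e / (Cmod l + 1)))%R with e in H2 by (field; lra). auto.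
Qed.

Lemma D_ext f g t l : (forall s, f s = g s) -> D i f t l -> D i g t l.
Proof.
  intros E H e He. destruct (H e He) as (d & Hd & H1).
  exists d; split; auto. intros t' Ht. rewrite <- !E. auto.
Qed.

Lemma D_ext_near f g t l (d0 : R) : (0 < d0)%R ->
  (forall s, (Cmod (i s - i t) < d0)%R -> f s = g s) -> D i f t l -> D i g t l.
Proof.
  intros Hd0 E H e He. destruct (H e He) as (d & Hd & H1).
  exists (Rmin d d0); split. apply Rmin_glb_lt; auto.
  intros t' Ht.
  assert (Et : f t = g t).
  { apply E. replace (i t - i t) with (RtoC 0) by ring. now rewrite Cmod_0. }
  rewrite <- Et, <- E. apply H1.
  eapply Rlt_le_trans; [apply Ht|apply Rmin_l].
  eapply Rlt_le_trans; [apply Ht|apply Rmin_r].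
Qed.

Lemma D_eq f t l l' : l = l' -> D i f t l -> D i f t l'.
Proof. now intros ->. Qed.

Lemma D_const (c : C) t : D i (fun _ => c) t 0.
Proof.
  intros e He. exists 1%R; split. lra. intros t' _.
  replace (c - c - 0 * (i t' - i t)) with (RtoC 0) by ring. rewrite Cmod_0.
  apply Rmult_le_pos. lra. apply Cmod_ge_0.
Qed.

Lemma D_coord t : D i i t 1.
Proof.
  intros e He. exists 1%R; split. lra. intros t' _.
  replace (i t' - i t - 1 * (i t' - i t)) with (RtoC 0) by ring. rewrite Cmod_0.
  apply Rmult_le_pos. lra. apply Cmod_ge_0.
Qed.

Lemma D_plus f g t l m : D i f t l -> D i g t m ->
  D i (fun s => f s + g s) t (l + m).
Proof.
  intros Hf Hg e He.
  destruct (Hf (e / 2)%R) as (d1 & Hd1 & H1). lra.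
  destruct (Hg (e / 2)%R) as (d2 & Hd2 & H2). lra.
  exists (Rmin d1 d2); split. apply Rmin_glb_lt; auto.
  intros t' Ht. specialize (H1 t' (Rlt_le_trans _ _ _ Ht (Rmin_l _ _))).
  specialize (H2 t' (Rlt_le_trans _ _ _ Ht (Rmin_r _ _))).
  replace (f t' + g t' - (f t + g t) - (l + m) * (i t' - i t)) with
   ((f t' - f t - l * (i t' - i t)) + (g t' - g t - m * (i t' - i t))) by ring.
  eapply Rle_trans. apply Cmod_triangle. lra.
Qed.

Lemma D_mult f g t l m : D i f t l -> D i g t m ->
  D i (fun s => f s * g s) t (l * g t + f t * m).
Proof.
  intros Hf Hg e He.
  pose proof (Cmod_ge_0 (f t)) as Pf. pose proof (Cmod_ge_0 (g t)) as Pg.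
  pose proof (Cmod_ge_0 l) as Pl. pose proof (Cmod_ge_0 m) as Pm.
  destruct (Hf (e / 3 / (Cmod (g t) + 1))%R) as (d1 & Hd1 & H1).
  { apply Rdiv_lt_0_compat; lra. }
  destruct (Hg (e / 3 / (Cmod (f t) + 1))%R) as (d2 & Hd2 & H2).
  { apply Rdiv_lt_0_compat; lra. }
  destruct (D_lipschitz _ _ _ Hf) as (d3 & Hd3 & H3).
  destruct (D_Ct _ _ _ Hg (e / 3 / (Cmod l + 1))%R) as (d4 & Hd4 & H4).
  { apply Rdiv_lt_0_compat; lra. }
  exists (Rmin (Rmin d1 d2) (Rmin d3 d4)); split.
  { repeat apply Rmin_glb_lt; auto. }
  intros t' Ht.
  assert (A1 := Rmin_l (Rmin d1 d2) (Rmin d3 d4)). assert (A2 := Rmin_r (Rmin d1 d2) (Rmin d3 d4)).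
  assert (A3 := Rmin_l d1 d2). assert (A4 := Rmin_r d1 d2).
  assert (A5 := Rmin_l d3 d4). assert (A6 := Rmin_r d3 d4).
  specialize (H1 t' ltac:(lra)). specialize (H2 t' ltac:(lra)).
  specialize (H3 t' ltac:(lra)). specialize (H4 t' ltac:(lra)).
  set (x := i t' - i t) in *.
  replace (f t' * g t' - f t * g t - (l * g t + f t * m) * x) with
    ((f t' - f t - l * x) * g t + f t * (g t' - g t - m * x) + (f t' - f t) * (g t' - g t)) by ring.
  eapply Rle_trans. apply Cmod_triangle3. rewrite !Cmod_mult.
  pose proof (Cmod_ge_0 x) as Px.
  set (a := Cmod (f t' - f t - l * x)) in *. set (b := Cmod (g t' - g t - m * x)) in *.
  set (p := Cmod (f t' - f t)) in *. set (q := Cmod (g t' - g t)) in *.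
  assert (0 <= a)%R by apply Cmod_ge_0. assert (0 <= b)%R by apply Cmod_ge_0.
  assert (0 <= p)%R by apply Cmod_ge_0. assert (0 <= q)%R by apply Cmod_ge_0.
  assert (B1 : (a * Cmod (g t) <= e / 3 * Cmod x)%R).
  { apply Rle_trans with (a * (Cmod (g t) + 1))%R. nra.
    apply Rmult_le_compat_r with (r := (Cmod (g t) + 1)%R) in H1; [|lra].
    replace (e / 3 / (Cmod (g t) + 1) * Cmod x * (Cmod (g t) + 1))%R with (e / 3 * Cmod x)%R in H1 by (field; lra).
    lra. }
  assert (B2 : (Cmod (f t) * b <= e / 3 * Cmod x)%R).
  { apply Rle_trans with (b * (Cmod (f t) + 1))%R. nra.
    apply Rmult_le_compat_r with (r := (Cmod (f t) + 1)%R) in H2; [|lra].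
    replace (e / 3 / (Cmod (f t) + 1) * Cmod x * (Cmod (f t) + 1))%R with (e / 3 * Cmod x)%R in H2 by (field; lra).
    lra. }
  assert (B3 : (p * q <= e / 3 * Cmod x)%R).
  { apply Rle_trans with ((Cmod l + 1) * Cmod x * (e / 3 / (Cmod l + 1)))%R.
    apply Rmult_le_compat; lra. right; field; lra. }
  lra.
Qed.

Lemma D_comp (F : C -> C) g t l m : D i g t l -> Did F (g t) m ->
  D i (fun s => F (g s)) t (m * l).
Proof.
  intros Hg HF e He.
  pose proof (Cmod_ge_0 l) as Pl. pose proof (Cmod_ge_0 m) as Pm.
  destruct (HF (e / 2 / (Cmod l + 1))%R) as (d1 & Hd1 & H1).
  { apply Rdiv_lt_0_compat; lra. }
  destruct (Hg (e / 2 / (Cmod m + 1))%R) as (d2 & Hd2 & H2).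
  { apply Rdiv_lt_0_compat; lra. }
  destruct (D_lipschitz _ _ _ Hg) as (d3 & Hd3 & H3).
  destruct (D_Ct _ _ _ Hg d1 Hd1) as (d4 & Hd4 & H4).
  exists (Rmin (Rmin d2 d3) d4); split.
  { repeat apply Rmin_glb_lt; auto. }
  intros t' Ht.
  assert (A1 := Rmin_l (Rmin d2 d3) d4). assert (A2 := Rmin_r (Rmin d2 d3) d4).
  assert (A3 := Rmin_l d2 d3). assert (A4 := Rmin_r d2 d3).
  specialize (H2 t' ltac:(lra)). specialize (H3 t' ltac:(lra)). specialize (H4 t' ltac:(lra)).
  specialize (H1 (g t') H4). set (x := i t' - i t) in *.
  replace (F (g t') - F (g t) - m * l * x) with
    ((F (g t') - F (g t) - m * (g t' - g t)) + m * (g t' - g t - l * x)) by ring.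
  eapply Rle_trans. apply Cmod_triangle. rewrite Cmod_mult.
  pose proof (Cmod_ge_0 x) as Px.
  set (a := Cmod (g t' - g t)) in *. set (b := Cmod (g t' - g t - l * x)) in *.
  assert (0 <= a)%R by apply Cmod_ge_0. assert (0 <= b)%R by apply Cmod_ge_0.
  assert (B1 : (e / 2 / (Cmod l + 1) * a <= e / 2 * Cmod x)%R).
  { apply Rle_trans with (e / 2 / (Cmod l + 1) * ((Cmod l + 1) * Cmod x))%R.
    apply Rmult_le_compat_l; auto. apply Rlt_le, Rdiv_lt_0_compat; lra.
    right; field; lra. }
  assert (B2 : (Cmod m * b <= e / 2 * Cmod x)%R).
  { apply Rle_trans with ((Cmod m + 1) * b)%R. nra.
    apply Rmult_le_compat_l with (r := (Cmod m + 1)%R) in H2; [|lra].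
    replace ((Cmod m + 1) * (e / 2 / (Cmod m + 1) * Cmod x))%R with (e / 2 * Cmod x)%R in H2 by (field; lra).
    lra. }
  lra.
Qed.

Lemma D_scal (c : C) f t l : D i f t l -> D i (fun s => c * f s) t (c * l).
Proof.
  intros H. eapply D_eq. 2: apply D_mult; [apply D_const|apply H]. cbv beta; ring.
Qed.

Lemma D_opp f t l : D i f t l -> D i (fun s => - f s) t (- l).
Proof.
  intros H. apply (D_ext (fun s => (-(1)) * f s)). intros; ring.
  eapply D_eq. 2: apply D_scal, H. ring.
Qed.

Lemma D_minus f g t l m : D i f t l -> D i g t m ->
  D i (fun s => f s - g s) t (l - m).
Proof. intros Hf Hg. apply D_plus; auto. now apply D_opp. Qed.

Lemma Ct_const (c : C) t : Ct i (fun _ => c) t.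
Proof. eapply D_Ct, D_const. Qed.

Lemma Ct_coord t : Ct i i t.
Proof. eapply D_Ct, D_coord. Qed.

Lemma Ct_plus f g t : Ct i f t -> Ct i g t -> Ct i (fun s => f s + g s) t.
Proof.
  intros Hf Hg e He.
  destruct (Hf (e / 2)%R) as (d1 & Hd1 & H1). lra.
  destruct (Hg (e / 2)%R) as (d2 & Hd2 & H2). lra.
  exists (Rmin d1 d2); split. apply Rmin_glb_lt; auto.
  intros t' Ht. specialize (H1 t' (Rlt_le_trans _ _ _ Ht (Rmin_l _ _))).
  specialize (H2 t' (Rlt_le_trans _ _ _ Ht (Rmin_r _ _))).
  replace (f t' + g t' - (f t + g t)) with ((f t' - f t) + (g t' - g t)) by ring.
  eapply Rle_lt_trans. apply Cmod_triangle. lra.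
Qed.

Lemma Ct_mult f g t : Ct i f t -> Ct i g t -> Ct i (fun s => f s * g s) t.
Proof.
  intros Hf Hg e He.
  pose proof (Cmod_ge_0 (f t)) as Pf. pose proof (Cmod_ge_0 (g t)) as Pg.
  set (K := (Cmod (f t) + Cmod (g t) + 1)%R).
  assert (PK : (0 < e / 2 / K)%R). { unfold K. apply Rdiv_lt_0_compat; lra. }
  destruct (Hf (Rmin 1 (e / 2 / K))%R) as (d1 & Hd1 & H1). apply Rmin_glb_lt; lra.
  destruct (Hg (e / 2 / K)%R) as (d2 & Hd2 & H2). lra.
  exists (Rmin d1 d2); split. apply Rmin_glb_lt; auto.
  intros t' Ht. specialize (H1 t' (Rlt_le_trans _ _ _ Ht (Rmin_l _ _))).
  specialize (H2 t' (Rlt_le_trans _ _ _ Ht (Rmin_r _ _))).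
  assert (A1 := Rmin_l 1 (e / 2 / K)). assert (A2 := Rmin_r 1 (e / 2 / K)).
  replace (f t' * g t' - f t * g t) with
    ((f t' - f t) * g t + (f t + (f t' - f t)) * (g t' - g t)) by ring.
  eapply Rle_lt_trans. apply Cmod_triangle. rewrite !Cmod_mult.
  pose proof (Cmod_triangle (f t) (f t' - f t)) as A3.
  pose proof (Cmod_ge_0 (f t' - f t)). pose proof (Cmod_ge_0 (g t' - g t)).
  pose proof (Cmod_ge_0 (f t + (f t' - f t))).
  apply Rle_lt_trans with (e / 2 / K * Cmod (g t) + (Cmod (f t) + 1) * Cmod (g t' - g t))%R.
  { apply Rplus_le_compat. apply Rmult_le_compat_r; lra. apply Rmult_le_compat_r; lra. }
  apply Rle_lt_trans with (e / 2 / K * Cmod (g t) + (Cmod (f t) + 1) * (e / 2 / K))%R.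
  { apply Rplus_le_compat_l. apply Rmult_le_compat_l; lra. }
  replace (e / 2 / K * Cmod (g t) + (Cmod (f t) + 1) * (e / 2 / K))%R with (e / 2 / K * K)%R by (unfold K; ring).
  replace (e / 2 / K * K)%R with (e / 2)%R. lra. field. unfold K; lra.
Qed.

Lemma Ct_comp (F : C -> C) g t : Ct i g t -> Cid F (g t) ->
  Ct i (fun s => F (g s)) t.
Proof.
  intros Hg HF e He. destruct (HF e He) as (d & Hd & H1).
  destruct (Hg d Hd) as (d' & Hd' & H2). exists d'; split; auto.
Qed.

Lemma Ct_opp f t : Ct i f t -> Ct i (fun s => - f s) t.
Proof.
  intros Hf e He. destruct (Hf e He) as (d & Hd & H). exists d; split; auto.
  intros t' Ht. replace (- f t' - - f t) with (- (f t' - f t)) by ring.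
  rewrite Cmod_opp. auto.
Qed.

Lemma Ct_minus f g t : Ct i f t -> Ct i g t -> Ct i (fun s => f s - g s) t.
Proof. intros Hf Hg. apply Ct_plus; auto. now apply Ct_opp. Qed.

End Rules.

Lemma Did_inv (z : C) : z <> 0 -> Did Cinv z (- / (z * z)).
Proof.
  intros Hz e He. assert (Pz := proj1 (Cmod_gt_0 z) Hz).
  set (m := Cmod z) in *.
  (* The remainder is (w - z)^2 / (w z^2). The first radius gives |w| > m / 2, hence a bound 2 |w -
     z|^2 / m^3, which dictates the second radius. *)
  exists (Rmin (m / 2) (e * (m * m * m) / 2))%R; split.
  { apply Rmin_glb_lt. lra. apply Rdiv_lt_0_compat; [|lra].
    repeat apply Rmult_lt_0_compat; auto. }
  intros w Hw.
  assert (A1 := Rmin_l (m / 2) (e * (m * m * m) / 2)).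
  assert (A2 := Rmin_r (m / 2) (e * (m * m * m) / 2)).
  assert (Pw : (m / 2 < Cmod w)%R).
  { pose proof (Cmod_reverse_triangle z w). rewrite Cmod_sub_sym in H. fold m in H. lra. }
  assert (Hw0 : w <> 0). { apply Cmod_gt_0. lra. }
  replace (/ w - / z - - / (z * z) * (w - z)) with ((w - z) * ((w - z) * / (w * (z * z))))
    by (field; auto).
  rewrite !Cmod_mult, Cmod_inv, !Cmod_mult; [|repeat apply Cmult_neq_0; auto].
  fold m. rewrite (Rmult_comm e). apply Rmult_le_compat_l. apply Cmod_ge_0.
  assert (P1 : (0 < m * m)%R) by nra.
  assert (P2 : (0 < Cmod w * (m * m))%R) by (apply Rmult_lt_0_compat; lra).
  apply Rmult_le_reg_r with (Cmod w * (m * m))%R; auto.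
  rewrite Rmult_assoc, Rinv_l by lra.
  assert (m / 2 * (m * m) <= Cmod w * (m * m))%R by (apply Rmult_le_compat_r; lra).
  assert (e * (m / 2 * (m * m)) <= e * (Cmod w * (m * m)))%R by (apply Rmult_le_compat_l; lra).
  lra.
Qed.

Lemma D_inv {T} (i f : T -> C) t l : D i f t l -> f t <> 0 ->
  D i (fun s => / f s) t (- l / (f t * f t)).
Proof.
  intros H H0. eapply D_eq. 2: apply (D_comp i Cinv f); [apply H|apply Did_inv, H0].
  field; auto.
Qed.

Lemma Cid_inv (z : C) : z <> 0 -> Cid Cinv z.
Proof. intros H. eapply D_Ct, Did_inv, H. Qed.

Lemma Ct_inv {T} (i f : T -> C) t : Ct i f t -> f t <> 0 -> Ct i (fun s => / f s) t.
Proof. intros H H0. apply (Ct_comp i Cinv f); auto. now apply Cid_inv. Qed.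

Lemma D_unique (f : C -> C) z l m : Did f z l -> Did f z m -> l = m.
Proof.
  intros Hl Hm.
  destruct (Ceq_dec l m) as [|Hn]; auto. exfalso.
  assert (P : (0 < Cmod (l - m))%R).
  { apply Cmod_gt_0. intros H. apply Hn. replace l with (l - m + m) by ring. rewrite H. ring. }
  destruct (Hl (Cmod (l - m) / 4)%R) as (d1 & Hd1 & H1). lra.
  destruct (Hm (Cmod (l - m) / 4)%R) as (d2 & Hd2 & H2). lra.
  set (d := (Rmin d1 d2 / 2)%R).
  assert (A1 := Rmin_l d1 d2). assert (A2 := Rmin_r d1 d2).
  assert (A3 : (0 < Rmin d1 d2)%R) by (apply Rmin_glb_lt; auto).
  assert (Pd : (0 < d)%R) by (unfold d; lra).
  assert (E : z + RtoC d - z = RtoC d) by ring.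
  assert (Ed : Cmod (RtoC d) = d). { rewrite Cmod_R, Rabs_right; lra. }
  specialize (H1 (z + RtoC d)). specialize (H2 (z + RtoC d)).
  rewrite E, Ed in H1, H2. specialize (H1 ltac:(unfold d; lra)). specialize (H2 ltac:(unfold d; lra)).
  pose proof (Cmod_sub_le (f (z + d) - f z - m * d) (f (z + d) - f z - l * d)) as H3.
  replace (f (z + d) - f z - m * d - (f (z + d) - f z - l * d)) with ((l - m) * d) in H3 by ring.
  rewrite Cmod_mult, Ed in H3. nra.
Qed.

Lemma is_derive_Did (f : C -> C) z l :
  is_derive (K := C_AbsRing) (V := C_NormedModule) f z l <-> Did f z l.
Proof.
  split.
  - intros [_ H] e He.
    specialize (H z (fun P HP => HP) (mkposreal e He)).
    destruct H as [d Hd]. exists d; split. apply cond_pos. intros t' Ht.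
    specialize (Hd t' Ht). cbn in Hd.
    replace (f t' - f z - l * (t' - z)) with (f t' - f z - (t' - z) * l) by ring.
    exact Hd.
  - intros H. split. apply is_linear_scal_l.
    intros x Hx. assert (x = z).
    { symmetry. apply (is_filter_lim_locally_unique (K := C_AbsRing) (V := AbsRing_NormedModule C_AbsRing)). exact Hx. }
    subst x. intros e. destruct (H e (cond_pos e)) as (d & Hd & H1).
    exists (mkposreal d Hd). intros y Hy. specialize (H1 y Hy).
    replace (f y - f z - l * (y - z)) with (f y - f z - (y - z) * l) in H1 by ring.
    exact H1.
Qed.

(** The factor [k] selects a direction before the real part is taken, so that real one-variable
    theorems apply to the component of [f] in any direction. *)
Lemma DR_component (k : C) (f : R -> C) t l :
  DR f t l -> is_derive (fun s => Re (k * f s)) t (Re (k * l)).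
Proof.
  intros H. apply is_derive_Reals. intros e He.
  pose proof (Cmod_ge_0 k) as Pk.
  destruct (H (e / 2 / (Cmod k + 1))%R) as (d & Hd & H1).
  { apply Rdiv_lt_0_compat; lra. }
  exists (mkposreal d Hd). intros h Hh Hhd. simpl in Hhd.
  specialize (H1 (t + h)%R).
  replace (RtoC (t + h) - RtoC t) with (RtoC h) in H1 by (rewrite RtoC_plus; ring).
  rewrite Cmod_R in H1. specialize (H1 Hhd).
  replace ((Re (k * f (t + h)%R) - Re (k * f t)) / h - Re (k * l))%R with
    (Re (k * (f (t + h)%R - f t - l * h)) / h)%R.
  2: { destruct k, (f (t + h)%R), (f t), l. unfold Cminus, Cmult, Cplus, Copp, RtoC, Re; simpl. field; auto. }
  unfold Rdiv. rewrite Rabs_mult, Rabs_inv.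
  assert (Ph := Rabs_pos_lt h Hh).
  apply Rmult_lt_reg_r with (Rabs h); auto. rewrite Rmult_assoc, Rinv_l, Rmult_1_r; [|lra].
  eapply Rle_lt_trans. apply re_le_Cmod. rewrite Cmod_mult.
  apply Rle_lt_trans with ((Cmod k + 1) * (e / 2 / (Cmod k + 1) * Rabs h))%R.
  { apply Rmult_le_compat; auto; try apply Cmod_ge_0; lra. }
  replace ((Cmod k + 1) * (e / 2 / (Cmod k + 1) * Rabs h))%R with (e / 2 * Rabs h)%R by (field; lra).
  nra.
Qed.

Lemma Cmod_le_components (z : C) : (Cmod z <= Rabs (fst z) + Rabs (snd z))%R.
Proof.
  destruct z as [a b]. unfold Cmod; simpl fst; simpl snd.
  pose proof (Rabs_pos a). pose proof (Rabs_pos b).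
  rewrite <- (sqrt_pow2 (Rabs a + Rabs b)); [|lra]. apply sqrt_le_1_alt.
  rewrite <- (pow2_abs a), <- (pow2_abs b). nra.
Qed.

Lemma DR_of_components (f : R -> C) (a b : R) t :
  is_derive (fun s => fst (f s)) t a -> is_derive (fun s => snd (f s)) t b ->
  DR f t (a, b).
Proof.
  intros Ha Hb e He.
  apply is_derive_Reals in Ha, Hb.
  destruct (Ha (e / 2)%R) as [d1 H1]. lra. destruct (Hb (e / 2)%R) as [d2 H2]. lra.
  exists (Rmin d1 d2); split. apply Rmin_glb_lt; apply cond_pos.
  intros t' Ht. replace (RtoC t' - RtoC t) with (RtoC (t' - t)) in * by (rewrite RtoC_minus; ring).
  rewrite Cmod_R in *.
  destruct (Req_dec t' t) as [->|Hn].
  { replace (f t - f t - (a, b) * RtoC (t - t)) with (RtoC 0).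
    2: { unfold Rminus; rewrite Rplus_opp_r. ring. }
    rewrite Cmod_0. apply Rmult_le_pos. lra. apply Rabs_pos. }
  set (h := (t' - t)%R) in *. assert (Hh : h <> 0%R) by (unfold h; lra).
  specialize (H1 h Hh (Rlt_le_trans _ _ _ Ht (Rmin_l _ _))).
  specialize (H2 h Hh (Rlt_le_trans _ _ _ Ht (Rmin_r _ _))).
  replace (t + h)%R with t' in * by (unfold h; ring).
  eapply Rle_trans. apply Cmod_le_components.
  assert (Ph := Rabs_pos_lt h Hh).
  assert (S : forall p q c, (Rabs ((p - q) / h - c) < e / 2 -> Rabs (p - q - c * h) <= e / 2 * Rabs h)%R).
  { intros p q c Hc. replace (p - q - c * h)%R with (((p - q) / h - c) * h)%R by (field; auto).
    rewrite Rabs_mult. apply Rmult_le_compat_r; lra. }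
  apply S in H1. apply S in H2.
  replace (fst (f t' - f t - (a, b) * h)) with (fst (f t') - fst (f t) - a * h)%R.
  2: { destruct (f t'), (f t). simpl. ring. }
  replace (snd (f t' - f t - (a, b) * h)) with (snd (f t') - snd (f t) - b * h)%R.
  2: { destruct (f t'), (f t). simpl. ring. }
  lra.
Qed.

(** The real mean value theorem is applied to Re (k f) with k the conjugate of f b - f a: the
    increment of this function is |f b - f a|^2, and its derivative is at most |f b - f a| M. *)
Lemma DR_mean_value (f df : R -> C) (a b M : R) : (a <= b)%R ->
  (forall t, (a <= t <= b)%R -> DR f t (df t)) ->
  (forall t, (a <= t <= b)%R -> (Cmod (df t) <= M)%R) ->
  (Cmod (f b - f a) <= M * (b - a))%R.
Proof.
  intros Hab Hd HM. set (k := Cconj (f b - f a)).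
  destruct (MVT_gen (fun s => Re (k * f s)) a b (fun s => Re (k * df s))) as (c & Hc & E).
  - intros x Hx. rewrite Rmin_left, Rmax_right in Hx by lra. apply DR_component, Hd. lra.
  - intros x Hx. rewrite Rmin_left, Rmax_right in Hx by lra.
    apply derivable_continuous_pt. exists (Re (k * df x)).
    apply is_derive_Reals, DR_component, Hd. lra.
  - rewrite Rmin_left, Rmax_right in Hc by lra.
    replace (Re (k * f b) - Re (k * f a))%R with (Cmod (f b - f a) ^ 2)%R in E.
    2: { rewrite Cmod2_alt. unfold k. destruct (f a), (f b). unfold Cconj, Re, Im; simpl. ring. }
    specialize (HM c Hc).
    pose proof (Rle_abs (Re (k * df c))). pose proof (re_le_Cmod (k * df c)).
    rewrite Cmod_mult in H0. unfold k in H0 at 2. rewrite Cmod_conj in H0.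
    pose proof (Cmod_ge_0 (f b - f a)). pose proof (Cmod_ge_0 (df c)).
    set (m := Cmod (f b - f a)) in *.
    assert (m ^ 2 <= m * M * (b - a))%R.
    { rewrite E. apply Rmult_le_compat_r. lra. eapply Rle_trans. apply H.
      eapply Rle_trans. apply H0. apply Rmult_le_compat_l; lra. }
    destruct (Req_dec m 0) as [->|]. apply Rmult_le_pos; lra. nra.
Qed.

Definition seg (a b : C) (t : R) : C := a + RtoC t * (b - a).

Lemma DR_seg a b t : DR (seg a b) t (b - a).
Proof.
  unfold seg. eapply D_eq. 2: apply D_plus; [apply D_const|apply D_mult; [apply D_coord|apply D_const]].
  simpl. ring.
Qed.

Lemma Did_mean_value (f df : C -> C) (a b : C) (M : R) :
  (forall t, (0 <= t <= 1)%R -> Did f (seg a b t) (df (seg a b t))) ->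
  (forall t, (0 <= t <= 1)%R -> (Cmod (df (seg a b t)) <= M)%R) ->
  (Cmod (f b - f a) <= M * Cmod (b - a))%R.
Proof.
  intros H HM.
  pose proof (DR_mean_value (fun t => f (seg a b t)) (fun t => df (seg a b t) * (b - a)) 0 1 (M * Cmod (b - a))) as P.
  cbv beta in P.
  replace (seg a b 1) with b in P by (unfold seg; ring).
  replace (seg a b 0) with a in P by (unfold seg; ring).
  rewrite Rminus_0_r, Rmult_1_r in P. apply P. lra.
  - intros t Ht. apply D_comp. apply DR_seg. auto.
  - intros t Ht. rewrite Cmod_mult. apply Rmult_le_compat_r. apply Cmod_ge_0. auto.
Qed.

Lemma cexp_plus (a b : C) : cexp (a + b) = cexp a * cexp b.
Proof.
  unfold cexp, Cmult, Re, Im; destruct a, b; simpl. rewrite exp_plus, cos_plus, sin_plus.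
  f_equal; ring.
Qed.

Lemma cexp_0 : cexp 0 = 1.
Proof. unfold cexp; simpl. rewrite exp_0, cos_0, sin_0. unfold RtoC; f_equal; ring. Qed.

Lemma Cmod_cexp (z : C) : Cmod (cexp z) = exp (Re z).
Proof.
  unfold cexp, Cmod; simpl fst; simpl snd.
  replace ((exp (Re z) * cos (Im z)) ^ 2 + (exp (Re z) * sin (Im z)) ^ 2)%R
    with (exp (Re z) ^ 2 * (Rsqr (sin (Im z)) + Rsqr (cos (Im z))))%R by (unfold Rsqr; ring).
  rewrite sin2_cos2, Rmult_1_r. apply sqrt_pow2. left; apply exp_pos.
Qed.

Lemma cexp_neq_0 (z : C) : cexp z <> 0.
Proof. apply Cmod_gt_0. rewrite Cmod_cexp. apply exp_pos. Qed.

Lemma cexp_opp (z : C) : cexp (- z) = / cexp z.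
Proof.
  assert (H : cexp (- z) * cexp z = 1).
  { rewrite <- cexp_plus, <- cexp_0. f_equal. ring. }
  pose proof (cexp_neq_0 z).
  replace (cexp (- z)) with (cexp (- z) * cexp z * / cexp z) by (field; auto).
  rewrite H. ring.
Qed.

Lemma DR_cexp_line (u : C) t : DR (fun s => cexp (RtoC s * u)) t (u * cexp (RtoC t * u)).
Proof.
  destruct u as [x y]. eapply D_eq; [|apply DR_of_components].
  2: { apply (is_derive_ext (fun s => exp (s * x) * cos (s * y))%R).
       intros s. unfold cexp, Re, Im; simpl. f_equal; f_equal; ring.
       auto_derive; auto. }
  2: { apply (is_derive_ext (fun s => exp (s * x) * sin (s * y))%R).
       intros s. unfold cexp, Re, Im; simpl. f_equal; f_equal; ring.
       auto_derive; auto. }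
  unfold cexp, Cmult, Re, Im; simpl.
  replace (t * x - 0 * y)%R with (t * x)%R by ring. replace (t * y + 0 * x)%R with (t * y)%R by ring.
  f_equal; ring.
Qed.

Lemma exp_le_compat (x y : R) : (x <= y -> exp x <= exp y)%R.
Proof. intros [H| ->]; [left; now apply exp_increasing|right; reflexivity]. Qed.

(** The mean value inequality is used twice along t u: first for e^(t u), which gives |e^(t u) - 1|
    <= 3 |u| with 3 bounding e, then for e^(t u) - t u. *)
Lemma cexp_remainder (u : C) : (Cmod u <= 1)%R ->
  (Cmod (cexp u - 1 - u) <= 3 * Cmod u * Cmod u)%R.
Proof.
  intros Hu. pose proof (Cmod_ge_0 u) as Pu.
  assert (H1 : forall t, (0 <= t <= 1)%R -> (Cmod (cexp (RtoC t * u) - 1) <= 3 * Cmod u)%R).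
  { intros t Ht.
    pose proof (DR_mean_value (fun s => cexp (RtoC s * u)) (fun s => u * cexp (RtoC s * u)) 0 t (3 * Cmod u)) as P.
    cbv beta in P. replace (RtoC 0 * u) with (RtoC 0) in P by ring. rewrite cexp_0 in P.
    eapply Rle_trans. apply P; try lra.
    - intros s Hs. apply DR_cexp_line.
    - intros s Hs. rewrite Cmod_mult, Rmult_comm. apply Rmult_le_compat_r; auto.
      rewrite Cmod_cexp. apply Rle_trans with (exp 1); [|apply exp_le_3].
      apply exp_le_compat. pose proof (re_le_Cmod (s * u)) as Q. rewrite Cmod_mult, Cmod_R, (Rabs_right s) in Q by lra.
      pose proof (Rle_abs (Re (s * u))). nra.
    - nra. }
  pose proof (DR_mean_value (fun s => cexp (RtoC s * u) - RtoC s * u) (fun s => u * cexp (RtoC s * u) - u) 0 1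
    (3 * Cmod u * Cmod u)) as P.
  cbv beta in P. replace (RtoC 0 * u) with (RtoC 0) in P by ring. rewrite cexp_0, Rminus_0_r, Rmult_1_r, Cmult_1_l in P.
  replace (cexp u - 1 - u) with (cexp u - u - (1 - 0)) by ring. apply P. lra.
  - intros s Hs. apply D_minus. apply DR_cexp_line.
    eapply D_eq. 2: apply D_mult; [apply D_coord|apply D_const]. simpl; ring.
  - intros s Hs. replace (u * cexp (s * u) - u) with ((cexp (s * u) - 1) * u) by ring.
    rewrite Cmod_mult. apply Rmult_le_compat_r; auto.
Qed.

Lemma Did_cexp (z : C) : Did cexp z (cexp z).
Proof.
  intros e He. set (m := Cmod (cexp z)).
  assert (Pm : (0 < m)%R) by (unfold m; rewrite Cmod_cexp; apply exp_pos).
  exists (Rmin 1 (e / (3 * m))); split.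
  { apply Rmin_glb_lt. lra. apply Rdiv_lt_0_compat; lra. }
  intros w Hw. assert (A1 := Rmin_l 1 (e / (3 * m))). assert (A2 := Rmin_r 1 (e / (3 * m))).
  set (u := w - z) in *.
  replace (cexp w - cexp z - cexp z * u) with (cexp z * (cexp u - 1 - u)).
  2: { replace w with (z + u) by (unfold u; ring). rewrite cexp_plus. ring. }
  rewrite Cmod_mult. fold m. pose proof (cexp_remainder u ltac:(lra)) as R1.
  pose proof (Cmod_ge_0 u).
  apply Rle_trans with (m * (3 * Cmod u * Cmod u))%R. apply Rmult_le_compat_l; lra.
  assert (Cmod u * (3 * m) <= e)%R.
  { apply Rle_trans with (e / (3 * m) * (3 * m))%R. apply Rmult_le_compat_r; lra. right; field; lra. }
  nra.
Qed.

Lemma D_cexp {T} (i f : T -> C) t l : D i f t l -> D i (fun s => cexp (f s)) t (cexp (f t) * l).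
Proof. intros H. apply (D_comp i cexp f); auto. apply Did_cexp. Qed.

(** * Integrals and Goursat's theorem *)

Notation Cint := (@RInt C_R_CompleteNormedModule).
Notation is_Cint := (@is_RInt C_R_NormedModule).

Lemma CR_continuous (f : R -> C) t : CR f t ->
  @continuous R_UniformSpace C_R_NormedModule f t.
Proof.
  intros H P HP. apply (locally_norm_le_locally (K := R_AbsRing) (V := C_R_NormedModule)) in HP.
  destruct HP as [e He]. destruct (H e (cond_pos e)) as (d & Hd & H1).
  exists (mkposreal d Hd). intros y Hy. apply He.
  unfold ball_norm. rewrite <- Cmod_norm. apply H1.
  rewrite <- RtoC_minus, Cmod_R. exact Hy.
Qed.

Lemma DR_is_derive (f : R -> C) t l : DR f t l ->
  @is_derive R_AbsRing C_R_NormedModule f t l.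
Proof.
  intros H. split. apply is_linear_scal_l.
  intros x Hx. assert (x = t).
  { symmetry. apply (is_filter_lim_locally_unique (K := R_AbsRing) (V := R_NormedModule)). exact Hx. }
  subst x. intros e. destruct (H e (cond_pos e)) as (d & Hd & H1).
  exists (mkposreal d Hd). intros y Hy. specialize (H1 y).
  rewrite <- RtoC_minus, Cmod_R in H1. specialize (H1 Hy).
  rewrite <- Cmod_norm.
  match goal with |- (Cmod ?x <= _)%R => replace x with (f y - f t - l * RtoC (y - t)) end.
  exact H1.
  apply injective_projections; simpl; unfold minus, plus, opp, scal; simpl; unfold mult; simpl; ring.
Qed.

Lemma ex_Cint (f : R -> C) a b : (a <= b)%R ->
  (forall t, (a <= t <= b)%R -> CR f t) -> is_Cint f a b (Cint f a b).
Proof.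
  intros Hab H. apply (@RInt_correct C_R_CompleteNormedModule).
  apply (@ex_RInt_continuous C_R_CompleteNormedModule). intros z Hz.
  rewrite Rmin_left, Rmax_right in Hz by lra. apply CR_continuous; auto.
Qed.

Lemma Cint_unique (f : R -> C) a b l : is_Cint f a b l -> Cint f a b = l.
Proof. apply (@is_RInt_unique C_R_CompleteNormedModule). Qed.

Lemma is_Cint_bound (f : R -> C) a b l M : (a <= b)%R ->
  (forall t, (a <= t <= b)%R -> (Cmod (f t) <= M)%R) -> is_Cint f a b l ->
  (Cmod l <= (b - a) * M)%R.
Proof.
  intros Hab H Hl. rewrite Cmod_norm. apply (norm_RInt_le_const f a b l M Hab); auto.
  intros x Hx. rewrite <- Cmod_norm. auto.
Qed.

Lemma is_Cint_ext (f g : R -> C) a b l : (a <= b)%R ->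
  (forall t, (a <= t <= b)%R -> f t = g t) -> is_Cint f a b l -> is_Cint g a b l.
Proof.
  intros Hab H. apply is_RInt_ext. intros x Hx.
  rewrite Rmin_left, Rmax_right in Hx by lra. apply H. lra.
Qed.

Lemma is_Cint_minus (f g : R -> C) a b l m : is_Cint f a b l -> is_Cint g a b m ->
  is_Cint (fun t => f t - g t) a b (l - m).
Proof. apply (@is_RInt_minus C_R_NormedModule). Qed.

(** The integral lives in a module over the reals, so a complex constant is pulled out through the
    real and imaginary components. *)
Lemma is_Cint_scal (c : C) (f : R -> C) a b l : is_Cint f a b l ->
  is_Cint (fun t => c * f t) a b (c * l).
Proof.
  intros H.
  pose proof (is_RInt_fct_extend_fst (U := R_NormedModule) (V := R_NormedModule) f a b l H) as H1.
  pose proof (is_RInt_fct_extend_snd (U := R_NormedModule) (V := R_NormedModule) f a b l H) as H2.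
  apply (is_RInt_fct_extend_pair (U := R_NormedModule) (V := R_NormedModule)).
  - apply (is_RInt_minus (V := R_NormedModule)); apply (is_RInt_scal (V := R_NormedModule)); auto.
  - apply (is_RInt_plus (V := R_NormedModule)); apply (is_RInt_scal (V := R_NormedModule)); auto.
Qed.

Lemma is_Cint_FTC (f df : R -> C) a b : (a <= b)%R ->
  (forall t, (a <= t <= b)%R -> DR f t (df t)) ->
  (forall t, (a <= t <= b)%R -> CR df t) -> is_Cint df a b (f b - f a).
Proof.
  intros Hab H Hc. apply (@is_RInt_derive C_R_CompleteNormedModule f df a b);
    intros x Hx; rewrite Rmin_left, Rmax_right in Hx by lra.
  - apply DR_is_derive; auto.
  - apply CR_continuous; auto.
Qed.

Lemma CR_bounded (f : R -> C) a b : (forall t, (a <= t <= b)%R -> CR f t) ->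
  exists M, (0 < M)%R /\ forall t, (a <= t <= b)%R -> (Cmod (f t) <= M)%R.
Proof.
  intros H.
  destruct (@bounded_continuity R_AbsRing C_R_NormedModule f a b) as [M HM].
  - intros x Hx. apply CR_continuous; auto.
  - exists (Rabs M + 1)%R. split. pose proof (Rabs_pos M); lra.
    intros t Ht. specialize (HM t Ht). rewrite Cmod_norm.
    pose proof (Rle_abs M). eapply Rle_trans; [apply Rlt_le, HM|lra].
Qed.

(** Uniform continuity at the points of a compact curve, where [y] may leave the curve. The
    compactness of [a, b] is used in the doubly negated form of [compactness_value_1d], hence the
    appeal to [NNPP]. *)
Lemma Cid_uniform_on_curve (f : C -> C) (x : R -> C) a b :
  (forall t, (a <= t <= b)%R -> CR x t) ->
  (forall t, (a <= t <= b)%R -> Cid f (x t)) ->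
  forall e, (0 < e)%R -> exists d, (0 < d)%R /\
    forall t y, (a <= t <= b)%R -> (Cmod (y - x t) < d)%R -> (Cmod (f y - f (x t)) < e)%R.
Proof.
  intros Hx Hf e He.
  assert (G : forall u, exists d : posreal, (a <= u <= b)%R ->
     (forall y t, (Rabs (t - u) < d)%R -> (Cmod (y - x t) < d)%R ->
        (Cmod (f y - f (x u)) < e / 2)%R /\ (Cmod (f (x t) - f (x u)) < e / 2)%R)).
  { intros u. destruct (classic (a <= u <= b)%R) as [Hu|Hu].
    2: { exists (mkposreal 1 Rlt_0_1). tauto. }
    destruct (Hf u Hu (e / 2)%R) as (d1 & Hd1 & H1). lra.
    destruct (Hx u Hu (d1 / 2)%R) as (d2 & Hd2 & H2). lra.
    assert (P : (0 < Rmin (d1 / 2) d2)%R) by (apply Rmin_glb_lt; lra).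
    exists (mkposreal _ P). intros _ y t Ht Hy. simpl in *.
    assert (A1 := Rmin_l (d1 / 2) d2). assert (A2 := Rmin_r (d1 / 2) d2).
    specialize (H2 t). rewrite <- RtoC_minus, Cmod_R in H2. specialize (H2 ltac:(lra)).
    pose proof (Cmod_sub_triangle y (x t) (x u)).
    split; apply H1; lra. }
  destruct (ClassicalEpsilon.choice _ G) as [g Hg].
  destruct (compactness_value_1d a b g) as [d Hd].
  exists d; split. apply cond_pos. intros t y Ht Hy.
  apply NNPP. intros Hn. apply (Hd t Ht). intros (u & Hu & H1 & H2). apply Hn.
  destruct (Hg u Hu y t H1 ltac:(lra)) as [B1 B2].
  pose proof (Cmod_sub_triangle (f y) (f (x u)) (f (x t))).
  rewrite (Cmod_sub_sym (f (x u))) in H. lra.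
Qed.

(** The intervals of centre [x n] and radius 2 K / 2^n are nested. The limit is the supremum of
    their left endpoints, so the error bound comes with it. *)
Lemma R_dyadic_limit (x : nat -> R) (K : R) :
  (forall n, (Rabs (x (S n) - x n) <= K * (/ 2) ^ n)%R) ->
  exists l, forall n, (Rabs (x n - l) <= 2 * K * (/ 2) ^ n)%R.
Proof.
  intros H.
  assert (Step : forall n, (x n - 2 * K * (/2)^n <= x (S n) - 2 * K * (/2)^(S n) /\
    x (S n) + 2 * K * (/2)^(S n) <= x n + 2 * K * (/2)^n)%R).
  { intros n. specialize (H n). simpl. apply Rabs_le_between in H. lra. }
  assert (Mono : forall n m, (x n - 2 * K * (/2)^n <= x (n + m)%nat - 2 * K * (/2)^(n + m) /\
    x (n + m)%nat + 2 * K * (/2)^(n + m) <= x n + 2 * K * (/2)^n)%R).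
  { intros n m. induction m. rewrite Nat.add_0_r. lra.
    rewrite Nat.add_succ_r. specialize (Step (n + m)%nat). lra. }
  assert (PK : (0 <= K)%R). { specialize (H O). simpl in H. pose proof (Rabs_pos (x 1%nat - x O)). lra. }
  assert (PP : forall n, (0 <= K * (/2)^n)%R). { intros n. apply Rmult_le_pos; auto. apply pow_le; lra. }
  assert (Cross : forall n m, (x n - 2 * K * (/2)^n <= x m + 2 * K * (/2)^m)%R).
  { intros n m. destruct (Mono n m) as [A _]. destruct (Mono m n) as [_ B].
    rewrite (Nat.add_comm m n) in B. pose proof (PP (n + m)%nat). lra. }
  destruct (completeness (fun y => exists n, y = x n - 2 * K * (/2)^n)%R) as [l [L1 L2]].
  - exists (x O + 2 * K * (/2)^0)%R. intros y [n ->]. apply Cross.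
  - exists (x O - 2 * K * (/2)^0)%R. now exists O.
  - exists l. intros n. apply Rabs_le_between. split.
    + assert (l <= x n + 2 * K * (/2)^n)%R. { apply L2. intros y [m ->]. apply Cross. } lra.
    + assert (x n - 2 * K * (/2)^n <= l)%R. { apply L1. now exists n. } lra.
Qed.

Lemma C_dyadic_limit (u : nat -> C) (K : R) :
  (forall n, (Cmod (u (S n) - u n) <= K * (/ 2) ^ n)%R) ->
  exists l, forall n, (Cmod (u n - l) <= 4 * K * (/ 2) ^ n)%R.
Proof.
  intros H.
  assert (B : forall z : C, (Rabs (fst z) <= Cmod z /\ Rabs (snd z) <= Cmod z)%R).
  { intros z. pose proof (Rmax_Cmod z). pose proof (Rmax_l (Rabs (fst z)) (Rabs (snd z))).
    pose proof (Rmax_r (Rabs (fst z)) (Rabs (snd z))). lra. }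
  destruct (R_dyadic_limit (fun n => fst (u n)) K) as [l1 H1].
  { intros n. eapply Rle_trans; [|apply H]. apply (B (u (S n) - u n)). }
  destruct (R_dyadic_limit (fun n => snd (u n)) K) as [l2 H2].
  { intros n. eapply Rle_trans; [|apply H]. apply (B (u (S n) - u n)). }
  exists (l1, l2). intros n. eapply Rle_trans. apply Cmod_le_components.
  specialize (H1 n). specialize (H2 n). simpl. unfold Rminus in H1, H2. lra.
Qed.

Lemma half_pow_small (K e : R) : (0 < e)%R -> exists n, (K * (/ 2) ^ n < e)%R.
Proof.
  intros He. destruct (pow_lt_1_zero (/ 2) ltac:(rewrite Rabs_right; lra) (e / (Rabs K + 1))) as [N HN].
  { apply Rdiv_lt_0_compat; auto. pose proof (Rabs_pos K); lra. }
  exists N. specialize (HN N (le_n _)). pose proof (Rabs_pos K). pose proof (Rle_abs K).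
  assert (P : (0 < (/2)^N)%R) by (apply pow_lt; lra).
  rewrite Rabs_right in HN by lra.
  apply Rle_lt_trans with ((Rabs K + 1) * (/2)^N)%R. apply Rmult_le_compat_r; lra.
  apply Rmult_lt_compat_l with (r := (Rabs K + 1)%R) in HN; [|lra].
  replace ((Rabs K + 1) * (e / (Rabs K + 1)))%R with e in HN by (field; lra). auto.
Qed.

Lemma Cmod_seg_le (a b : C) (t M : R) : (0 <= t <= 1)%R ->
  (Cmod a <= M)%R -> (Cmod b <= M)%R -> (Cmod (seg a b t) <= M)%R.
Proof.
  intros Ht Ha Hb. unfold seg.
  replace (a + t * (b - a)) with (RtoC (1 - t) * a + RtoC t * b) by (rewrite RtoC_minus; ring).
  eapply Rle_trans. apply Cmod_triangle. rewrite !Cmod_mult, !Cmod_R, !Rabs_right by lra.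
  nra.
Qed.

Lemma in_disk_seg (a b : C) (t : R) : (0 <= t <= 1)%R ->
  in_disk a -> in_disk b -> in_disk (seg a b t).
Proof.
  unfold in_disk. intros Ht Ha Hb.
  apply Rle_lt_trans with (Rmax (Cmod a) (Cmod b)).
  apply Cmod_seg_le; auto. apply Rmax_l. apply Rmax_r. now apply Rmax_lub_lt.
Qed.

Lemma Cmod_seg_sub (a b : C) (t : R) : (0 <= t <= 1)%R -> (Cmod (seg a b t - a) <= Cmod (b - a))%R.
Proof.
  intros Ht. unfold seg. replace (a + t * (b - a) - a) with (t * (b - a)) by ring.
  rewrite Cmod_mult, Cmod_R, Rabs_right by lra. pose proof (Cmod_ge_0 (b - a)). nra.
Qed.

Definition segint (f : C -> C) (a b : C) : C :=
  (b - a) * Cint (fun t => f (seg a b t)) 0 1.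

Section Goursat.
Variable f : C -> C.
Hypothesis f_cont : forall z, in_disk z -> Cid f z.

Lemma CR_f_seg (a b : C) (t : R) : (0 <= t <= 1)%R -> in_disk a -> in_disk b ->
  CR (fun s => f (seg a b s)) t.
Proof.
  intros Ht Ha Hb. apply (Ct_comp RtoC f (seg a b)). eapply D_Ct, DR_seg.
  now apply f_cont, in_disk_seg.
Qed.

Lemma is_segint (a b : C) : in_disk a -> in_disk b ->
  is_Cint (fun t => f (seg a b t)) 0 1 (Cint (fun t => f (seg a b t)) 0 1).
Proof. intros Ha Hb. apply ex_Cint. lra. intros t Ht. now apply CR_f_seg. Qed.

Lemma segint_swap (a b : C) : in_disk a -> in_disk b -> segint f b a = - segint f a b.
Proof.
  intros Ha Hb. unfold segint.
  assert (E : Cint (fun t => f (seg b a t)) 0 1 = Cint (fun t => f (seg a b t)) 0 1).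
  { apply Cint_unique.
    pose proof (is_RInt_swap _ _ _ _ (is_segint a b Ha Hb)) as H.
    pose proof (is_RInt_comp_lin (V := C_R_NormedModule) (fun t => f (seg a b t)) (-1) 1 0 1) as H1.
    replace (-1 * 0 + 1)%R with 1%R in H1 by ring. replace (-1 * 1 + 1)%R with 0%R in H1 by ring.
    specialize (H1 _ H). apply (is_Cint_scal (- (1))) in H1.
    assert (X : forall v : C, - (1) * @opp C_R_NormedModule v = v).
    { intros v. change (- (1) * (- v) = v). ring. }
    rewrite X in H1.
    revert H1. apply is_Cint_ext. lra. intros t Ht.
    replace (seg a b (-1 * t + 1)) with (seg b a t).
    2: { unfold seg. replace (-1 * t + 1)%R with (1 - t)%R by ring. rewrite RtoC_minus. ring. }
    apply injective_projections; simpl; unfold scal; simpl; unfold mult; simpl; ring. }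
  rewrite E. ring.
Qed.

Lemma segint_half (a b : C) (m := (a + b) / 2) : in_disk a -> in_disk b ->
  segint f a b = segint f a m + segint f m b.
Proof.
  intros Ha Hb. unfold segint.
  assert (Em : m = seg a b (/ 2)).
  { unfold m, seg. rewrite RtoC_inv by lra. field. }
  assert (Hm : in_disk m). { rewrite Em. apply in_disk_seg; auto. lra. }
  assert (A : forall c d, (0 <= c)%R -> (c + d <= 1)%R -> (0 <= d)%R ->
    is_Cint (fun t => f (seg a b t)) c (c + d) (Cint (fun t => f (seg a b t)) c (c + d))).
  { intros c d Hc Hd Hd'. apply ex_Cint. lra. intros t Ht. apply CR_f_seg; auto. lra. }
  assert (B1 : Cint (fun t => f (seg a m t)) 0 1 = 2 * Cint (fun t => f (seg a b t)) 0 (/2)).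
  { apply Cint_unique. pose proof (is_RInt_comp_lin (V := C_R_NormedModule) (fun t => f (seg a b t)) (/2) 0 0 1) as H1.
    replace (/ 2 * 0 + 0)%R with 0%R in H1 by ring. replace (/ 2 * 1 + 0)%R with (/2)%R in H1 by ring.
    specialize (A 0%R (/2)%R ltac:(lra) ltac:(lra) ltac:(lra)). rewrite Rplus_0_l in A.
    specialize (H1 _ A). apply (is_Cint_scal 2) in H1. revert H1. apply is_Cint_ext. lra.
    intros t Ht. replace (seg a m t) with (seg a b (/2 * t + 0)).
    2: { rewrite Em. unfold seg. rewrite RtoC_plus, RtoC_mult. ring. }
    apply injective_projections; simpl; unfold scal; simpl; unfold mult; simpl; field. }
  assert (B2 : Cint (fun t => f (seg m b t)) 0 1 = 2 * Cint (fun t => f (seg a b t)) (/2) 1).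
  { apply Cint_unique. pose proof (is_RInt_comp_lin (V := C_R_NormedModule) (fun t => f (seg a b t)) (/2) (/2) 0 1) as H1.
    replace (/ 2 * 0 + /2)%R with (/2)%R in H1 by ring. replace (/ 2 * 1 + /2)%R with 1%R in H1 by field.
    specialize (A (/2)%R (/2)%R ltac:(lra) ltac:(lra) ltac:(lra)). replace (/2 + /2)%R with 1%R in A by field.
    specialize (H1 _ A). apply (is_Cint_scal 2) in H1. revert H1. apply is_Cint_ext. lra.
    intros t Ht. replace (seg m b t) with (seg a b (/2 * t + /2)).
    2: { rewrite Em. unfold seg. rewrite RtoC_plus, RtoC_mult, RtoC_inv by lra. field. }
    apply injective_projections; simpl; unfold scal; simpl; unfold mult; simpl; field. }
  assert (B3 : Cint (fun t => f (seg a b t)) 0 1 =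
     Cint (fun t => f (seg a b t)) 0 (/2) + Cint (fun t => f (seg a b t)) (/2) 1).
  { apply Cint_unique. apply (@is_RInt_Chasles C_R_NormedModule _ _ (/2)).
    specialize (A 0%R (/2)%R ltac:(lra) ltac:(lra) ltac:(lra)). rewrite Rplus_0_l in A. exact A.
    specialize (A (/2)%R (/2)%R ltac:(lra) ltac:(lra) ltac:(lra)). replace (/2 + /2)%R with 1%R in A by field. exact A. }
  rewrite B1, B2, B3. unfold m. field.
Qed.

(** Comparison with an entire [g] that has an explicit primitive [G]: an affine [g] in Goursat's
    theorem, a constant one in the construction of the primitive. *)
Lemma segint_approx (g G : C -> C) (a b : C) (M : R) : in_disk a -> in_disk b ->
  (forall z, Did G z (g z)) -> (forall z, Cid g z) ->
  (forall t, (0 <= t <= 1)%R -> (Cmod (f (seg a b t) - g (seg a b t)) <= M)%R) ->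
  (Cmod (segint f a b - (G b - G a)) <= M * Cmod (b - a))%R.
Proof.
  intros Ha Hb HG Hg HM.
  assert (E : is_Cint (fun t => (b - a) * g (seg a b t)) 0 1 (G b - G a)).
  { pose proof (is_Cint_FTC (fun t => G (seg a b t)) (fun t => (b - a) * g (seg a b t)) 0 1 ltac:(lra)) as P.
    cbv beta in P.
    replace (seg a b 1) with b in P by (unfold seg; ring).
    replace (seg a b 0) with a in P by (unfold seg; ring). apply P.
    - intros t Ht. eapply D_eq. 2: apply D_comp; [apply DR_seg|apply HG]. ring.
    - intros t Ht. apply Ct_mult. apply Ct_const. apply (Ct_comp RtoC g (seg a b)).
      eapply D_Ct, DR_seg. apply Hg. }
  pose proof (is_Cint_minus _ _ _ _ _ _ (is_Cint_scal (b - a) _ _ _ _ (is_segint a b Ha Hb)) E) as E2.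
  eapply Rle_trans. refine (is_Cint_bound _ _ _ _ (M * Cmod (b - a)) _ _ E2). lra.
  - intros t Ht. replace ((b - a) * f (seg a b t) - (b - a) * g (seg a b t)) with
      ((f (seg a b t) - g (seg a b t)) * (b - a)) by ring.
    rewrite Cmod_mult. apply Rmult_le_compat_r; auto. apply Cmod_ge_0.
  - lra.
Qed.

Definition tri (a b c : C) : C := segint f a b + segint f b c + segint f c a.

Definition tri3 : Type := (C * C * C)%type.
Definition triT (x : tri3) : C := let '(a, b, c) := x in tri a b c.
Definition tri_perim (x : tri3) : R :=
  let '(a, b, c) := x in (Cmod (b - a) + Cmod (c - b) + Cmod (a - c))%R.
Definition tri_within (M : R) (x : tri3) : Prop :=
  let '(a, b, c) := x in (Cmod a <= M /\ Cmod b <= M /\ Cmod c <= M)%R.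
Definition tri_vertex (x : tri3) : C := let '(a, _, _) := x in a.

Lemma Cmod_half (z : C) : Cmod (z / 2) = (Cmod z / 2)%R.
Proof.
  unfold Cdiv. rewrite Cmod_mult, <- RtoC_inv, Cmod_R, Rabs_right by lra. reflexivity.
Qed.

(** Joining the midpoints of the sides cuts the triangle into four whose boundary integrals add up
    to the original one, so one of them carries at least a quarter of it. Inclusion of triangles is
    not tracked: the common disk of radius [M] and the displacement of the first vertex suffice to
    produce the limit point. *)
Lemma tri_child (M : R) (x : tri3) : (M < 1)%R -> tri_within M x -> exists y : tri3,
  tri_within M y /\ (Cmod (triT x) <= 4 * Cmod (triT y))%R /\
  tri_perim y = (tri_perim x / 2)%R /\ (Cmod (tri_vertex y - tri_vertex x) <= tri_perim x)%R.
Proof.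
  intros HM. destruct x as [[a b] c]. intros (Ha & Hb & Hc).
  assert (Mid : forall p q, (Cmod p <= M)%R -> (Cmod q <= M)%R -> (Cmod ((p + q) / 2) <= M)%R).
  { intros p q Hp Hq. rewrite Cmod_half. pose proof (Cmod_triangle p q). lra. }
  set (ab := (a + b) / 2). set (bc := (b + c) / 2). set (ca := (c + a) / 2).
  assert (Hab : (Cmod ab <= M)%R) by (apply Mid; auto).
  assert (Hbc : (Cmod bc <= M)%R) by (apply Mid; auto).
  assert (Hca : (Cmod ca <= M)%R) by (apply Mid; auto).
  assert (E : tri a b c = tri a ab ca + tri ab b bc + tri bc c ca + tri ab bc ca).
  { unfold tri, in_disk in *.
    rewrite (segint_half a b), (segint_half b c), (segint_half c a) by (unfold in_disk; lra).
    fold ab bc ca.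
    rewrite (segint_swap ab ca), (segint_swap ab bc), (segint_swap bc ca) by (unfold in_disk; lra). ring. }
  assert (P1 : forall p q r s, (p - q) = (r - s) / 2 -> Cmod (p - q) = (Cmod (r - s) / 2)%R).
  { intros p q r s ->. apply Cmod_half. }
  assert (Q : (4 * Cmod (tri a ab ca) >= Cmod (tri a b c) \/ 4 * Cmod (tri ab b bc) >= Cmod (tri a b c) \/
    4 * Cmod (tri bc c ca) >= Cmod (tri a b c) \/ 4 * Cmod (tri ab bc ca) >= Cmod (tri a b c))%R).
  { pose proof (Cmod_triangle (tri a ab ca + tri ab b bc + tri bc c ca) (tri ab bc ca)) as H1.
    pose proof (Cmod_triangle3 (tri a ab ca) (tri ab b bc) (tri bc c ca)) as H2.
    rewrite <- E in H1. lra. }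
  pose proof (Cmod_ge_0 (b - a)). pose proof (Cmod_ge_0 (c - b)). pose proof (Cmod_ge_0 (a - c)).
  assert (F1 : Cmod (ab - a) = (Cmod (b - a) / 2)%R) by (apply P1; unfold ab; field).
  assert (F2 : Cmod (ca - ab) = (Cmod (c - b) / 2)%R) by (apply P1; unfold ab, ca; field).
  assert (F3 : Cmod (a - ca) = (Cmod (a - c) / 2)%R) by (apply P1; unfold ca; field).
  assert (F4 : Cmod (b - ab) = (Cmod (b - a) / 2)%R) by (apply P1; unfold ab; field).
  assert (F5 : Cmod (bc - b) = (Cmod (c - b) / 2)%R) by (apply P1; unfold bc; field).
  assert (F6 : Cmod (ab - bc) = (Cmod (a - c) / 2)%R) by (apply P1; unfold ab, bc; field).
  assert (F7 : Cmod (c - bc) = (Cmod (c - b) / 2)%R) by (apply P1; unfold bc; field).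
  assert (F8 : Cmod (ca - c) = (Cmod (a - c) / 2)%R) by (apply P1; unfold ca; field).
  assert (F9 : Cmod (bc - ca) = (Cmod (b - a) / 2)%R) by (apply P1; unfold bc, ca; field).
  assert (F10 : (Cmod (bc - a) <= Cmod (b - a) + Cmod (c - b))%R).
  { pose proof (Cmod_sub_triangle bc b a). lra. }
  destruct Q as [Q|[Q|[Q|Q]]].
  - exists (a, ab, ca). simpl. replace (a - a) with (RtoC 0) by ring. rewrite Cmod_0, F1, F2, F3.
    repeat split; auto; lra.
  - exists (ab, b, bc). simpl. rewrite F1, F4, F5, F6. repeat split; auto; lra.
  - exists (bc, c, ca). simpl. rewrite F7, F8, F9. repeat split; auto; lra.
  - exists (ab, bc, ca). simpl.
    rewrite (Cmod_sub_sym bc ab), (Cmod_sub_sym ca bc), (Cmod_sub_sym ab ca), F1, F2, F6, F9.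
    repeat split; auto; lra.
Qed.

Hypothesis f_diff : forall z, in_disk z -> exists l, Did f z l.

Lemma goursat (a b c : C) : in_disk a -> in_disk b -> in_disk c -> tri a b c = 0.
Proof.
  intros Ha Hb Hc.
  set (M := Rmax (Cmod a) (Rmax (Cmod b) (Cmod c))).
  assert (HM : (M < 1)%R). { unfold M. apply Rmax_lub_lt; auto. now apply Rmax_lub_lt. }
  assert (H0 : tri_within M (a, b, c)).
  { unfold M. simpl. repeat split. apply Rmax_l.
    eapply Rle_trans; [|apply Rmax_r]. apply Rmax_l. eapply Rle_trans; [|apply Rmax_r]. apply Rmax_r. }
  assert (Ch : forall x : tri3, exists y : tri3, tri_within M x -> tri_within M y /\ (Cmod (triT x) <= 4 * Cmod (triT y))%R /\
    tri_perim y = (tri_perim x / 2)%R /\ (Cmod (tri_vertex y - tri_vertex x) <= tri_perim x)%R).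
  { intros x. destruct (classic (tri_within M x)) as [Hx|Hx].
    destruct (tri_child M x HM Hx) as [y Hy]. exists y; auto. exists x; tauto. }
  destruct (ClassicalEpsilon.choice _ Ch) as [next Hn].
  set (s := fun n => Nat.iter n next (a, b, c)).
  set (p := tri_perim (a, b, c)).
  assert (I : forall n, tri_within M (s n) /\ (Cmod (tri a b c) * (/4)^n <= Cmod (triT (s n)))%R /\
     tri_perim (s n) = (p * (/2)^n)%R).
  { induction n. simpl. repeat split; try apply H0; unfold p; simpl; lra.
    destruct IHn as (I1 & I2 & I3). destruct (Hn _ I1) as (J1 & J2 & J3 & _).
    change (s (S n)) with (next (s n)). repeat split; auto. simpl. lra. rewrite J3, I3. simpl; field. }
  destruct (C_dyadic_limit (fun n => tri_vertex (s n)) p) as [z Hz].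
  { intros n. destruct (I n) as (I1 & _ & I3). destruct (Hn _ I1) as (_ & _ & _ & J4).
    change (s (S n)) with (next (s n)). rewrite <- I3. auto. }
  assert (Pp : (0 <= p)%R).
  { unfold p; simpl. pose proof (Cmod_ge_0 (b - a)). pose proof (Cmod_ge_0 (c - b)). pose proof (Cmod_ge_0 (a - c)). lra. }
  assert (Hzd : in_disk z).
  { destruct (half_pow_small (4 * p) (1 - M)) as [n Hn']. lra.
    specialize (Hz n). destruct (I n) as (I1 & _). destruct (s n) as [[a' b'] c']. simpl in *.
    pose proof (Cmod_reverse_triangle z a'). rewrite Cmod_sub_sym in Hz. unfold in_disk. lra. }
  destruct (f_diff z Hzd) as [l Hl].
  apply Cmod_eq_0. apply Rle_antisym; [|apply Cmod_ge_0].
  apply Rnot_lt_le. intros Hpos.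
  set (eta := Cmod (tri a b c)) in *.
  (* The final estimate bounds [eta] by 5 p^2 e, which this choice makes smaller than [eta]; the
     added 1 covers p = 0. *)
  set (e := (eta / (5 * p * p + 1))%R).
  assert (Hpp : (0 <= 5 * p * p)%R) by nra.
  assert (Pe : (0 < e)%R). { unfold e. apply Rdiv_lt_0_compat; lra. }
  destruct (Hl e Pe) as (d & Hd & H1).
  (* The boundary of the n-th triangle lies within p / 2^n of its first vertex, which lies within 4
     p / 2^n of [z]. *)
  destruct (half_pow_small (5 * p) d Hd) as [n Hnd].
  destruct (I n) as (I1 & I2 & I3). specialize (Hz n).
  destruct (s n) as [[a' b'] c'] eqn:Es. simpl in I1, I2, I3, Hz.
  set (q := ((/2)^n)%R) in *.
  assert (Pq : (0 < q)%R) by (apply pow_lt; lra).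
  assert (Eq : ((/4)^n = q * q)%R). { unfold q. rewrite <- Rpow_mult_distr. f_equal. field. }
  (* The affine approximation of [f] at [z] has the primitive [G], so it contributes nothing around
     a closed triangle and only the error of size e |w - z| remains. *)
  set (g := fun w => f z + l * (w - z)). set (G := fun w => f z * w + l * (w * w / 2 - z * w)).
  assert (HG : forall w, Did G w (g w)).
  { intros w. unfold G, g. eapply D_eq. 2: { apply D_plus. apply D_scal, D_coord. apply D_scal.
    apply D_minus. apply D_mult. apply D_mult; apply D_coord. apply D_const. apply D_scal, D_coord. } cbv beta.
    field. }
  assert (Hg : forall w, Cid g w).
  { intros w. unfold g. apply Ct_plus. apply Ct_const. apply Ct_mult. apply Ct_const.
    apply Ct_minus. apply Ct_coord. apply Ct_const. }
  destruct I1 as (Ia & Ib & Ic).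
  pose proof (Cmod_ge_0 (b' - a')) as Q1. pose proof (Cmod_ge_0 (c' - b')) as Q2. pose proof (Cmod_ge_0 (a' - c')) as Q3.
  assert (Side : forall u v, (Cmod u <= M)%R -> (Cmod v <= M)%R ->
     (Cmod (u - a') + Cmod (v - u) <= p * q)%R ->
     (Cmod (segint f u v - (G v - G u)) <= e * (5 * p * q) * Cmod (v - u))%R).
  { intros u v Hu Hv Huv. apply segint_approx with (g := g); auto.
    unfold in_disk; lra. unfold in_disk; lra.
    intros t Ht. set (w := seg u v t).
    assert (Hw : (Cmod (w - z) <= 5 * p * q)%R).
    { pose proof (Cmod_sub_triangle w a' z). pose proof (Cmod_sub_triangle w u a').
      pose proof (Cmod_seg_sub u v t Ht). fold w in H3. lra. }
    replace (f w - g w) with (f w - f z - l * (w - z)) by (unfold g; ring).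
    eapply Rle_trans. apply H1. lra. apply Rmult_le_compat_l; lra. }
  assert (Sum : (Cmod (tri a' b' c') <= e * (5 * p * q) * (p * q))%R).
  { replace (tri a' b' c') with ((segint f a' b' - (G b' - G a')) + (segint f b' c' - (G c' - G b')) +
      (segint f c' a' - (G a' - G c'))) by (unfold tri; ring).
    eapply Rle_trans. apply Cmod_triangle3. rewrite <- I3.
    assert (S1 := Side a' b' Ia Ib). assert (S2 := Side b' c' Ib Ic). assert (S3 := Side c' a' Ic Ia).
    replace (a' - a') with (RtoC 0) in S1 by ring. rewrite Cmod_0 in S1.
    rewrite (Cmod_sub_sym c' a') in S3.
    specialize (S1 ltac:(lra)). specialize (S2 ltac:(lra)).
    assert (T3 : (Cmod (a' - c') <= Cmod (b' - a') + Cmod (c' - b'))%R).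
    { pose proof (Cmod_sub_triangle a' b' c'). rewrite (Cmod_sub_sym a' b'), (Cmod_sub_sym b' c') in H. lra. }
    specialize (S3 ltac:(lra)). lra. }
  rewrite Eq in I2.
  assert (H2 : (eta * (q * q) <= e * (5 * p * p) * (q * q))%R) by lra.
  apply Rmult_le_reg_r in H2; [|nra].
  assert (H3 : (e * (5 * p * p + 1) = eta)%R) by (unfold e; field; lra).
  lra.
Qed.

(** By Goursat's theorem on the triangle 0, z, w, the increment of the primitive is the integral
    over [z, w], where [f] is close to the constant f z. *)
Lemma Did_primitive (z : C) : in_disk z -> Did (segint f 0) z (f z).
Proof.
  intros Hz e He.
  destruct (f_cont z Hz e He) as (d & Hd & H1).
  assert (Hz0 : in_disk 0) by (unfold in_disk; rewrite Cmod_0; lra).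
  exists (Rmin d (1 - Cmod z)); split. { apply Rmin_glb_lt; auto. unfold in_disk in Hz. lra. }
  intros w Hw. assert (A1 := Rmin_l d (1 - Cmod z)). assert (A2 := Rmin_r d (1 - Cmod z)).
  assert (Hwd : in_disk w). { unfold in_disk. pose proof (Cmod_reverse_triangle w z). lra. }
  pose proof (goursat 0 z w Hz0 Hz Hwd) as T. unfold tri in T.
  rewrite (segint_swap 0 w Hz0 Hwd) in T.
  assert (E : segint f 0 w - segint f 0 z = segint f z w).
  { replace (segint f 0 w - segint f 0 z) with
      (segint f z w - (segint f 0 z + segint f z w + - segint f 0 w)) by ring.
    rewrite T. ring. }
  rewrite E.
  replace (segint f z w - f z * (w - z)) with (segint f z w - (f z * w - f z * z)) by ring.
  apply segint_approx with (g := fun _ => f z) (G := fun u => f z * u); auto.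
  - intros u. eapply D_eq. 2: apply D_scal, D_coord. ring.
  - intros u. apply Ct_const.
  - intros t Ht. left. apply H1. pose proof (Cmod_seg_sub z w t Ht). lra.
Qed.

End Goursat.

(** * Cauchy's formula and the Schwarz lemma *)

Definition circ (r t : R) : C := RtoC r * cexp (RtoC t * Ci).

Lemma Cmod_circ (r t : R) : (0 <= r)%R -> Cmod (circ r t) = r.
Proof.
  intros Hr. unfold circ. rewrite Cmod_mult, Cmod_R, Cmod_cexp, Rabs_right by lra.
  replace (Re (t * Ci)) with 0%R by (unfold Re, Ci; simpl; ring). rewrite exp_0. ring.
Qed.

Lemma DR_circ (r t : R) : DR (circ r) t (Ci * circ r t).
Proof.
  unfold circ. eapply D_eq. 2: apply D_scal, DR_cexp_line. ring.
Qed.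

Lemma CR_circ (r t : R) : CR (circ r) t.
Proof. eapply D_Ct, DR_circ. Qed.

Lemma circ_period (r : R) : circ r (2 * PI) = circ r 0.
Proof.
  unfold circ, cexp, Ci; simpl.
  replace (2 * PI * 0 - 0 * 1)%R with (0 * 0 - 0 * 1)%R by ring.
  replace (2 * PI * 1 + 0 * 0)%R with (2 * PI)%R by ring.
  replace (0 * 1 + 0 * 0)%R with 0%R by ring.
  now rewrite cos_2PI, sin_2PI, cos_0, sin_0.
Qed.

Lemma Ci_neq_0 : Ci <> 0.
Proof. apply Cmod_gt_0. rewrite Cmod_Ci. lra. Qed.

Lemma two_PI_pos : (0 <= 2 * PI)%R.
Proof. pose proof PI_RGT_0. lra. Qed.

(** Differentiation under the integral sign. The first-order remainder of the integrand is asked to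
    be quadratic uniformly in [t], which rational kernels satisfy by an algebraic identity. *)
Lemma Did_param (k : R -> C -> C) (k1 : R -> C) (a : C) (K d : R) : (0 < d)%R ->
  (forall b t, (Cmod (b - a) < d)%R -> (0 <= t <= 2 * PI)%R -> CR (fun s => k s b) t) ->
  (forall t, (0 <= t <= 2 * PI)%R -> CR k1 t) ->
  (forall b t, (Cmod (b - a) < d)%R -> (0 <= t <= 2 * PI)%R ->
     (Cmod (k t b - k t a - k1 t * (b - a)) <= K * (Cmod (b - a) * Cmod (b - a)))%R) ->
  Did (fun b => Cint (fun t => k t b) 0 (2 * PI)) a (Cint k1 0 (2 * PI)).
Proof.
  intros Hd Hk Hk1 H e He. pose proof PI_RGT_0 as PP.
  set (L := (2 * PI * (Rabs K + 1))%R).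
  assert (PK := Rabs_pos K). assert (PL : (0 < L)%R) by (unfold L; nra).
  exists (Rmin d (e / L)); split. { apply Rmin_glb_lt; auto. apply Rdiv_lt_0_compat; lra. }
  intros b Hb. assert (A1 := Rmin_l d (e / L)). assert (A2 := Rmin_r d (e / L)).
  assert (Haa : (Cmod (a - a) < d)%R). { replace (a - a) with (RtoC 0) by ring. rewrite Cmod_0; auto. }
  pose proof (ex_Cint (fun t => k t b) 0 (2 * PI) two_PI_pos (fun t => Hk b t ltac:(lra))) as I1.
  pose proof (ex_Cint (fun t => k t a) 0 (2 * PI) two_PI_pos (fun t => Hk a t Haa)) as I2.
  pose proof (is_Cint_scal (b - a) _ _ _ _ (ex_Cint k1 0 (2 * PI) two_PI_pos Hk1)) as I3.
  pose proof (is_Cint_minus _ _ _ _ _ _ (is_Cint_minus _ _ _ _ _ _ I1 I2) I3) as I4.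
  rewrite (Cmult_comm (Cint k1 0 (2 * PI))).
  pose proof (Cmod_ge_0 (b - a)) as Pb.
  eapply Rle_trans. refine (is_Cint_bound _ _ _ _ ((Rabs K + 1) * (Cmod (b - a) * Cmod (b - a)))%R two_PI_pos _ I4).
  - intros t Ht. cbv beta. rewrite (Cmult_comm (b - a)). eapply Rle_trans. apply H; auto. lra.
    apply Rmult_le_compat_r. nra. pose proof (Rle_abs K). lra.
  - rewrite Rminus_0_r. replace (2 * PI * ((Rabs K + 1) * (Cmod (b - a) * Cmod (b - a))))%R
      with (L * Cmod (b - a) * Cmod (b - a))%R by (unfold L; ring).
    apply Rmult_le_compat_r; auto.
    apply Rle_trans with (L * (e / L))%R. apply Rmult_le_compat_l; lra. right; field; lra.
Qed.

Section CauchyTransform.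
Variables (r : R) (psi : R -> C).
Hypothesis psi_cont : forall t, (0 <= t <= 2 * PI)%R -> CR psi t.
Hypothesis r_pos : (0 < r)%R.

(** Cauchy transforms of a density on the circle |w| = r, with respect to the angle: any factor w
    coming from dw = i w dt has to be part of [psi]. *)
Definition cauchy1 (a : C) : C := Cint (fun t => psi t * / (circ r t - a)) 0 (2 * PI).
Definition cauchy2 (a : C) : C :=
  Cint (fun t => psi t * (/ (circ r t - a) * / (circ r t - a))) 0 (2 * PI).
Definition cauchy3 (a : C) : C :=
  Cint (fun t => psi t * (/ (circ r t - a) * / (circ r t - a) * / (circ r t - a))) 0 (2 * PI).

Lemma circ_sub_lower (a : C) t : (r - Cmod a <= Cmod (circ r t - a))%R.
Proof.
  pose proof (Cmod_reverse_triangle (circ r t) a). rewrite Cmod_circ in H; lra.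
Qed.

Lemma circ_sub_neq_0 (a : C) t : (Cmod a < r)%R -> circ r t - a <> 0.
Proof. intros H. apply Cmod_gt_0. pose proof (circ_sub_lower a t). lra. Qed.

Lemma CR_kernel (a : C) t : (Cmod a < r)%R -> CR (fun s => / (circ r s - a)) t.
Proof.
  intros H. apply Ct_inv. apply Ct_minus. apply CR_circ. apply Ct_const. now apply circ_sub_neq_0.
Qed.

Lemma kernel_estimates (a : C) : (Cmod a < r)%R -> exists d B : R, (0 < d)%R /\ (0 < B)%R /\
  forall b, (Cmod (b - a) < d)%R -> (Cmod b < r)%R /\ forall t, (Cmod (/ (circ r t - b)) <= B)%R.
Proof.
  intros Ha. set (d := ((r - Cmod a) / 2)%R). assert (Pd : (0 < d)%R) by (unfold d; lra).
  exists d, (/ d)%R. split; auto. split. now apply Rinv_0_lt_compat.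
  intros b Hb. assert (Hb' : (Cmod b < r)%R). { pose proof (Cmod_reverse_triangle b a). unfold d in *. lra. }
  split; auto. intros t. rewrite Cmod_inv by now apply circ_sub_neq_0.
  apply Rinv_le_contravar; auto. pose proof (circ_sub_lower b t). pose proof (Cmod_reverse_triangle b a).
  unfold d in *. lra.
Qed.

Lemma kernel_diff (a b : C) t : (Cmod a < r)%R -> (Cmod b < r)%R ->
  / (circ r t - b) - / (circ r t - a) = (b - a) * (/ (circ r t - a) * / (circ r t - b)).
Proof. intros Ha Hb. field. split; now apply circ_sub_neq_0. Qed.

Lemma Cmod_prod_le (x y : C) (A B : R) : (Cmod x <= A)%R -> (Cmod y <= B)%R -> (Cmod (x * y) <= A * B)%R.
Proof. intros. rewrite Cmod_mult. apply Rmult_le_compat; auto; apply Cmod_ge_0. Qed.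

Lemma Cmod_sum_le (x y : C) (A B : R) : (Cmod x <= A)%R -> (Cmod y <= B)%R -> (Cmod (x + y) <= A + B)%R.
Proof. intros. pose proof (Cmod_triangle x y). lra. Qed.

(** Three orders are treated because [derivative_derivable] represents a primitive of f by
    [cauchy1], hence f by [cauchy2] and f' by [cauchy3], and then needs the derivative of f'. *)
Lemma Did_cauchy (a : C) : (Cmod a < r)%R ->
  Did cauchy1 a (cauchy2 a) /\ Did cauchy2 a (2 * cauchy3 a) /\ exists l, Did cauchy3 a l.
Proof.
  intros Ha. destruct (kernel_estimates a Ha) as (d & B & Hd & HB & HE).
  destruct (CR_bounded psi 0 (2 * PI) psi_cont) as (M & HM & Hpsi).
  assert (Haa : (Cmod (a - a) < d)%R). { replace (a - a) with (RtoC 0) by ring. rewrite Cmod_0; auto. }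
  assert (Fac : forall t h x, (0 <= t <= 2 * PI)%R -> forall A, (Cmod x <= A)%R ->
    (Cmod (psi t * (h * h * x)) <= M * A * (Cmod h * Cmod h))%R).
  { intros t h x Ht A HA. rewrite !Cmod_mult. specialize (Hpsi t Ht).
    pose proof (Cmod_ge_0 h). pose proof (Cmod_ge_0 x). pose proof (Cmod_ge_0 (psi t)).
    replace (M * A * (Cmod h * Cmod h))%R with (M * ((Cmod h * Cmod h) * A))%R by ring.
    apply Rmult_le_compat; auto. apply Rmult_le_pos; nra. apply Rmult_le_compat_l; nra. }
  split; [|split].
  - unfold cauchy1, cauchy2. apply (Did_param (fun t b => psi t * / (circ r t - b)) _ a (M * (B * B * B)) d); auto.
    + intros b t Hb Ht. apply Ct_mult; auto. apply CR_kernel, HE, Hb.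
    + intros t Ht. apply Ct_mult; auto. apply Ct_mult; now apply CR_kernel.
    + intros b t Hb Ht. destruct (HE b Hb) as [Hb1 Eb]. destruct (HE a Haa) as [_ Ea].
      specialize (Eb t). specialize (Ea t). pose proof (kernel_diff a b t Ha Hb1) as Kd.
      (* Applying u' - u = h u u' twice turns the first-order remainder into h^2 times a polynomial
         in u and u'. The other two kernels are treated in the same way. *)
      set (u := / (circ r t - a)) in *. set (u' := / (circ r t - b)) in *. set (h := b - a) in *.
      replace (psi t * u' - psi t * u - psi t * (u * u) * h) with (psi t * (h * h * (u * u * u'))).
      2: { replace (h * h * (u * u * u')) with (h * u * (h * (u * u'))) by ring. rewrite <- Kd.
           replace (h * u * (u' - u)) with (h * (u * u') - u * u * h) by ring. rewrite <- Kd. ring. }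
      apply Fac; auto. repeat apply Cmod_prod_le; auto.
  - unfold cauchy2, cauchy3.
    assert (E : Cint (fun t => psi t * (2 * (/ (circ r t - a) * / (circ r t - a) * / (circ r t - a)))) 0 (2 * PI) =
      2 * Cint (fun t => psi t * (/ (circ r t - a) * / (circ r t - a) * / (circ r t - a))) 0 (2 * PI)).
    { apply Cint_unique.
      apply is_Cint_ext with (fun t => 2 * (psi t * (/ (circ r t - a) * / (circ r t - a) * / (circ r t - a)))).
      apply two_PI_pos. intros; ring. apply is_Cint_scal. apply ex_Cint. apply two_PI_pos.
      intros t Ht. apply Ct_mult; auto. repeat apply Ct_mult; now apply CR_kernel. }
    rewrite <- E.
    apply (Did_param (fun t b => psi t * (/ (circ r t - b) * / (circ r t - b))) _ a (M * (B * B * B * (B + 2 * B))) d); auto.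
    + intros b t Hb Ht. apply Ct_mult; auto. apply Ct_mult; apply CR_kernel, HE, Hb.
    + intros t Ht. apply Ct_mult; auto. apply Ct_mult. apply Ct_const. repeat apply Ct_mult; now apply CR_kernel.
    + intros b t Hb Ht. destruct (HE b Hb) as [Hb1 Eb]. destruct (HE a Haa) as [_ Ea].
      specialize (Eb t). specialize (Ea t). pose proof (kernel_diff a b t Ha Hb1) as Kd.
      set (u := / (circ r t - a)) in *. set (u' := / (circ r t - b)) in *. set (h := b - a) in *.
      replace (psi t * (u' * u') - psi t * (u * u) - psi t * (2 * (u * u * u)) * h) with
        (psi t * (h * h * (u * u * u' * (u' + 2 * u)))).
      2: { replace (h * h * (u * u * u' * (u' + 2 * u))) with (h * u * (h * (u * u')) * (u' + 2 * u)) by ring.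
           rewrite <- Kd. replace (psi t * (u' * u') - psi t * (u * u)) with (psi t * ((u' - u) * (u' + u))) by ring.
           replace (h * u * (u' - u) * (u' + 2 * u)) with (h * (u * u') * (u + u') - 2 * (u * u * u) * h) by ring.
           rewrite <- Kd. ring. }
      apply Fac; auto. apply Cmod_prod_le. repeat apply Cmod_prod_le; auto.
      apply Cmod_sum_le; auto. apply Cmod_prod_le; auto. rewrite Cmod_R, Rabs_right; lra.
  - unfold cauchy3. eexists.
    apply (Did_param (fun t b => psi t * (/ (circ r t - b) * / (circ r t - b) * / (circ r t - b)))
       (fun t => psi t * (3 * (/ (circ r t - a) * / (circ r t - a) * / (circ r t - a) * / (circ r t - a))))
      a (M * (B * B * B * (B * B + 2 * B * B + 3 * B * B))) d); auto.
    + intros b t Hb Ht. apply Ct_mult; auto. repeat apply Ct_mult; apply CR_kernel, HE, Hb.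
    + intros t Ht. apply Ct_mult; auto. apply Ct_mult. apply Ct_const. repeat apply Ct_mult; now apply CR_kernel.
    + intros b t Hb Ht. destruct (HE b Hb) as [Hb1 Eb]. destruct (HE a Haa) as [_ Ea].
      specialize (Eb t). specialize (Ea t). pose proof (kernel_diff a b t Ha Hb1) as Kd.
      set (u := / (circ r t - a)) in *. set (u' := / (circ r t - b)) in *. set (h := b - a) in *.
      replace (psi t * (u' * u' * u') - psi t * (u * u * u) - psi t * (3 * (u * u * u * u)) * h) with
        (psi t * (h * h * (u * u * u' * (u' * u' + 2 * u * u' + 3 * u * u)))).
      2: { replace (h * h * (u * u * u' * (u' * u' + 2 * u * u' + 3 * u * u))) with
             (h * u * (h * (u * u')) * (u' * u' + 2 * u * u' + 3 * u * u)) by ring.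
           rewrite <- Kd.
           replace (psi t * (u' * u' * u') - psi t * (u * u * u)) with
             (psi t * ((u' - u) * (u' * u' + u * u' + u * u))) by ring.
           replace (h * u * (u' - u) * (u' * u' + 2 * u * u' + 3 * u * u)) with
             (h * (u * u') * (u' * u' + u * u' + u * u) - 3 * (u * u * u * u) * h) by ring.
           rewrite <- Kd. ring. }
      assert (N2 : (Cmod 2 <= 2)%R) by (rewrite Cmod_R, Rabs_right; lra).
      assert (N3 : (Cmod 3 <= 3)%R) by (rewrite Cmod_R, Rabs_right; lra).
      apply Fac; auto. apply Cmod_prod_le. repeat apply Cmod_prod_le; auto.
      repeat apply Cmod_sum_le; repeat apply Cmod_prod_le; auto.
Qed.

End CauchyTransform.

Lemma RtoC_neq_0 (x : R) : x <> 0%R -> RtoC x <> 0.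
Proof. intros H E. apply H. now injection E. Qed.

Lemma is_Cint_circ (r : R) : is_Cint (circ r) 0 (2 * PI) (RtoC 0).
Proof.
  pose proof (is_Cint_FTC (fun t => / Ci * circ r t) (circ r) 0 (2 * PI) two_PI_pos) as H.
  cbv beta in H. rewrite circ_period in H.
  replace (RtoC 0) with (/ Ci * circ r 0 - / Ci * circ r 0) by ring. apply H.
  - intros t _. eapply D_eq. 2: apply D_scal, DR_circ. field. apply Ci_neq_0.
  - intros t _. apply CR_circ.
Qed.

(** As a function of [a] the integral is a Cauchy transform. Its derivative integrates w / (w -
    a)^2, which has the periodic primitive i / (w - a) in t, so it vanishes and the value is the one
    at a = 0. *)
Lemma is_Cint_winding (r : R) (a : C) : (0 < r)%R -> (Cmod a < r)%R ->
  is_Cint (fun t => circ r t * / (circ r t - a)) 0 (2 * PI) (RtoC (2 * PI)).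
Proof.
  intros Hr Ha.
  assert (Hc : forall t, (0 <= t <= 2 * PI)%R -> CR (circ r) t) by (intros; apply CR_circ).
  assert (H2 : forall b, (Cmod b < r)%R -> cauchy2 r (circ r) b = 0).
  { intros b Hb. apply Cint_unique.
    pose proof (is_Cint_FTC (fun t => Ci * / (circ r t - b))
      (fun t => circ r t * (/ (circ r t - b) * / (circ r t - b))) 0 (2 * PI) two_PI_pos) as H.
    cbv beta in H. rewrite circ_period in H.
    replace (RtoC 0) with (Ci * / (circ r 0 - b) - Ci * / (circ r 0 - b)) by ring. apply H.
    - intros t _. eapply D_eq. 2: { apply D_scal. apply D_inv. apply D_minus. apply DR_circ. apply D_const.
        now apply circ_sub_neq_0. }
      cbv beta. assert (E : Ci * Ci = - (1)). { unfold Ci, Cmult, RtoC, Copp; simpl. f_equal; ring. }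
      pose proof (circ_sub_neq_0 r Hr b t Hb) as N.
      replace (Ci * (- (Ci * circ r t - 0) / ((circ r t - b) * (circ r t - b)))) with
        (- (Ci * Ci) * circ r t / ((circ r t - b) * (circ r t - b))) by (field; auto).
      rewrite E. field; auto.
    - intros t _. apply Ct_mult. apply CR_circ. apply Ct_mult; now apply CR_kernel. }
  assert (E : cauchy1 r (circ r) a = cauchy1 r (circ r) 0).
  { assert (Q : (Cmod (cauchy1 r (circ r) a - cauchy1 r (circ r) 0) <= 0 * Cmod (a - 0))%R).
    { assert (S : forall t, (0 <= t <= 1)%R -> (Cmod (seg 0 a t) < r)%R).
      { intros t Ht. eapply Rle_lt_trans; [|apply Ha]. apply Cmod_seg_le; auto; try lra.
        rewrite Cmod_0. apply Cmod_ge_0. }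
      apply Did_mean_value with (df := fun _ => 0).
      - intros t Ht. exact (D_eq _ _ _ _ _ (H2 _ (S t Ht))
          (proj1 (Did_cauchy r (circ r) Hc Hr _ (S t Ht)))).
      - intros t _. rewrite Cmod_0. lra. }
    rewrite Rmult_0_l in Q. assert (Z : cauchy1 r (circ r) a - cauchy1 r (circ r) 0 = 0).
    { apply Cmod_eq_0. apply Rle_antisym; auto. apply Cmod_ge_0. }
    replace (cauchy1 r (circ r) a) with (cauchy1 r (circ r) a - cauchy1 r (circ r) 0 + cauchy1 r (circ r) 0) by ring.
    rewrite Z. ring. }
  assert (E0 : cauchy1 r (circ r) 0 = RtoC (2 * PI)).
  { apply Cint_unique.
    pose proof (is_Cint_FTC RtoC (fun _ => 1) 0 (2 * PI) two_PI_pos) as H.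
    replace (RtoC (2 * PI)) with (RtoC (2 * PI) - RtoC 0) by ring.
    apply is_Cint_ext with (fun _ => 1). apply two_PI_pos.
    - intros t _. field. pose proof (circ_sub_neq_0 r Hr 0 t) as N. rewrite Cmod_0 in N. specialize (N Hr).
      intros Z; apply N. rewrite Z. ring.
    - apply H. intros t _. apply D_coord. intros t _. apply Ct_const. }
  rewrite <- E0, <- E. apply ex_Cint. apply two_PI_pos. intros t _.
  apply Ct_mult. apply CR_circ. now apply CR_kernel.
Qed.

Lemma DR_seg_end (a : C) (s : R) (w : R -> C) t l : DR w t l -> DR (fun t => seg a (w t) s) t (RtoC s * l).
Proof.
  intros H. unfold seg. eapply D_eq. 2: { apply D_plus. apply D_const. apply D_scal. apply D_minus. apply H. apply D_const. }
  ring.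
Qed.

(** The circle is contracted to [a]: phi(s), the integral of f (a + s (w - a)) w / (w - a), joins 2
    pi f(a) at s = 0 to the left-hand side at s = 1. Its derivative integrates f1 (a + s (w - a)) w,
    which has the periodic primitive f (a + s (w - a)) / (i s) for s > 0 and is a multiple of w for
    s = 0, so phi is constant. *)
Lemma cauchy_formula_C1 (f f1 : C -> C) (r : R) (a : C) :
  (forall z, in_disk z -> Did f z (f1 z)) -> (forall z, in_disk z -> Cid f1 z) ->
  (0 < r < 1)%R -> (Cmod a < r)%R ->
  is_Cint (fun t => f (circ r t) * circ r t * / (circ r t - a)) 0 (2 * PI) (RtoC (2 * PI) * f a).
Proof.
  intros Hf Hf1 Hr Ha.
  assert (Hr0 : (0 < r)%R) by lra.
  assert (Ms : forall s t, (0 <= s <= 1)%R -> (Cmod (seg a (circ r t) s) <= r)%R).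
  { intros s t Hs. apply Cmod_seg_le; auto; try lra. rewrite Cmod_circ; lra. }
  assert (Ds : forall s t, (0 <= s <= 1)%R -> in_disk (seg a (circ r t) s)).
  { intros s t Hs. specialize (Ms s t Hs). unfold in_disk. lra. }
  assert (Zero : forall s, (0 <= s <= 1)%R -> is_Cint (fun t => f1 (seg a (circ r t) s) * circ r t) 0 (2 * PI) (RtoC 0)).
  { intros s Hs. destruct (Req_dec s 0) as [->|Hs0].
    - apply is_Cint_ext with (fun t => f1 a * circ r t). apply two_PI_pos.
      { intros t _. f_equal. f_equal. unfold seg. ring. }
      replace (RtoC 0) with (f1 a * 0) by ring. apply is_Cint_scal, is_Cint_circ.
    - pose proof (is_Cint_FTC (fun t => / (Ci * RtoC s) * f (seg a (circ r t) s))
        (fun t => f1 (seg a (circ r t) s) * circ r t) 0 (2 * PI) two_PI_pos) as H.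
      cbv beta in H. rewrite circ_period in H.
      match type of H with _ -> _ -> is_RInt _ _ _ ?x => replace x with (RtoC 0) in H by ring end.
      apply H.
      + intros t _. eapply D_eq. 2: { apply D_scal. apply D_comp. apply DR_seg_end, DR_circ. apply Hf; auto. }
        field. split. now apply RtoC_neq_0. apply Ci_neq_0.
      + intros t _. apply Ct_mult; [|apply CR_circ]. apply (Ct_comp RtoC f1 (fun t => seg a (circ r t) s)).
        eapply D_Ct, DR_seg_end, DR_circ. apply Hf1; auto. }
  assert (Kc : forall t, CR (fun t => circ r t * / (circ r t - a)) t).
  { intros t. apply Ct_mult. apply CR_circ. now apply CR_kernel. }
  set (phi := fun s : R => Cint (fun t => f (seg a (circ r t) s) * (circ r t * / (circ r t - a))) 0 (2 * PI) : C).
  assert (Ic : forall s, (forall t, in_disk (seg a (circ r t) s)) ->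
     is_Cint (fun t => f (seg a (circ r t) s) * (circ r t * / (circ r t - a))) 0 (2 * PI) (phi s)).
  { intros s Hs. apply ex_Cint. apply two_PI_pos. intros t _. apply Ct_mult; auto.
    apply (Ct_comp RtoC f (fun t => seg a (circ r t) s)).
    eapply D_Ct, DR_seg_end, DR_circ. eapply D_Ct, Hf; auto. }
  assert (Hphi : forall s, (0 <= s <= 1)%R -> DR phi s 0).
  { intros s Hs e He. pose proof PI_RGT_0 as PP.
    set (e' := (e / (2 * PI * r))%R).
    assert (P2 : (0 < 2 * PI * r)%R) by nra.
    assert (Pe' : (0 < e')%R) by (apply Rdiv_lt_0_compat; auto).
    destruct (Cid_uniform_on_curve f1 (fun t => seg a (circ r t) s) 0 (2 * PI)) with (e := e') as (d & Hd & Hu); auto.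
    { intros t _. eapply D_Ct, DR_seg_end, DR_circ. }
    (* The bound 1 - r keeps the displaced points inside the unit disk even when s' leaves [0, 1].
       The factor 2 r in the radius below bounds |w - a|. *)
    set (d' := Rmin d (1 - r)). assert (A1 := Rmin_l d (1 - r)). assert (A2 := Rmin_r d (1 - r)). fold d' in A1, A2.
    assert (Pd' : (0 < d')%R) by (apply Rmin_glb_lt; lra).
    exists (d' / (2 * r))%R; split. apply Rdiv_lt_0_compat; lra.
    intros s' Hs'. rewrite <- RtoC_minus in *. rewrite Cmod_R in *.
    assert (Bw : forall t, (Cmod (circ r t - a) <= 2 * r)%R).
    { intros t. pose proof (Cmod_sub_le (circ r t) a). rewrite Cmod_circ in H; lra. }
    assert (Hdist : forall t, (Cmod (seg a (circ r t) s' - seg a (circ r t) s) < d')%R).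
    { intros t. unfold seg. replace (a + s' * (circ r t - a) - (a + s * (circ r t - a))) with
        (RtoC (s' - s) * (circ r t - a)) by (rewrite RtoC_minus; ring).
      rewrite Cmod_mult, Cmod_R. apply Rle_lt_trans with (Rabs (s' - s) * (2 * r))%R.
      apply Rmult_le_compat_l; auto. apply Rabs_pos.
      apply Rmult_lt_compat_r with (r := (2 * r)%R) in Hs'; [|lra].
      replace (d' / (2 * r) * (2 * r))%R with d' in Hs' by (field; lra). auto. }
    assert (Hs'd : forall t, in_disk (seg a (circ r t) s')).
    { intros t. specialize (Hdist t). specialize (Ms s t Hs). unfold in_disk.
      pose proof (Cmod_reverse_triangle (seg a (circ r t) s') (seg a (circ r t) s)). lra. }
    pose proof (is_Cint_minus _ _ _ _ _ _ (Ic s' Hs'd) (Ic s (fun t => Ds s t Hs))) as I1.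
    pose proof (is_Cint_minus _ _ _ _ _ _ I1 (is_Cint_scal (RtoC (s' - s)) _ _ _ _ (Zero s Hs))) as I2.
    replace (phi s' - phi s - 0 * RtoC (s' - s)) with (phi s' - phi s - RtoC (s' - s) * 0) by ring.
    eapply Rle_trans. refine (is_Cint_bound _ _ _ _ (e' * r * Rabs (s' - s)) two_PI_pos _ I2).
    - intros t Ht. cbv beta.
      set (w := circ r t). set (x := seg a w s). set (y := seg a w s').
      assert (N : w - a <> 0) by now apply circ_sub_neq_0.
      assert (Exy : y - x = RtoC (s' - s) * (w - a)).
      { unfold y, x, seg. rewrite RtoC_minus. ring. }
      replace (f y * (w * / (w - a)) - f x * (w * / (w - a)) - RtoC (s' - s) * (f1 x * w)) with
        (((f y - f1 x * y) - (f x - f1 x * x)) * (w * / (w - a))).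
      2: { replace (f y - f1 x * y - (f x - f1 x * x)) with (f y - f x - f1 x * (y - x)) by ring.
           rewrite Exy. field; auto. }
      assert (MV : (Cmod ((f y - f1 x * y) - (f x - f1 x * x)) <= e' * Cmod (y - x))%R).
      { apply (Did_mean_value (fun z => f z - f1 x * z) (fun z => f1 z - f1 x)).
        - intros q Hq. apply D_minus. apply Hf. apply in_disk_seg; auto. apply Ds; auto. apply Hs'd.
          eapply D_eq. 2: apply D_scal, D_coord. ring.
        - intros q Hq. left. apply (Hu t); auto.
          eapply Rle_lt_trans. apply (Cmod_seg_sub x y q Hq). specialize (Hdist t). fold w x y in Hdist. lra. }
      rewrite Cmod_mult. eapply Rle_trans. apply Rmult_le_compat_r. apply Cmod_ge_0. apply MV.
      rewrite Exy, Rmult_assoc, <- Cmod_mult.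
      replace (RtoC (s' - s) * (w - a) * (w * / (w - a))) with (RtoC (s' - s) * w) by (field; auto).
      rewrite Cmod_mult, Cmod_R. unfold w. rewrite Cmod_circ by lra. lra.
    - right. rewrite Rminus_0_r. unfold e'. field. lra. }
  assert (E : phi 1%R = phi 0%R).
  { assert (Q : (Cmod (phi 1%R - phi 0%R) <= 0 * (1 - 0))%R).
    { apply DR_mean_value with (df := fun _ => 0); auto. lra. intros. rewrite Cmod_0. lra. }
    rewrite Rmult_0_l in Q. assert (Z : phi 1%R - phi 0%R = 0).
    { apply Cmod_eq_0. apply Rle_antisym; auto. apply Cmod_ge_0. }
    replace (phi 1%R) with (phi 1%R - phi 0%R + phi 0%R) by ring. rewrite Z. ring. }
  assert (E0 : phi 0%R = RtoC (2 * PI) * f a).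
  { apply Cint_unique. apply is_Cint_ext with (fun t => f a * (circ r t * / (circ r t - a))). apply two_PI_pos.
    - intros t _. f_equal. f_equal. unfold seg. ring.
    - rewrite Cmult_comm. apply is_Cint_scal. now apply is_Cint_winding. }
  rewrite <- E0, <- E.
  apply is_Cint_ext with (fun t => f (seg a (circ r t) 1) * (circ r t * / (circ r t - a))). apply two_PI_pos.
  - intros t _. replace (seg a (circ r t) 1) with (circ r t) by (unfold seg; ring). ring.
  - apply Ic. intros t. apply Ds. lra.
Qed.

Definition derivable_disk (f : C -> C) : Prop := forall z, in_disk z -> exists l, Did f z l.

Lemma derivable_disk_Cid f : derivable_disk f -> forall z, in_disk z -> Cid f z.
Proof. intros H z Hz. destruct (H z Hz) as [l Hl]. eapply D_Ct, Hl. Qed.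

Lemma two_PI_neq_0 : RtoC (2 * PI) <> 0.
Proof. apply RtoC_neq_0. pose proof PI_RGT_0. lra. Qed.

Lemma in_disk_margin (z : C) : in_disk z -> exists r, (0 < r < 1)%R /\ (Cmod z < r)%R.
Proof.
  unfold in_disk. intros H. pose proof (Cmod_ge_0 z). exists ((1 + Cmod z) / 2)%R. lra.
Qed.

Lemma in_disk_near (z w : C) (r : R) : (Cmod (w - z) < r - Cmod z)%R -> (Cmod w < r)%R.
Proof. intros H. pose proof (Cmod_reverse_triangle w z). lra. Qed.

(** Continuity of f' is not yet known, so [cauchy_formula_C1] is applied to a primitive of f, whose
    derivative f is continuous. This makes the primitive a Cauchy transform, which can be
    differentiated three times; the successive derivatives are matched by uniqueness. *)
Lemma derivative_derivable (f : C -> C) : derivable_disk f ->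
  exists f1, (forall z, in_disk z -> Did f z (f1 z)) /\ derivable_disk f1.
Proof.
  intros Hf.
  assert (Hc := derivable_disk_Cid f Hf).
  set (P := segint f 0).
  assert (HP : forall z, in_disk z -> Did P z (f z)) by (intros z Hz; apply Did_primitive; auto).
  assert (H1 : forall z, exists l, in_disk z -> Did f z l).
  { intros z. destruct (classic (in_disk z)) as [H|H]. destruct (Hf z H) as [l Hl]. now exists l. exists 0; tauto. }
  destruct (ClassicalEpsilon.choice _ H1) as [f1 Hf1].
  exists f1; split; auto. intros z Hz.
  destruct (in_disk_margin z Hz) as (r & Hr & Hzr).
  set (psi := fun t => P (circ r t) * circ r t).
  assert (Hpsi : forall t, (0 <= t <= 2 * PI)%R -> CR psi t).
  { intros t _. unfold psi. apply Ct_mult; [|apply CR_circ].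
    apply (Ct_comp RtoC P (circ r)). apply CR_circ. eapply D_Ct, HP.
    unfold in_disk. rewrite Cmod_circ; lra. }
  assert (EP : forall a, (Cmod a < r)%R -> P a = / RtoC (2 * PI) * cauchy1 r psi a).
  { intros a Ha. unfold cauchy1, psi. rewrite (Cint_unique _ _ _ _ (cauchy_formula_C1 P f r a HP Hc Hr Ha)).
    field. apply two_PI_neq_0. }
  assert (Ef : forall a, (Cmod a < r)%R -> f a = / RtoC (2 * PI) * cauchy2 r psi a).
  { intros a Ha. apply (D_unique P a). apply HP. unfold in_disk; lra.
    apply (D_ext_near _ (fun b => / RtoC (2 * PI) * cauchy1 r psi b) P a _ (r - Cmod a)). lra.
    - intros s Hs. symmetry. apply EP. now apply (in_disk_near a).
    - apply D_scal. exact (proj1 (Did_cauchy r psi Hpsi (proj1 Hr) a Ha)). }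
  assert (Ef1 : forall a, (Cmod a < r)%R -> f1 a = / RtoC (2 * PI) * (2 * cauchy3 r psi a)).
  { intros a Ha. apply (D_unique f a). apply Hf1. unfold in_disk; lra.
    apply (D_ext_near _ (fun b => / RtoC (2 * PI) * cauchy2 r psi b) f a _ (r - Cmod a)). lra.
    - intros s Hs. symmetry. apply Ef. now apply (in_disk_near a).
    - apply D_scal. exact (proj1 (proj2 (Did_cauchy r psi Hpsi (proj1 Hr) a Ha))). }
  destruct (Did_cauchy r psi Hpsi ltac:(lra) z Hzr) as (_ & _ & l & Hl).
  exists (/ RtoC (2 * PI) * (2 * l)).
  apply (D_ext_near _ (fun b => / RtoC (2 * PI) * (2 * cauchy3 r psi b)) f1 z _ (r - Cmod z)). lra.
  - intros s Hs. symmetry. apply Ef1. now apply (in_disk_near z).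
  - now apply D_scal, D_scal.
Qed.

Lemma cauchy_formula (f : C -> C) (r : R) (a : C) : derivable_disk f -> (0 < r < 1)%R -> (Cmod a < r)%R ->
  is_Cint (fun t => f (circ r t) * circ r t * / (circ r t - a)) 0 (2 * PI) (RtoC (2 * PI) * f a).
Proof.
  intros Hf. destruct (derivative_derivable f Hf) as (f1 & H1 & H2).
  apply (cauchy_formula_C1 f f1); auto. now apply derivable_disk_Cid.
Qed.

Lemma cauchy_bound (f : C -> C) (r M : R) (a : C) : derivable_disk f -> (0 < r < 1)%R -> (Cmod a < r)%R ->
  (forall t, (0 <= t <= 2 * PI)%R -> (Cmod (f (circ r t)) <= M)%R) -> (Cmod (f a) <= M * (r / (r - Cmod a)))%R.
Proof.
  intros Hf Hr Ha HM. pose proof PI_RGT_0 as PP.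
  pose proof (cauchy_formula f r a Hf Hr Ha) as H.
  apply is_Cint_bound with (M := (M * (r / (r - Cmod a)))%R) in H; [|apply two_PI_pos|].
  - rewrite Cmod_mult, Cmod_R, Rabs_right, Rminus_0_r in H by lra.
    apply Rmult_le_reg_l in H; lra.
  - intros t Ht. rewrite <- Cmult_assoc. apply Cmod_prod_le; auto.
    unfold Rdiv. apply Cmod_prod_le. rewrite Cmod_circ; lra.
    rewrite Cmod_inv by (apply circ_sub_neq_0; lra). apply Rinv_le_contravar. lra. apply circ_sub_lower. lra.
Qed.

(** Continuity gives a bound on the single circle of radius (1 + r) / 2, by compactness of an
    interval, and the Cauchy estimate carries it to the smaller disk. *)
Lemma derivable_disk_bounded (f : C -> C) (r : R) : derivable_disk f -> (r < 1)%R ->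
  exists M, (0 < M)%R /\ forall z, (Cmod z <= r)%R -> (Cmod (f z) <= M)%R.
Proof.
  intros Hf Hr. destruct (Rle_lt_dec 0 r) as [Hr0|Hr0].
  2: { exists 1%R. split. lra. intros z Hz. pose proof (Cmod_ge_0 z). lra. }
  set (s := ((1 + r) / 2)%R).
  assert (Hs : (0 < s < 1)%R) by (unfold s; lra). assert (Hsr : (r < s)%R) by (unfold s; lra).
  destruct (CR_bounded (fun t => f (circ s t)) 0 (2 * PI)) as (M & HM & HB).
  { intros t _. apply (Ct_comp RtoC f (circ s)). apply CR_circ.
    apply derivable_disk_Cid; auto. unfold in_disk. rewrite Cmod_circ; lra. }
  exists (M * (s / (s - r)))%R; split.
  { apply Rmult_lt_0_compat; auto. apply Rdiv_lt_0_compat; lra. }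
  intros z Hz. eapply Rle_trans. apply (cauchy_bound f s M z); auto; lra.
  apply Rmult_le_compat_l. lra. apply Rmult_le_compat_l. lra. apply Rinv_le_contravar; lra.
Qed.

Lemma derivable_disk_mult f g : derivable_disk f -> derivable_disk g -> derivable_disk (fun z => f z * g z).
Proof.
  intros Hf Hg z Hz. destruct (Hf z Hz) as [l Hl]. destruct (Hg z Hz) as [m Hm].
  eexists. apply D_mult; eauto.
Qed.

Lemma derivable_disk_pow f n : derivable_disk f -> derivable_disk (fun z => f z ^ n).
Proof.
  intros Hf. induction n. intros z _. exists 0. apply (D_ext _ (fun _ => 1)). reflexivity. apply D_const.
  apply derivable_disk_mult; auto.
Qed.

Lemma pow_unbounded (x K : R) : (forall n, (x ^ n <= K)%R) -> (0 <= x)%R -> (x <= 1)%R.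
Proof.
  intros H Hx. apply Rnot_lt_le. intros H1.
  destruct (Pow_x_infinity x ltac:(rewrite Rabs_right; lra) (K + 1)) as [N HN].
  specialize (HN N (le_n _)). specialize (H N).
  rewrite Rabs_right in HN. lra. apply Rle_ge, pow_le; auto.
Qed.

(* The constant [r / (r - |a|)] of the Cauchy estimate disappears when the
   estimate is applied to the powers of [f]. *)
Lemma maximum_modulus (f : C -> C) (r M : R) (a : C) : derivable_disk f -> (0 < r < 1)%R -> (Cmod a < r)%R ->
  (0 < M)%R -> (forall t, (Cmod (f (circ r t)) <= M)%R) -> (Cmod (f a) <= M)%R.
Proof.
  intros Hf Hr Ha HM HB.
  assert (H : (Cmod (f a) / M <= 1)%R).
  { apply pow_unbounded with (r / (r - Cmod a))%R.
    - intros n. pose proof (cauchy_bound (fun z => f z ^ n) r (M ^ n) a (derivable_disk_pow f n Hf) Hr Ha) as H.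
      cbv beta in H. rewrite Cmod_pow in H.
      assert (PM : (0 < M ^ n)%R) by (apply pow_lt; auto).
      unfold Rdiv at 1. rewrite Rpow_mult_distr, pow_inv.
      apply Rmult_le_reg_l with (M ^ n)%R; auto.
      replace (M ^ n * (Cmod (f a) ^ n * / M ^ n))%R with (Cmod (f a) ^ n)%R by (field; lra).
      apply H. intros t _. rewrite Cmod_pow. apply pow_incr. split; auto. apply Cmod_ge_0.
    - apply Rdiv_le_0_compat; auto. apply Cmod_ge_0. }
  apply Rmult_le_compat_r with (r := M) in H; [|lra].
  replace (Cmod (f a) / M * M)%R with (Cmod (f a)) in H by (field; lra). lra.
Qed.

(** The maximum principle for f(z) / z on circles of radius r close to 1, once the singularity at 0
    is removed. *)
Lemma schwarz (f : C -> C) : derivable_disk f -> f 0 = 0 ->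
  (forall z, in_disk z -> (Cmod (f z) <= 1)%R) -> forall z, in_disk z -> (Cmod (f z) <= Cmod z)%R.
Proof.
  intros Hf H0 H1 z Hz.
  (* Subtracting Cauchy's formula at 0 from the one at b, with f(0) = 0 and w / (w - b) - 1 = b / (w
     - b), gives f(b) = b k(b). So [k] is the holomorphic extension of f(b) / b across 0. *)
  set (k := fun b => / RtoC (2 * PI) * cauchy1 (/2) (fun t => f (circ (/2) t)) b).
  set (g := fun b : C => if excluded_middle_informative (b = 0) then k 0 else f b / b).
  assert (Hr : (0 < / 2 < 1)%R) by lra.
  assert (Pc : forall t, (0 <= t <= 2 * PI)%R -> CR (fun t => f (circ (/2) t)) t).
  { intros t _. apply (Ct_comp RtoC f (circ (/2))). apply CR_circ.
    apply derivable_disk_Cid; auto. unfold in_disk. rewrite Cmod_circ; lra. }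
  assert (Hk : forall b, (Cmod b < /2)%R -> f b = b * k b).
  { intros b Hb. pose proof (cauchy_formula f (/2) b Hf Hr Hb) as E1.
    pose proof (cauchy_formula f (/2) 0 Hf Hr ltac:(rewrite Cmod_0; lra)) as E2.
    pose proof (is_Cint_minus _ _ _ _ _ _ E1 E2) as E3. rewrite H0 in E3.
    pose proof (is_Cint_scal b _ _ _ _ (ex_Cint (fun t => f (circ (/2) t) * / (circ (/2) t - b)) 0 (2 * PI) two_PI_pos
      (fun t Ht => Ct_mult _ _ _ _ (Pc t Ht) (CR_kernel (/2) ltac:(lra) b t Hb)))) as E4.
    apply Cint_unique in E4.
    apply is_Cint_ext with (g := fun t => b * (f (circ (/2) t) * / (circ (/2) t - b))) in E3; [|apply two_PI_pos|].
    - apply Cint_unique in E3. unfold k, cauchy1. rewrite E3 in E4.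
      pose proof two_PI_neq_0.
      replace (f b) with (/ RtoC (2 * PI) * (RtoC (2 * PI) * f b - RtoC (2 * PI) * 0)) by (field; auto).
      rewrite E4. ring.
    - intros t _. pose proof (circ_sub_neq_0 (/2) ltac:(lra) b t Hb).
      pose proof (circ_sub_neq_0 (/2) ltac:(lra) 0 t ltac:(rewrite Cmod_0; lra)).
      field. split; auto. intros Z. apply H2. rewrite Z. ring. }
  assert (Gn : forall b : C, b <> 0 -> g b = f b / b).
  { intros b Hb. unfold g. destruct (excluded_middle_informative (b = 0)); tauto. }
  assert (Hg : derivable_disk g).
  { intros b Hb. destruct (classic (b = 0)) as [->|Hb0].
    - exists (/ RtoC (2 * PI) * cauchy2 (/2) (fun t => f (circ (/2) t)) 0).
      apply (D_ext_near _ k g 0 _ (/2)). lra.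
      + intros s Hs. replace (s - 0) with s in Hs by ring. unfold g.
        destruct (excluded_middle_informative (s = 0)) as [->|N]; auto.
        rewrite (Hk s Hs). field; auto.
      + apply D_scal. apply (proj1 (Did_cauchy (/2) _ Pc (proj1 Hr) 0 ltac:(rewrite Cmod_0; lra))).
    - destruct (Hf b Hb) as [l Hl]. eexists.
      apply (D_ext_near _ (fun s => f s * / s) g b _ (Cmod b)). now apply Cmod_gt_0.
      + intros s Hs. symmetry. apply Gn. intros ->. replace (0 - b) with (- b) in Hs by ring.
        rewrite Cmod_opp in Hs. lra.
      + apply D_mult. apply Hl. apply Did_inv; auto. }
  destruct (classic (z = 0)) as [->|Hz0]. { rewrite H0. lra. }
  assert (Pz := proj1 (Cmod_gt_0 z) Hz0).
  assert (B : forall r, (Cmod z < r < 1)%R -> (Cmod (f z) * r <= Cmod z)%R).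
  { intros r Hrz.
    pose proof (maximum_modulus g r (/ r) z Hg ltac:(lra) ltac:(lra) ltac:(apply Rinv_0_lt_compat; lra)) as Q.
    rewrite (Gn z Hz0), Cmod_div in Q by auto.
    assert (Q' : (Cmod (f z) / Cmod z <= / r)%R).
    { apply Q. intros t. assert (Ec : Cmod (circ r t) = r) by (apply Cmod_circ; lra).
      assert (Nc : circ r t <> 0) by (apply Cmod_gt_0; lra).
      rewrite Gn, Cmod_div, Ec by auto. unfold Rdiv. rewrite <- (Rmult_1_l (/ r)) at 2.
      apply Rmult_le_compat_r. left; apply Rinv_0_lt_compat; lra. apply H1. unfold in_disk; lra. }
    apply Rmult_le_compat_r with (r := (Cmod z * r)%R) in Q'; [|nra].
    replace (Cmod (f z) / Cmod z * (Cmod z * r))%R with (Cmod (f z) * r)%R in Q' by (field; lra).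
    replace (/ r * (Cmod z * r))%R with (Cmod z) in Q' by (field; lra). auto. }
  apply Rnot_lt_le. intros Hlt. unfold in_disk in Hz.
  set (x := Cmod (f z)) in *. set (y := Cmod z) in *.
  assert (y / x < 1)%R. { apply Rmult_lt_reg_r with x. lra. unfold Rdiv. rewrite Rmult_assoc, Rinv_l; lra. }
  assert (y <= y / x)%R.
  { unfold Rdiv. assert (x <= 1)%R by (apply H1; auto). assert (1 <= / x)%R. { rewrite <- Rinv_1. apply Rinv_le_contravar; lra. } nra. }
  (* In place of a limit r -> 1: if y < x, this radius lies strictly between y and 1, and x r = (x +
     y) / 2 exceeds y. *)
  specialize (B ((1 + y / x) / 2)%R ltac:(lra)).
  assert (x * (y / x) = y)%R by (field; lra). nra.
Qed.

(** * Loewner chains *)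

(** The iterates stay within 2 eps of [z]. The radius 4 eps of the conclusion is the error of
    [C_dyadic_limit] at index 0, and the limit has to lie in the ball of contraction, hence 4 eps <=
    eta. *)
Lemma contraction_fixpoint (N : C -> C) (z : C) (eta eps : R) :
  (forall x y, (Cmod (x - z) <= eta)%R -> (Cmod (y - z) <= eta)%R ->
     (Cmod (N x - N y) <= / 2 * Cmod (x - y))%R) ->
  (Cmod (N z - z) <= eps)%R -> (4 * eps <= eta)%R ->
  exists l, (Cmod (l - z) <= 4 * eps)%R /\ N l = l.
Proof.
  intros HN Hz He. assert (Pe : (0 <= eps)%R) by (pose proof (Cmod_ge_0 (N z - z)); lra).
  assert (Hzz : Cmod (z - z) = 0%R) by (replace (z - z) with (RtoC 0) by ring; apply Cmod_0).
  set (x := fun n => Nat.iter n N z).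
  assert (I : forall n, (Cmod (x n - z) <= 2 * eps * (1 - (/2) ^ n))%R /\
     (Cmod (x (S n) - x n) <= eps * (/2) ^ n)%R).
  { induction n. simpl. rewrite Hzz. simpl in Hz. lra.
    destruct IHn as [I1 I2].
    assert (P : (0 < (/2) ^ n)%R) by (apply pow_lt; lra).
    assert (J : (Cmod (x (S n) - z) <= 2 * eps * (1 - (/2) ^ S n))%R).
    { pose proof (Cmod_sub_triangle (x (S n)) (x n) z). simpl pow. lra. }
    split; auto. change (x (S (S n))) with (N (x (S n))). change (x (S n)) with (N (x n)) at 2.
    eapply Rle_trans. apply HN. simpl pow in J. nra. nra. simpl pow. lra. }
  destruct (C_dyadic_limit x eps (fun n => proj2 (I n))) as [l Hl].
  exists l. assert (L0 : (Cmod (l - z) <= 4 * eps)%R).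
  { specialize (Hl O). simpl in Hl. rewrite Cmod_sub_sym in Hl. lra. }
  split; auto.
  assert (Z : (Cmod (N l - l) <= 0)%R).
  { apply Rnot_lt_le. intros Hp. destruct (half_pow_small (8 * eps) _ Hp) as [n Hn].
    assert (B1 := Hl n). assert (B2 := Hl (S n)). simpl pow in B2.
    assert (P : (0 < (/2) ^ n)%R) by (apply pow_lt; lra).
    assert (B3 : (Cmod (N l - N (x n)) <= / 2 * Cmod (l - x n))%R).
    { apply HN. lra. destruct (I n) as [I1 _]. nra. }
    rewrite (Cmod_sub_sym l) in B3.
    pose proof (Cmod_sub_triangle (N l) (x (S n)) l). change (x (S n)) with (N (x n)) in *. nra. }
  assert (Z2 : N l - l = 0). { apply Cmod_eq_0. apply Rle_antisym; auto. apply Cmod_ge_0. }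
  replace (N l) with (N l - l + l) by ring. rewrite Z2. ring.
Qed.

(* Relative form of [Re (1 / X) >= 1 / ((1 + th) s)] for [X] in the disk of centre [s] and radius [th s]. *)
Lemma Cmod_sub_real_le (X : C) (s th d : R) : (0 < s)%R -> (0 <= th < 1)%R -> (0 <= d)%R ->
  (Cmod (X - RtoC s) <= th * s)%R ->
  (Cmod (X - RtoC d) ^ 2 * s <= Cmod X ^ 2 * (s - d * (1 + (1 - th) / (1 + th))) + d * d * s)%R.
Proof.
  intros Hs Hth Hd HX. destruct X as [x y].
  assert (H2 : (Cmod ((x, y) - RtoC s) ^ 2 <= (th * s) ^ 2)%R) by (apply pow_incr; split; auto; apply Cmod_ge_0).
  assert (H3 : (Cmod (x, y) ^ 2 <= ((1 + th) * s) ^ 2)%R).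
  { apply pow_incr. split. apply Cmod_ge_0. pose proof (Cmod_reverse_triangle (x, y) s).
    rewrite Cmod_R, Rabs_right in H by lra. lra. }
  rewrite !Cmod2_alt in *. unfold Re, Im in *. simpl fst in *. simpl snd in *.
  set (n2 := (x ^ 2 + y ^ 2)%R) in *.
  assert (E1 : ((x + - s) ^ 2 + (y + - 0) ^ 2 = n2 - 2 * s * x + s * s)%R) by (unfold n2; ring).
  rewrite E1 in H2.
  assert (E2 : ((x + - d) ^ 2 + (y + - 0) ^ 2 = n2 - 2 * d * x + d * d)%R) by (unfold n2; ring).
  rewrite E2.
  assert (H4 : (n2 * ((1 - th) / (1 + th)) <= (1 - th * th) * (s * s))%R).
  { apply Rle_trans with (((1 + th) * s) ^ 2 * ((1 - th) / (1 + th)))%R.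
    apply Rmult_le_compat_r; auto. apply Rdiv_le_0_compat; lra. right. field. lra. }
  set (q := ((1 - th) / (1 + th))%R) in *.
  assert (H5 : (n2 * (1 + q) <= 2 * s * x)%R) by nra.
  assert (d * (n2 * (1 + q)) <= d * (2 * s * x))%R by (apply Rmult_le_compat_l; auto).
  nra.
Qed.

Section Loewner.
(** Here E = F', E1 = E', and Q is the logarithmic derivative z E' / E. The margin between [r] and
    [R1] is for Newton iterates starting in |z| <= r. On the edge |z|^2 (1 + tau) = r^2, [Q_bound]
    multiplied by |z|^2 reads |(r^2 - |z|^2) Q + k |z|^2| <= th r^2, which is Ahlfors' condition
    when r = th = 1. *)
Variables (F E E1 Q : C -> C) (k : C) (r R1 th m M : R).
Hypothesis r_pos : (0 < r)%R.
Hypothesis r_lt : (r < R1)%R.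
Hypothesis R1_le : (R1 <= 1)%R.
Hypothesis th_bounds : (0 <= th < 1)%R.
Hypothesis m_pos : (0 < m)%R.
Hypothesis M_pos : (0 < M)%R.
Hypothesis F_deriv : forall z, (Cmod z <= R1)%R -> Did F z (E z).
Hypothesis E_deriv : forall z, (Cmod z <= R1)%R -> Did E z (E1 z).
Hypothesis E_lower : forall z, (Cmod z <= R1)%R -> (m <= Cmod (E z))%R.
Hypothesis E_upper : forall z, (Cmod z <= R1)%R -> (Cmod (E z) <= M)%R.
Hypothesis E1_upper : forall z, (Cmod z <= R1)%R -> (Cmod (E1 z) <= M)%R.
Hypothesis E1_lip : forall x y, (Cmod x <= R1)%R -> (Cmod y <= R1)%R ->
  (Cmod (E1 x - E1 y) <= M * Cmod (x - y))%R.
Hypothesis Q_eq : forall z, (Cmod z <= R1)%R -> z * E1 z = Q z * E z.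

Definition chain_dom (z : C) (tau : R) : Prop := (Cmod z ^ 2 * (1 + tau) <= r ^ 2)%R.

Hypothesis Q_bound : forall z tau, (0 <= tau)%R -> chain_dom z tau ->
  (Cmod (k + RtoC tau * Q z) <= th * (1 + tau))%R.

(** For k different from -1 this is 1 + k times the classical chain F(e^(-t) x) + (e^t - e^(-t)) x
    F'(e^(-t) x) / (1 + k), in the variables z = e^(-t) x and tau = e^(2 t) - 1. The condition
    [chain_dom] is |x| <= r. *)
Definition chain_map (z : C) (tau : R) : C := (1 + k) * F z + RtoC tau * (z * E z).
Definition chain_deriv (z : C) (tau : R) : C := (1 + k) * E z + RtoC tau * (E z + z * E1 z).

Lemma Did_chain_map (z : C) tau : (Cmod z <= R1)%R -> Did (fun w => chain_map w tau) z (chain_deriv z tau).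
Proof.
  intros Hz. unfold chain_map, chain_deriv. eapply D_eq. 2: { apply D_plus. apply D_scal, F_deriv, Hz.
    apply D_scal. apply D_mult. apply D_coord. apply E_deriv, Hz. }
  cbv beta. ring.
Qed.

Lemma chain_dom_le (z : C) tau : (0 <= tau)%R -> chain_dom z tau -> (Cmod z <= r)%R.
Proof.
  clear - r_pos. intros Ht H. unfold chain_dom in H. pose proof (Cmod_ge_0 z).
  apply Rnot_lt_le. intros Hl. nra.
Qed.

Lemma k_bound : (Cmod k <= th)%R.
Proof.
  pose proof (Q_bound 0 0%R (Rle_refl _)) as H. unfold chain_dom in H. rewrite Cmod_0 in H.
  replace (k + 0 * Q 0) with k in H by ring. rewrite Rplus_0_r, !Rmult_1_r in H. apply H. nra.
Qed.

Lemma one_k_bound : (Cmod (1 + k) <= 2)%R.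
Proof. pose proof (Cmod_triangle 1 k). rewrite Cmod_1 in H. pose proof k_bound. lra. Qed.

Definition chain_factor (z : C) (tau : R) : C := RtoC (1 + tau) + (k + RtoC tau * Q z).

Lemma chain_deriv_eq (z : C) tau : (Cmod z <= R1)%R -> chain_deriv z tau = E z * chain_factor z tau.
Proof. intros Hz. unfold chain_deriv, chain_factor. rewrite (Q_eq z Hz), RtoC_plus. ring. Qed.

Lemma chain_factor_near (z : C) tau : (0 <= tau)%R -> chain_dom z tau -> (Cmod (chain_factor z tau - RtoC (1 + tau)) <= th * (1 + tau))%R.
Proof.
  intros Ht H. unfold chain_factor.
  replace (RtoC (1 + tau) + (k + RtoC tau * Q z) - RtoC (1 + tau)) with (k + RtoC tau * Q z) by ring. auto.
Qed.

Lemma chain_factor_lower (z : C) tau : (0 <= tau)%R -> chain_dom z tau -> (1 - th <= Cmod (chain_factor z tau))%R.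
Proof.
  intros Ht H. pose proof (chain_factor_near z tau Ht H) as H1.
  pose proof (Cmod_reverse_triangle (RtoC (1 + tau)) (chain_factor z tau)) as H2.
  rewrite Cmod_R, Rabs_right, Cmod_sub_sym in H2 by lra. nra.
Qed.

(** The inequality th < 1 yields a positive bound independent of [tau]; it controls both the Newton
    step and the radius of local injectivity. *)
Lemma chain_deriv_lower (z : C) tau : (0 <= tau)%R -> chain_dom z tau -> (m * (1 - th) <= Cmod (chain_deriv z tau))%R.
Proof.
  intros Ht H. assert (Hz : (Cmod z <= R1)%R) by (pose proof (chain_dom_le z tau Ht H); lra).
  rewrite chain_deriv_eq, Cmod_mult by auto. apply Rmult_le_compat; try lra. auto. now apply chain_factor_lower.
Qed.

Lemma E_lip (x y : C) : (Cmod x <= R1)%R -> (Cmod y <= R1)%R -> (Cmod (E x - E y) <= M * Cmod (x - y))%R.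
Proof.
  intros Hx Hy. apply (Did_mean_value E E1).
  - intros t Ht. apply E_deriv. now apply Cmod_seg_le.
  - intros t Ht. apply E1_upper. now apply Cmod_seg_le.
Qed.

Lemma zE1_upper (z : C) : (Cmod z <= R1)%R -> (Cmod (z * E1 z) <= M)%R.
Proof.
  intros Hz. replace M with (1 * M)%R by ring. apply Cmod_prod_le; auto. lra.
Qed.

Lemma chain_deriv_lip (T : R) (x y : C) (t t' : R) : (Cmod x <= R1)%R -> (Cmod y <= R1)%R ->
  (0 <= t <= T)%R -> (0 <= t' <= T)%R ->
  (Cmod (chain_deriv x t' - chain_deriv y t) <= (4 + 3 * T) * M * (Cmod (x - y) + Rabs (t' - t)))%R.
Proof.
  intros Hx Hy Ht Ht'. unfold chain_deriv.
  replace ((1 + k) * E x + t' * (E x + x * E1 x) - ((1 + k) * E y + t * (E y + y * E1 y))) with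
    ((1 + k) * (E x - E y) + RtoC t' * ((E x - E y) + (x * (E1 x - E1 y) + (x - y) * E1 y)) + RtoC (t' - t) * (E y + y * E1 y))
    by (rewrite RtoC_minus; ring).
  pose proof (E_lip x y Hx Hy) as H1. pose proof (E1_lip x y Hx Hy) as H2.
  pose proof (Cmod_ge_0 (x - y)) as P1. pose proof (Rabs_pos (t' - t)) as P2.
  eapply Rle_trans. apply Cmod_triangle3.
  assert (B1 : (Cmod ((1 + k) * (E x - E y)) <= 2 * (M * Cmod (x - y)))%R).
  { apply Cmod_prod_le; auto. apply one_k_bound. }
  assert (B2 : (Cmod (RtoC t' * ((E x - E y) + (x * (E1 x - E1 y) + (x - y) * E1 y))) <= T * (M * Cmod (x - y) + (1 * (M * Cmod (x - y)) + Cmod (x - y) * M)))%R).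
  { apply Cmod_prod_le. rewrite Cmod_R, Rabs_right; lra.
    apply Cmod_sum_le; auto. apply Cmod_sum_le; apply Cmod_prod_le; auto; lra. }
  assert (B3 : (Cmod (RtoC (t' - t) * (E y + y * E1 y)) <= Rabs (t' - t) * (M + M))%R).
  { apply Cmod_prod_le. rewrite Cmod_R; lra. apply Cmod_sum_le; auto. now apply zE1_upper. }
  assert (0 <= T * (M * Rabs (t' - t)))%R. { repeat apply Rmult_le_pos; lra. }
  assert (0 <= M * Rabs (t' - t))%R by (apply Rmult_le_pos; lra).
  assert (0 <= M * Cmod (x - y))%R by (apply Rmult_le_pos; lra).
  lra.
Qed.

(** On the segment from z to w the derivative differs from its value at z by less than the modulus
    of that value, so the linear part dominates. *)
Lemma chain_map_local_injective (T : R) (z w : C) tau : (0 <= tau <= T)%R -> chain_dom z tau -> chain_dom w tau ->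
  chain_map z tau = chain_map w tau -> (Cmod (w - z) * ((4 + 3 * T) * M) < m * (1 - th))%R -> w = z.
Proof.
  intros Ht Hz Hw Heq Hs. destruct (classic (w = z)) as [|Hn]; auto. exfalso.
  assert (Pw : (0 < Cmod (w - z))%R).
  { apply Cmod_gt_0. intros Z. apply Hn. replace w with (w - z + z) by ring. rewrite Z. ring. }
  assert (Rz : (Cmod z <= R1)%R) by (pose proof (chain_dom_le z tau (proj1 Ht) Hz); lra).
  assert (Rw : (Cmod w <= R1)%R) by (pose proof (chain_dom_le w tau (proj1 Ht) Hw); lra).
  pose proof (chain_deriv_lower z tau (proj1 Ht) Hz) as HL. set (L := chain_deriv z tau) in *.
  pose proof (Did_mean_value (fun x => chain_map x tau - L * x) (fun x => chain_deriv x tau - L) z w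
    ((4 + 3 * T) * M * Cmod (w - z))) as MV. cbv beta in MV.
  assert (MV' := MV ltac:(intros t Hts; apply D_minus; [apply Did_chain_map, Cmod_seg_le; auto|
     eapply D_eq; [|apply D_scal, D_coord]; ring])). clear MV.
  assert (Hb : (Cmod (chain_map w tau - L * w - (chain_map z tau - L * z)) <= (4 + 3 * T) * M * Cmod (w - z) * Cmod (w - z))%R).
  { apply MV'. intros t Hts. eapply Rle_trans. apply (chain_deriv_lip T); auto. now apply Cmod_seg_le.
    replace (tau - tau)%R with 0%R by ring. rewrite Rabs_R0, Rplus_0_r. apply Rmult_le_compat_l.
    apply Rmult_le_pos; lra. now apply Cmod_seg_sub. }
  rewrite Heq in Hb. replace (chain_map w tau - L * w - (chain_map w tau - L * z)) with (- (L * (w - z))) in Hb by ring.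
  rewrite Cmod_opp, Cmod_mult in Hb. apply Rmult_le_reg_r in Hb; auto. lra.
Qed.

(* The level set of [chain_map z tau] is followed by Newton's
   method, and [|z|^2 (1 + tau) <= r^2] persists because [Re (1 / chain_factor z tau) > 1 / (2 (1 + tau))]. *)
Lemma chain_step (T : R) (mu := (m * (1 - th))%R) (K := ((4 + 3 * T) * M)%R) (B := (M / mu)%R)
  (c := (4 * K * B * (4 * B + 1) / mu)%R) (kap := ((1 - th) / (1 + th))%R)
  (c1 := (/ ((1 - th) * (1 - th)))%R) (c2 := (4 * c + c * c)%R)
  (delta : R) (z : C) (tau : R) :
  (0 <= T)%R -> (0 < delta <= 1)%R -> (delta <= 1 - th)%R -> (4 * delta * B <= R1 - r)%R ->
  (16 * delta * B * K <= mu)%R -> (4 * K * delta <= mu)%R ->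
  (delta * (2 * c1 + c2 * (2 + T) / (r * r)) <= kap / (1 + T))%R ->
  (0 <= tau)%R -> (tau + delta <= T)%R -> chain_dom z tau ->
  exists l, chain_map l (tau + delta) = chain_map z tau /\ chain_dom l (tau + delta) /\
    (Cmod (l - z) <= 4 * delta * B)%R.
Proof.
  intros HT Hd1 Hd2 Hd3 Hd4 Hd5 Hd6 Ht HtT Hz.
  assert (Pmu : (0 < mu)%R) by (apply Rmult_lt_0_compat; lra).
  assert (PK : (0 < K)%R) by (apply Rmult_lt_0_compat; lra).
  assert (PB : (0 < B)%R) by (apply Rdiv_lt_0_compat; lra).
  assert (Pc : (0 < c)%R).
  { unfold c. apply Rdiv_lt_0_compat; auto.
    assert (0 < K * B)%R by (apply Rmult_lt_0_compat; auto).
    assert (0 < K * B * (4 * B + 1))%R by (apply Rmult_lt_0_compat; lra). lra. }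
  assert (Rzr := chain_dom_le z tau Ht Hz). assert (Rz : (Cmod z <= R1)%R) by lra.
  pose proof (chain_deriv_lower z tau Ht Hz) as HL. fold mu in HL. set (L := chain_deriv z tau) in *.
  assert (NL : L <> 0) by (apply Cmod_gt_0; lra).
  assert (It : (0 <= tau <= T)%R) by lra. assert (It' : (0 <= tau + delta <= T)%R) by lra.
  set (tau' := (tau + delta)%R) in *.
  (* Newton's map with the derivative frozen at (z, tau): its fixed points solve chain_map x tau' =
     chain_map z tau, and its first iterate from [z] is explicit. *)
  set (N := fun x => x - (chain_map x tau' - chain_map z tau) / L).
  (* On the ball of radius [rho], the derivative at time tau' differs from [L] by at most K (rho +
     delta). For rho = 4 delta B, [Hd4] and [Hd5] bring the factor down to 1/2. *)
  assert (Contr : forall rho x y, (rho <= R1 - r)%R -> (Cmod (x - z) <= rho)%R -> (Cmod (y - z) <= rho)%R ->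
    (Cmod (N x - N y) <= K * (rho + delta) / mu * Cmod (x - y))%R).
  { intros rho x y Hrho Hx Hy.
    assert (Bx : forall w, (Cmod (w - z) <= rho)%R -> (Cmod w <= R1)%R).
    { intros w Hw. pose proof (Cmod_reverse_triangle w z). lra. }
    assert (MV : (Cmod ((chain_map x tau' - L * x) - (chain_map y tau' - L * y)) <= K * (rho + delta) * Cmod (x - y))%R).
    { apply (Did_mean_value (fun w => chain_map w tau' - L * w) (fun w => chain_deriv w tau' - L)).
      - intros t Hts. apply D_minus. apply Did_chain_map, Cmod_seg_le; auto.
        eapply D_eq; [|apply D_scal, D_coord]; ring.
      - intros t Hts. unfold L. eapply Rle_trans. apply (chain_deriv_lip T); auto; try lra. apply Cmod_seg_le; auto.
        fold K. apply Rmult_le_compat_l. lra. apply Rplus_le_compat.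
        + replace (seg y x t - z) with (seg (y - z) (x - z) t) by (unfold seg; ring). now apply Cmod_seg_le.
        + unfold tau'. replace (tau + delta - tau)%R with delta by ring. rewrite Rabs_right; lra. }
    replace (N x - N y) with (- (((chain_map x tau' - L * x) - (chain_map y tau' - L * y)) / L)) by (unfold N; field; auto).
    rewrite Cmod_opp, Cmod_div by auto.
    apply Rle_trans with (K * (rho + delta) * Cmod (x - y) / mu)%R.
    2: { right. field. lra. }
    unfold Rdiv. apply Rmult_le_compat; auto. apply Cmod_ge_0.
    left. apply Rinv_0_lt_compat. lra. apply Rinv_le_contravar; lra. }
  assert (Nz : N z = z - RtoC delta * (z * E z) / L).
  { unfold N, chain_map, tau'. rewrite RtoC_plus. field. auto. }
  assert (Nz1 : (Cmod (N z - z) <= delta * B)%R).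
  { rewrite Nz. replace (z - RtoC delta * (z * E z) / L - z) with (- (RtoC delta * (z * E z / L))) by (field; auto).
    rewrite Cmod_opp. apply Cmod_prod_le. rewrite Cmod_R, Rabs_right; lra.
    rewrite Cmod_div by auto. unfold B, Rdiv. apply Rmult_le_compat.
    apply Cmod_ge_0. left. apply Rinv_0_lt_compat. lra.
    replace M with (1 * M)%R by ring. apply Cmod_prod_le; auto. lra. apply Rinv_le_contravar; lra. }
  destruct (contraction_fixpoint N z (4 * delta * B) (delta * B)) as (l & Hl & Nl); auto; try lra.
  { intros x y Hx Hy. eapply Rle_trans. apply (Contr (4 * delta * B)%R); auto.
    apply Rmult_le_compat_r. apply Cmod_ge_0.
    apply Rmult_le_reg_r with mu; auto. unfold Rdiv. rewrite Rmult_assoc, Rinv_l by lra. lra. }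
  exists l. split; [|split; [|lra]].
  { assert (Z : (chain_map l tau' - chain_map z tau) / L = 0).
    { replace ((chain_map l tau' - chain_map z tau) / L) with (l - N l) by (unfold N; ring). rewrite Nl. ring. }
    replace (chain_map l tau') with ((chain_map l tau' - chain_map z tau) / L * L + chain_map z tau) by (field; auto).
    rewrite Z. ring. }
  assert (Hx := chain_factor_near z tau Ht Hz). assert (Hxl := chain_factor_lower z tau Ht Hz).
  assert (EL : L = E z * chain_factor z tau) by (apply chain_deriv_eq; auto).
  set (x := chain_factor z tau) in *.
  assert (Nx : x <> 0) by (apply Cmod_gt_0; lra).
  assert (NE : E z <> 0). { intros Z. apply NL. rewrite EL, Z. ring. }
  assert (Nz2 : N z = z * ((x - RtoC delta) / x)).
  { rewrite Nz, EL. field. auto. }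
  set (a := (Cmod ((x - RtoC delta) / x))%R).
  assert (Pa : (0 <= a)%R) by apply Cmod_ge_0.
  set (s := (1 + tau)%R) in *.
  assert (Hs : (1 <= s <= 1 + T)%R) by (unfold s; lra).
  (* The first Newton iterate multiplies |z| by [a]. The rate (1 + kap) / s comes from 2 Re (1 / x)
     >= 2 / ((1 + th) s), since 1 + kap = 2 / (1 + th). *)
  assert (Ha : (a * a <= 1 - delta * (1 + kap) / s + delta * delta * c1)%R).
  { pose proof (Cmod_sub_real_le x s th delta ltac:(lra) th_bounds ltac:(lra) Hx) as H. fold kap in H.
    assert (Ea : (a * Cmod x = Cmod (x - RtoC delta))%R).
    { unfold a. rewrite <- Cmod_mult. f_equal. field; auto. }
    rewrite <- Ea in H.
    assert (Px : (0 < Cmod x)%R) by lra.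
    assert (H7 : (a * a <= 1 - delta * (1 + kap) / s + delta * delta * / (Cmod x * Cmod x))%R).
    { apply Rmult_le_reg_r with (Cmod x * Cmod x * s)%R. repeat apply Rmult_lt_0_compat; lra.
      replace ((1 - delta * (1 + kap) / s + delta * delta * / (Cmod x * Cmod x)) * (Cmod x * Cmod x * s))%R
        with (Cmod x ^ 2 * (s - delta * (1 + kap)) + delta * delta * s)%R by (field; lra).
      replace (a * a * (Cmod x * Cmod x * s))%R with ((a * Cmod x) ^ 2 * s)%R by ring. auto. }
    eapply Rle_trans. apply H7. apply Rplus_le_compat_l. apply Rmult_le_compat_l. nra.
    unfold c1. apply Rinv_le_contravar. nra. apply Rmult_le_compat; lra. }
  assert (Ha2 : (a <= 2)%R).
  { unfold a. replace ((x - RtoC delta) / x) with (1 - RtoC delta / x) by (field; auto).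
    eapply Rle_trans. apply Cmod_sub_le. rewrite Cmod_1, Cmod_div, Cmod_R, Rabs_right by (auto; lra).
    assert (delta / Cmod x <= 1)%R.
    { apply Rmult_le_reg_r with (Cmod x). lra. unfold Rdiv. rewrite Rmult_assoc, Rinv_l by lra. lra. }
    lra. }
  (* Since l = N l, the distance from [l] to the first iterate is |N l - N z|; there the contraction
     factor and |l - z| are both of order delta, so the correction is of second order. *)
  assert (Hl2 : (Cmod l <= Cmod z * a + c * (delta * delta))%R).
  { replace l with (N z + (N l - N z)) by (rewrite Nl; ring).
    eapply Rle_trans. apply Cmod_triangle. rewrite Nz2 at 1. rewrite Cmod_mult. fold a.
    apply Rplus_le_compat_l. eapply Rle_trans. apply (Contr (4 * delta * B)%R); auto. lra.
    replace (z - z) with (RtoC 0) by ring. rewrite Cmod_0.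
    apply Rmult_le_pos; [apply Rmult_le_pos|]; lra.
    apply Rle_trans with (K * (4 * delta * B + delta) / mu * (4 * delta * B))%R.
    apply Rmult_le_compat_l. apply Rdiv_le_0_compat; auto. apply Rmult_le_pos. lra.
    assert (0 <= delta * B)%R by (apply Rmult_le_pos; lra). lra. lra.
    right. unfold c. field. lra. }
  unfold chain_dom in Hz |- *. fold s in Hz. replace (1 + tau')%R with (s + delta)%R by (unfold s, tau'; ring).
  set (y := Cmod z) in *. assert (Py : (0 <= y)%R) by apply Cmod_ge_0.
  set (D2 := (delta * delta)%R) in *. assert (PD2 : (0 < D2 <= 1)%R) by (unfold D2; nra).
  assert (HD2 : (D2 <= delta)%R) by (unfold D2; nra).
  assert (Hlsq : (Cmod l ^ 2 <= y * y * (a * a) + c2 * D2)%R).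
  { apply Rle_trans with ((y * a + c * D2) ^ 2)%R. apply pow_incr. split; auto. apply Cmod_ge_0.
    replace ((y * a + c * D2) ^ 2)%R with (y * y * (a * a) + (2 * (y * a) * c * D2 + c * c * (D2 * D2)))%R by ring.
    apply Rplus_le_compat_l. unfold c2.
    assert (y * a <= 2)%R. { replace 2%R with (1 * 2)%R by ring. apply Rmult_le_compat; lra. }
    assert (0 <= c * D2)%R by (apply Rmult_le_pos; lra).
    assert (y * a * (c * D2) <= 2 * (c * D2))%R by (apply Rmult_le_compat_r; auto).
    assert (c * c * (D2 * D2) <= c * c * D2)%R.
    { apply Rmult_le_compat_l. apply Rmult_le_pos; lra.
      rewrite <- (Rmult_1_r D2) at 3. apply Rmult_le_compat_l; lra. }
    lra. }
  set (A := (1 - delta * (1 + kap) / s + D2 * c1)%R) in *.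
  assert (HA : (0 <= A)%R) by (apply Rle_trans with (a * a)%R; auto; apply Rmult_le_pos; auto).
  assert (Hys : (y * y <= r * r / s)%R).
  { apply Rmult_le_reg_r with s. lra. replace (r * r / s * s)%R with (r ^ 2)%R by (field; lra).
    replace (y * y * s)%R with (y ^ 2 * s)%R by ring. auto. }
  assert (Hfin : (Cmod l ^ 2 <= r * r / s * A + c2 * D2)%R).
  { eapply Rle_trans. apply Hlsq. apply Rplus_le_compat_r.
    apply Rmult_le_compat; auto; apply Rmult_le_pos; auto. }
  assert (Pkap : (0 < kap)%R) by (apply Rdiv_lt_0_compat; lra).
  assert (Pc1 : (0 < c1)%R). { unfold c1. apply Rinv_0_lt_compat, Rmult_lt_0_compat; lra. }
  assert (Pc2 : (0 < c2)%R).
  { unfold c2. assert (0 < c * c)%R by (apply Rmult_lt_0_compat; auto). lra. }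
  assert (Pr2 : (0 < r * r)%R) by (apply Rmult_lt_0_compat; auto).
  apply Rle_trans with ((r * r / s * A + c2 * D2) * (s + delta))%R.
  { apply Rmult_le_compat_r; lra. }
  replace ((r * r / s * A + c2 * D2) * (s + delta))%R with
    (r * r * ((1 + delta / s) * A + c2 * D2 * (s + delta) / (r * r)))%R by (field; split; lra).
  replace (r ^ 2)%R with (r * r * 1)%R by ring. apply Rmult_le_compat_l. lra.
  assert (Pds : (0 < delta / s <= 1)%R).
  { split. apply Rdiv_lt_0_compat; lra. apply Rmult_le_reg_r with s. lra. unfold Rdiv. rewrite Rmult_assoc, Rinv_l by lra. lra. }
  (* The growth 1 + delta / s of 1 + tau cancels the 1 in 1 + kap. The surplus delta kap / s is what
     [Hd6] makes large enough to absorb every term of order delta^2. *)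
  assert (T1 : ((1 + delta / s) * A <= 1 - delta * kap / s + 2 * c1 * D2)%R).
  { unfold A. replace (delta * (1 + kap) / s)%R with (delta / s * (1 + kap))%R by (field; lra).
    replace (delta * kap / s)%R with (delta / s * kap)%R by (field; lra).
    set (q := (delta / s)%R) in *.
    assert (0 <= q * q * (1 + kap))%R by (apply Rmult_le_pos; [apply Rmult_le_pos|]; lra).
    assert (q * (D2 * c1) <= 1 * (D2 * c1))%R.
    { apply Rmult_le_compat_r. apply Rmult_le_pos; lra. lra. }
    lra. }
  assert (T2 : (c2 * D2 * (s + delta) / (r * r) <= D2 * (c2 * (2 + T) / (r * r)))%R).
  { unfold Rdiv. rewrite <- !Rmult_assoc. apply Rmult_le_compat_r. left. apply Rinv_0_lt_compat; lra.
    rewrite (Rmult_comm c2 D2). apply Rmult_le_compat_l. apply Rmult_le_pos; lra. lra. }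
  assert (T3 : (delta * (kap / (1 + T)) <= delta * kap / s)%R).
  { unfold Rdiv. rewrite <- Rmult_assoc. apply Rmult_le_compat_l.
    apply Rmult_le_pos; lra. apply Rinv_le_contravar; lra. }
  assert (T4 : (delta * (delta * (2 * c1 + c2 * (2 + T) / (r * r))) <= delta * (kap / (1 + T)))%R).
  { apply Rmult_le_compat_l; lra. }
  replace (delta * (delta * (2 * c1 + c2 * (2 + T) / (r * r))))%R with
    (2 * c1 * D2 + D2 * (c2 * (2 + T) / (r * r)))%R in T4 by (unfold D2; ring).
  lra.
Qed.

(** For large tau the chain is close to tau E(0) z. With q = 8 M / m, q^2 <= tau gives q |z| <= 1 on
    the domain and q <= tau gives 8 M <= tau m; each keeps one part of the deviation of the
    derivative below tau m / 4, against a main term of modulus at least tau m. *)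
Lemma chain_map_injective_large (tau : R) (z w : C) : ((8 * M / m) ^ 2 + 8 * M / m + 1 <= tau)%R ->
  chain_dom z tau -> chain_dom w tau -> chain_map z tau = chain_map w tau -> w = z.
Proof.
  intros Htau Hz Hw Heq. destruct (classic (w = z)) as [|Hn]; auto. exfalso.
  assert (Pw : (0 < Cmod (w - z))%R).
  { apply Cmod_gt_0. intros Zr. apply Hn. replace w with (w - z + z) by ring. rewrite Zr. ring. }
  set (q := (8 * M / m)%R) in *. assert (Pq : (0 < q)%R) by (apply Rdiv_lt_0_compat; lra).
  assert (Eq : (q * m = 8 * M)%R) by (unfold q; field; lra).
  assert (Ht : (0 <= tau)%R) by nra.
  assert (Rz := chain_dom_le z tau Ht Hz). assert (Rw := chain_dom_le w tau Ht Hw).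
  assert (Sm : forall x, chain_dom x tau -> (q * Cmod x <= 1)%R).
  { intros x Hx. unfold chain_dom in Hx. pose proof (Cmod_ge_0 x) as P.
    apply Rnot_lt_le. intros Hc.
    assert (1 < (q * Cmod x) * (q * Cmod x))%R by nra.
    assert (Cmod x ^ 2 * (q ^ 2) <= Cmod x ^ 2 * (1 + tau))%R. { apply Rmult_le_compat_l; nra. }
    nra. }
  assert (Rs : (r <= R1)%R) by lra.
  pose proof (Did_mean_value (fun x => chain_map x tau - RtoC tau * E 0 * x) (fun x => chain_deriv x tau - RtoC tau * E 0) z w
    (tau * m / 2)) as MV. cbv beta in MV.
  assert (Hb : (Cmod (chain_map w tau - RtoC tau * E 0 * w - (chain_map z tau - RtoC tau * E 0 * z)) <= tau * m / 2 * Cmod (w - z))%R).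
  { apply MV.
    - intros t Hts. apply D_minus. apply Did_chain_map, Cmod_seg_le; auto; lra. eapply D_eq; [|apply D_scal, D_coord]; ring.
    - intros t Hts. set (x := seg z w t).
      assert (Rx : (Cmod x <= R1)%R) by (apply Cmod_seg_le; auto; lra).
      assert (Qx : (q * Cmod x <= 1)%R).
      { assert (Cmod x <= / q)%R.
        { apply Cmod_seg_le; auto; apply Rmult_le_reg_l with q; auto; rewrite Rinv_r by lra; auto. }
        apply Rmult_le_compat_l with (r := q) in H; [|lra]. rewrite Rinv_r in H; lra. }
      unfold chain_deriv. replace ((1 + k) * E x + tau * (E x + x * E1 x) - tau * E 0) with
        ((1 + k) * E x + tau * ((E x - E 0) + x * E1 x)) by ring.
      assert (R0 : (Cmod 0 <= R1)%R) by (rewrite Cmod_0; lra).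
      assert (HE := E_lip x 0 Rx R0). replace (x - 0) with x in HE by ring.
      assert (G1 : (Cmod ((1 + k) * E x) <= 2 * M)%R) by (apply Cmod_prod_le; auto; apply one_k_bound).
      assert (G2 : (Cmod (RtoC tau * ((E x - E 0) + x * E1 x)) <= tau * (M * Cmod x + Cmod x * M))%R).
      { apply Cmod_prod_le. rewrite Cmod_R, Rabs_right; lra. apply Cmod_sum_le; auto. apply Cmod_prod_le; auto; lra. }
      eapply Rle_trans. apply Cmod_triangle.
      assert (G3 : (8 * (M * Cmod x) <= m)%R).
      { replace (8 * (M * Cmod x))%R with (m * (q * Cmod x))%R. nra. rewrite <- Rmult_assoc, (Rmult_comm m q), Eq. ring. }
      assert (G4 : (8 * M <= tau * m)%R). { rewrite <- Eq. apply Rmult_le_compat_r; nra. }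
      assert (tau * (8 * (M * Cmod x)) <= tau * m)%R by (apply Rmult_le_compat_l; auto).
      lra. }
  rewrite Heq in Hb.
  replace (chain_map w tau - tau * E 0 * w - (chain_map w tau - tau * E 0 * z)) with (- (tau * E 0 * (w - z))) in Hb by ring.
  rewrite Cmod_opp, !Cmod_mult, Cmod_R, Rabs_right in Hb by lra.
  apply Rmult_le_reg_r in Hb; auto.
  assert (m <= Cmod (E 0))%R. { apply E_lower. rewrite Cmod_0; lra. }
  assert (tau * m <= tau * Cmod (E 0))%R by (apply Rmult_le_compat_l; auto).
  assert (0 < tau * m)%R by (apply Rmult_lt_0_compat; nra). lra.
Qed.

Lemma loewner_injective (z w : C) : (Cmod z <= r)%R -> (Cmod w <= r)%R -> F z = F w -> z = w.
Proof.
  intros Hz Hw Heq.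
  set (T0 := ((8 * M / m) ^ 2 + 8 * M / m + 1)%R).
  assert (PT0 : (0 < T0)%R).
  { unfold T0. assert (0 < 8 * M / m)%R by (apply Rdiv_lt_0_compat; lra). nra. }
  (* As delta <= 1, some multiple of delta falls in [T0, T]; the continuation stops there. *)
  set (T := (T0 + 1)%R).
  set (mu := (m * (1 - th))%R). set (K := ((4 + 3 * T) * M)%R). set (B := (M / mu)%R).
  set (c := (4 * K * B * (4 * B + 1) / mu)%R). set (kap := ((1 - th) / (1 + th))%R).
  set (c1 := (/ ((1 - th) * (1 - th)))%R). set (c2 := (4 * c + c * c)%R).
  set (c3 := (2 * c1 + c2 * (2 + T) / (r * r))%R).
  assert (PT : (0 < T)%R) by (unfold T; lra).
  assert (Pmu : (0 < mu)%R) by (apply Rmult_lt_0_compat; lra).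
  assert (PK : (0 < K)%R) by (apply Rmult_lt_0_compat; lra).
  assert (PB : (0 < B)%R) by (apply Rdiv_lt_0_compat; lra).
  assert (Pc : (0 < c)%R).
  { unfold c. apply Rdiv_lt_0_compat; auto.
    assert (0 < K * B)%R by (apply Rmult_lt_0_compat; auto).
    assert (0 < K * B * (4 * B + 1))%R by (apply Rmult_lt_0_compat; lra). lra. }
  assert (Pkap : (0 < kap)%R) by (apply Rdiv_lt_0_compat; lra).
  assert (Pc1 : (0 < c1)%R). { unfold c1. apply Rinv_0_lt_compat, Rmult_lt_0_compat; lra. }
  assert (Pc2 : (0 < c2)%R).
  { unfold c2. assert (0 < c * c)%R by (apply Rmult_lt_0_compat; auto). lra. }
  assert (Pr2 : (0 < r * r)%R) by (apply Rmult_lt_0_compat; auto).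
  assert (Pc3 : (0 < c3)%R).
  { unfold c3. assert (0 < c2 * (2 + T) / (r * r))%R. apply Rdiv_lt_0_compat; auto. apply Rmult_lt_0_compat; lra. lra. }
  assert (Small : forall a b : R, (0 < a)%R -> (0 < b)%R -> exists d, (0 < d)%R /\ forall x, (0 < x <= d)%R -> (x * a <= b)%R).
  { intros a b Ha Hb. exists (b / a)%R. split. apply Rdiv_lt_0_compat; auto. intros x Hx.
    apply Rle_trans with (b / a * a)%R. apply Rmult_le_compat_r; lra. right; field; lra. }
  destruct (Small (4 * B)%R (R1 - r)%R) as (d1 & Pd1 & Hd1); try lra.
  destruct (Small (16 * B * K)%R mu) as (d2 & Pd2 & Hd2); auto.
  { assert (0 < B * K)%R by (apply Rmult_lt_0_compat; auto). lra. }
  destruct (Small (4 * K)%R mu) as (d3 & Pd3 & Hd3); auto; try lra.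
  destruct (Small c3 (kap / (1 + T))%R) as (d4 & Pd4 & Hd4); auto. { apply Rdiv_lt_0_compat; lra. }
  set (delta := (Rmin (Rmin 1 (1 - th)) (Rmin (Rmin d1 d2) (Rmin d3 d4)))%R).
  assert (Pd : (0 < delta)%R) by (unfold delta; repeat apply Rmin_glb_lt; lra).
  assert (Q1 := Rmin_l (Rmin 1 (1 - th)) (Rmin (Rmin d1 d2) (Rmin d3 d4))).
  assert (Q2 := Rmin_r (Rmin 1 (1 - th)) (Rmin (Rmin d1 d2) (Rmin d3 d4))). fold delta in Q1, Q2.
  assert (Q3 := Rmin_l (Rmin d1 d2) (Rmin d3 d4)). assert (Q4 := Rmin_r (Rmin d1 d2) (Rmin d3 d4)).
  assert (Q5 := Rmin_l d1 d2). assert (Q6 := Rmin_r d1 d2). assert (Q7 := Rmin_l d3 d4). assert (Q8 := Rmin_r d3 d4).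
  assert (Q9 := Rmin_l 1 (1 - th)). assert (Q10 := Rmin_r 1 (1 - th)).
  specialize (Hd1 delta ltac:(lra)). specialize (Hd2 delta ltac:(lra)).
  specialize (Hd3 delta ltac:(lra)). specialize (Hd4 delta ltac:(lra)).
  destruct (classic (z = w)) as [|Hn]; auto. exfalso.
  assert (I : forall n, (INR n * delta <= T)%R -> exists z' w', z' <> w' /\ chain_dom z' (INR n * delta) /\
     chain_dom w' (INR n * delta) /\ chain_map z' (INR n * delta) = chain_map w' (INR n * delta)).
  { induction n.
    - intros _. simpl INR. rewrite Rmult_0_l. exists z, w. split; auto. unfold chain_dom.
      rewrite Rplus_0_r, !Rmult_1_r. split; [|split].
      apply pow_incr; split; auto; apply Cmod_ge_0. apply pow_incr; split; auto; apply Cmod_ge_0.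
      unfold chain_map. rewrite Heq. ring.
    - intros HS. rewrite S_INR in *. set (tau := (INR n * delta)%R) in *.
      replace ((INR n + 1) * delta)%R with (tau + delta)%R in * by (unfold tau; ring).
      assert (Ptau : (0 <= tau)%R). { unfold tau. apply Rmult_le_pos. apply pos_INR. lra. }
      destruct (IHn ltac:(lra)) as (z' & w' & Hne & Dz & Dw & He).
      destruct (chain_step T delta z' tau) as (lz & Ez & Lz & Bz); fold mu; fold K; fold B; fold c; fold kap; fold c1; fold c2; fold c3; auto; try lra.
      destruct (chain_step T delta w' tau) as (lw & Ew & Lw & Bw); fold mu; fold K; fold B; fold c; fold kap; fold c1; fold c2; fold c3; auto; try lra.
      fold mu in Bz, Bw; fold B in Bz, Bw.
      exists lz, lw. repeat split; auto; [|congruence].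
      (* If the two continued points met, their predecessors would both be within 4 delta B of the
         common point, hence within 8 delta B of each other, where the chain at time [tau] is
         injective. *)
      intros Hlw. subst lw. apply Hne. symmetry. apply (chain_map_local_injective T z' w' tau); auto; try lra.
      fold K mu. pose proof (Cmod_sub_triangle w' lz z') as H. rewrite (Cmod_sub_sym w' lz) in H.
      apply Rle_lt_trans with (8 * delta * B * K)%R. apply Rmult_le_compat_r; lra. lra. }
  destruct (INR_unbounded (T0 / delta)) as [n0 Hn0].
  assert (Ex : exists n, (T0 <= INR n * delta <= T)%R).
  { assert (Hge : (T0 <= INR n0 * delta)%R).
    { apply Rlt_le. apply Rmult_lt_compat_r with (r := delta) in Hn0; auto.
      replace (T0 / delta * delta)%R with T0 in Hn0 by (field; lra). auto. }
    clear - Hge PT0 Pd Q1 Q9. unfold T. induction n0.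
    - simpl in Hge. lra.
    - rewrite S_INR in Hge. destruct (Rle_lt_dec T0 (INR n0 * delta)) as [H|H]. auto.
      exists (S n0). rewrite S_INR. lra. }
  destruct Ex as [n Hnn]. destruct (I n ltac:(lra)) as (z' & w' & Hne & Dz & Dw & He).
  apply Hne. symmetry. apply (chain_map_injective_large (INR n * delta)); auto. exact (proj1 Hnn).
Qed.

End Loewner.

(** * Sufficiency *)

Lemma analytic_derivable f : analytic_on_disk f <-> derivable_disk f.
Proof.
  split; intros H z Hz; destruct (H z Hz) as [l Hl]; exists l; now apply is_derive_Did.
Qed.

Lemma in_disk_0 : in_disk 0.
Proof. unfold in_disk. rewrite Cmod_0. lra. Qed.

Lemma derivable_disk_exp (g : C) (h : C -> C) : derivable_disk h -> derivable_disk (fun z => cexp (g * h z)).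
Proof.
  intros H z Hz. destruct (H z Hz) as [l Hl]. eexists. now apply D_cexp, D_scal, Hl.
Qed.

Lemma Jgamma_segint (g : C) (h : C -> C) (z : C) : derivable_disk h -> in_disk z ->
  Jgamma g h z = segint (fun w => cexp (g * h w)) 0 z.
Proof.
  intros Hh Hz. apply Cint_unique. unfold segint.
  apply is_Cint_ext with (fun t => (z - 0) * cexp (g * h (seg 0 z t))). lra.
  - intros t _. replace (seg 0 z t) with (RtoC t * z) by (unfold seg; ring). ring.
  - apply is_Cint_scal.
    exact (is_segint (fun w => cexp (g * h w)) (derivable_disk_Cid _ (derivable_disk_exp g h Hh)) 0 z in_disk_0 Hz).
Qed.

Lemma Did_Jgamma (g : C) (h : C -> C) (z : C) : derivable_disk h -> in_disk z ->
  Did (Jgamma g h) z (cexp (g * h z)).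
Proof.
  intros Hh Hz. apply (D_ext_near _ (segint (fun w => cexp (g * h w)) 0) _ _ _ (1 - Cmod z)).
  unfold in_disk in Hz; lra.
  - intros s Hs. symmetry. apply Jgamma_segint; auto. now apply (in_disk_near z).
  - apply (Did_primitive (fun w => cexp (g * h w))); auto.
    apply derivable_disk_Cid. all: now apply derivable_disk_exp.
Qed.

Lemma Jgamma_0 (g : C) (h : C -> C) : derivable_disk h -> Jgamma g h 0 = 0.
Proof.
  intros Hh. rewrite Jgamma_segint by auto using in_disk_0. unfold segint. ring.
Qed.

Lemma Jgamma_classA (g : C) (h : C -> C) : derivable_disk h -> h 0 = 0 -> classA (Jgamma g h).
Proof.
  intros Hh H0. split; [|split].
  - apply analytic_derivable. intros z Hz. eexists. now apply Did_Jgamma.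
  - now apply Jgamma_0.
  - apply is_derive_Did. eapply D_eq. 2: apply Did_Jgamma; auto using in_disk_0.
    rewrite H0. replace (g * 0) with (RtoC 0) by ring. apply cexp_0.
Qed.

Lemma Cmod_sq (z : C) : (Cmod z * Cmod z = fst z * fst z + snd z * snd z)%R.
Proof. pose proof (Cmod2_alt z). unfold Re, Im in H. simpl in H. lra. Qed.

Lemma Cmod_le_of_sq (z : C) (B : R) : (0 <= B)%R -> (fst z * fst z + snd z * snd z <= B * B)%R -> (Cmod z <= B)%R.
Proof.
  intros HB H. rewrite <- Cmod_sq in H. pose proof (Cmod_ge_0 z). apply Rnot_lt_le. intros Hl. nra.
Qed.

(** The line Re v = -1 is the perpendicular bisector of the segment from -2 to 0. *)
Lemma Cmod_le_half_plane (v : C) : (-1 <= Re v)%R -> (Cmod v <= Cmod (v + 2))%R.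
Proof.
  intros H. apply Cmod_le_of_sq. apply Cmod_ge_0. rewrite Cmod_sq. destruct v; unfold Re in H; simpl in *. nra.
Qed.

(* [|w| <= x] for [w = v / (v + 2)] puts [v] in the disk of centre [2 x^2 / (1 - x^2)]
   and radius [2 x / (1 - x^2)]. *)
Lemma apollonius_disk (v : C) (x : R) : (0 <= x < 1)%R -> (Cmod v <= x * Cmod (v + 2))%R ->
  (Cmod (RtoC (1 - x * x) * v - RtoC (2 * x * x)) <= 2 * x)%R.
Proof.
  intros Hx H. pose proof (Cmod_ge_0 v) as P1.
  assert (H2 : (Cmod v * Cmod v <= x * x * (Cmod (v + 2) * Cmod (v + 2)))%R).
  { replace (x * x * (Cmod (v + 2) * Cmod (v + 2)))%R with ((x * Cmod (v + 2)) * (x * Cmod (v + 2)))%R by ring.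
    apply Rmult_le_compat; auto. }
  rewrite !Cmod_sq in H2. apply Cmod_le_of_sq. lra. destruct v as [a b]. simpl in *.
  assert (Hq : (0 < 1 - x * x)%R) by nra.
  assert (H3 : ((1 - x * x) * (a * a + b * b) <= x * x * (4 * a + 4))%R) by lra.
  assert (H4 : ((1 - x * x) * ((1 - x * x) * (a * a + b * b)) <= (1 - x * x) * (x * x * (4 * a + 4)))%R)
    by (apply Rmult_le_compat_l; lra).
  lra.
Qed.

(** This is [Q_bound] for k = - r^2 c, Q = (c / 2) v and th = r, with x = |z|. Writing (1 - x^2) v =
    2 x^2 + e with |e| <= 2 x separates a real term from an error tau e / 2. *)
Lemma chain_bound (c v : C) (r x tau : R) : (0 < r < 1)%R -> (Cmod c <= 1)%R -> (0 <= tau)%R -> (0 <= x)%R ->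
  (x ^ 2 * (1 + tau) <= r ^ 2)%R -> (Cmod v <= x * Cmod (v + 2))%R ->
  (Cmod (- (RtoC (r * r) * c) + RtoC tau * (c / 2 * v)) <= r * (1 + tau))%R.
Proof.
  intros Hr Hc Ht Hx Hd Hv.
  assert (Hxr : (x <= r)%R). { apply Rnot_lt_le. intros Hl. nra. }
  assert (Hq : (0 < 1 - x * x)%R) by nra.
  pose proof (apollonius_disk v x ltac:(lra) Hv) as HA.
  set (e := RtoC (1 - x * x) * v - RtoC (2 * x * x)) in *.
  assert (Nq : RtoC (1 - x * x) <> 0) by (apply RtoC_neq_0; lra).
  assert (Ev : v = (e + RtoC (2 * x * x)) / RtoC (1 - x * x)) by (unfold e; field; auto).
  replace (- (RtoC (r * r) * c) + RtoC tau * (c / 2 * v)) with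
    (c * ((- RtoC (r * r - tau * (x * x) - r * r * (x * x)) + RtoC tau * (e / 2)) / RtoC (1 - x * x))).
  2: { rewrite Ev. rewrite !RtoC_minus, !RtoC_mult. rewrite !RtoC_minus, !RtoC_mult in Nq. field. auto. }
  rewrite <- (Rmult_1_l (r * (1 + tau))). apply Cmod_prod_le; auto.
  rewrite Cmod_div, Cmod_R, Rabs_right by (auto; lra).
  apply Rmult_le_reg_r with (1 - x * x)%R; auto. unfold Rdiv. rewrite Rmult_assoc, Rinv_l, Rmult_1_r by lra.
  eapply Rle_trans. apply Cmod_triangle.
  assert (P1 : (0 <= r * r - tau * (x * x) - r * r * (x * x))%R).
  { assert (r * r * (x * x) <= 1 * (x * x))%R by (apply Rmult_le_compat_r; nra). lra. }
  rewrite Cmod_opp, Cmod_mult, !Cmod_R, Cmod_half.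
  rewrite (Rabs_right (r * r - _ - _)), (Rabs_right tau) by lra.
  assert (P2 : (tau * (Cmod e / 2) <= tau * x)%R) by (apply Rmult_le_compat_l; lra).
  (* The sum of [P3] and [P5] is exactly r (1 + tau) (1 - x^2) minus the estimate r^2 - tau x^2 -
     r^2 x^2 + tau x reached so far. *)
  assert (P3 : (0 <= r * (1 - r) * (1 - x * x))%R) by (apply Rmult_le_pos; nra).
  assert (P4 : (0 <= (1 - x) * (r * (1 + x) - x))%R) by (apply Rmult_le_pos; nra).
  assert (P5 : (0 <= tau * ((1 - x) * (r * (1 + x) - x)))%R) by (apply Rmult_le_pos; lra).
  lra.
Qed.

(* The disk estimate for [z h'] behind Ahlfors' univalence criterion. *)
Lemma spirallike_log_derivative (alpha lambda : R) (f h h1 : C -> C) :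
  (lambda < 1)%R -> (- (PI / 2) < alpha < PI / 2)%R -> spirallike alpha lambda f -> log_branch f h ->
  (forall z, in_disk z -> Did h z (h1 z)) -> derivable_disk h1 ->
  forall z, in_disk z ->
  let v := cexp (0, alpha) * (z * h1 z) / RtoC ((1 - lambda) * cos alpha) in
  (Cmod v <= Cmod z * Cmod (v + 2))%R.
Proof.
  intros Hl Ha (HA & Hnz & Hre) (Hh & H0 & Hlog) Hh1 Hd1 z Hz.
  assert (Pcos : (0 < cos alpha)%R) by (apply cos_gt_0; lra).
  set (A := ((1 - lambda) * cos alpha)%R). assert (PA : (0 < A)%R) by (apply Rmult_lt_0_compat; lra).
  assert (NA : RtoC A <> 0) by (apply RtoC_neq_0; lra).
  assert (Hf0 : f 0 = 0) by apply HA.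
  assert (Ef : forall w, in_disk w -> f w = w * cexp (h w)).
  { intros w Hw. destruct (classic (w = 0)) as [->|Hw0]. rewrite Hf0; ring.
    rewrite (Hlog w Hw Hw0). field; auto. }
  assert (Df : forall w, in_disk w -> Did f w (cexp (h w) * (1 + w * h1 w))).
  { intros w Hw. apply (D_ext_near _ (fun s => s * cexp (h s)) f w _ (1 - Cmod w)).
    unfold in_disk in Hw; lra.
    - intros s Hs. symmetry. apply Ef. now apply (in_disk_near w).
    - eapply D_eq. 2: { apply D_mult. apply D_coord. apply D_cexp, Hh1, Hw. } cbv beta. ring. }
  set (v := fun w => cexp (0, alpha) * (w * h1 w) / RtoC A).
  (* Since z f' / f = 1 + z h', the spirallike quantity is e^(i alpha) + A v, with real part cos
     alpha + A Re v; the constant [A] is chosen to turn the bound lambda cos alpha into -1. *)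
  assert (Rev : forall w, in_disk w -> (-1 < Re (v w))%R).
  { intros w Hw.
    assert (ER : (Re (cexp (0, alpha) * (1 + w * h1 w)) = cos alpha + A * Re (v w))%R).
    { replace (cexp (0, alpha) * (1 + w * h1 w)) with (cexp (0, alpha) + RtoC A * v w) by (unfold v; field; auto).
      unfold cexp, Re, Im; destruct (v w); simpl. rewrite exp_0. ring. }
    assert (HR : (lambda * cos alpha < Re (cexp (0, alpha) * (1 + w * h1 w)))%R).
    (* At the origin [spirallike] imposes nothing, but there v = 0. *)
    { destruct (classic (w = 0)) as [->|Hw0].
      - rewrite ER. replace (v 0) with (RtoC 0) by (unfold v; field; auto). simpl. nra.
      - specialize (Hre w _ Hw Hw0 (proj2 (is_derive_Did _ _ _) (Df w Hw))).
        replace (w * (cexp (h w) * (1 + w * h1 w)) / f w) with (1 + w * h1 w) in Hre. auto.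
        rewrite (Ef w Hw). field. split; auto. apply cexp_neq_0. }
    rewrite ER in HR. assert (EA : (A = cos alpha - lambda * cos alpha)%R) by (unfold A; ring).
    apply Rmult_lt_reg_l with A; auto. generalize dependent (Re (v w)). intros; lra. }
  assert (N2 : forall w, in_disk w -> v w + 2 <> 0).
  { intros w Hw Z. specialize (Rev w Hw).
    assert (Re (v w + 2) = 0)%R by (rewrite Z; reflexivity). destruct (v w); simpl in *. lra. }
  (* The map v -> v / (v + 2) sends the half plane Re v > -1 to the unit disk and fixes 0, so the
     Schwarz lemma applies. *)
  set (om := fun w => v w * / (v w + 2)).
  assert (Sch : (Cmod (om z) <= Cmod z)%R).
  { apply schwarz; auto.
    - intros w Hw. destruct (Hd1 w Hw) as [l2 Hl2].
      assert (Dv : Did v w (cexp (0, alpha) * (1 * h1 w + w * l2) * / RtoC A + cexp (0, alpha) * (w * h1 w) * 0)).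
      { unfold v, Cdiv. apply (D_mult _ (fun w => cexp (0%R, alpha) * (w * h1 w)) (fun _ => / RtoC A)). apply D_scal. apply D_mult. apply D_coord. apply Hl2. apply D_const. }
      eexists. apply D_mult. apply Dv. apply D_inv. apply D_plus. apply Dv. apply D_const. now apply N2.
    - unfold om. replace (v 0) with (RtoC 0) by (unfold v; field; auto). ring.
    - intros w Hw. unfold om. rewrite Cmod_mult, Cmod_inv by now apply N2.
      assert (P : (0 < Cmod (v w + 2))%R) by (apply Cmod_gt_0; now apply N2).
      apply Rmult_le_reg_r with (Cmod (v w + 2)); auto. rewrite Rmult_assoc, Rinv_l, Rmult_1_r, Rmult_1_l by lra.
      apply Cmod_le_half_plane. left. now apply Rev. }
  change (Cmod (v z) <= Cmod z * Cmod (v z + 2))%R.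
  replace (v z) with (om z * (v z + 2)) at 1 by (unfold om; field; now apply N2).
  rewrite Cmod_mult. apply Rmult_le_compat_r; auto. apply Cmod_ge_0.
Qed.

Lemma J_univalent (lambda : R) (gamma : C) (f h : C -> C) : (lambda < 1)%R ->
  (Cmod gamma <= 1 / (2 * (1 - lambda)))%R -> classS_lambda lambda f -> log_branch f h ->
  classS (Jgamma gamma h).
Proof.
  intros Hl Hg (alpha & Ha & Hsp) Hlog.
  assert (Hh : derivable_disk h) by (apply analytic_derivable, Hlog).
  assert (H0 : h 0 = 0) by apply Hlog.
  destruct (derivative_derivable h Hh) as (h1 & Hh1 & Hd1).
  split. now apply Jgamma_classA.
  intros z w Hz Hw Heq.
  set (r := ((1 + Rmax (Cmod z) (Cmod w)) / 2)%R).
  assert (Mx1 := Rmax_l (Cmod z) (Cmod w)). assert (Mx2 := Rmax_r (Cmod z) (Cmod w)).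
  assert (Mx3 : (Rmax (Cmod z) (Cmod w) < 1)%R) by (apply Rmax_lub_lt; auto).
  pose proof (Cmod_ge_0 z) as Pz.
  assert (Hr : (0 < r < 1)%R) by (unfold r; lra).
  set (R1 := ((1 + r) / 2)%R). assert (HR1 : (r < R1 < 1)%R) by (unfold R1; lra).
  assert (D1 : forall x, (Cmod x <= R1)%R -> in_disk x) by (intros x Hx; unfold in_disk; lra).
  set (E := fun x => cexp (gamma * h x)).
  set (E1 := fun x => gamma * h1 x * E x).
  assert (HE : derivable_disk E) by now apply derivable_disk_exp.
  assert (DE : forall x, in_disk x -> Did E x (E1 x)).
  { intros x Hx. eapply D_eq. 2: apply D_cexp, D_scal, Hh1, Hx. unfold E1, E. ring. }
  assert (HE1 : derivable_disk E1).
  { apply derivable_disk_mult; auto. intros x Hx. destruct (Hd1 x Hx) as [l Hl1]. eexists. apply D_scal, Hl1. }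
  (* The bound on E'' supplies the Lipschitz constant of E' required by the chain. *)
  destruct (derivative_derivable E1 HE1) as (E2 & DE1 & HE2).
  destruct (derivable_disk_bounded E R1 HE (proj2 HR1)) as (M0 & PM0 & BM0).
  destruct (derivable_disk_bounded E1 R1 HE1 (proj2 HR1)) as (M1 & PM1 & BM1).
  destruct (derivable_disk_bounded E2 R1 HE2 (proj2 HR1)) as (M2 & PM2 & BM2).
  (* An upper bound for 1 / E = exp (- gamma h) is a lower bound for |E|. *)
  destruct (derivable_disk_bounded (fun x => cexp (- gamma * h x)) R1) as (M3 & PM3 & BM3).
  { now apply derivable_disk_exp. } { lra. }
  assert (Pcos : (0 < cos alpha)%R) by (apply cos_gt_0; lra).
  set (A := ((1 - lambda) * cos alpha)%R). assert (PA : (0 < A)%R) by (apply Rmult_lt_0_compat; lra).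
  assert (NA : RtoC A <> 0) by (apply RtoC_neq_0; lra).
  (* Chosen so that gamma z h' = (c / 2) v; its modulus is 2 |gamma| (1 - lambda) cos alpha. *)
  set (c := 2 * gamma * RtoC A * / cexp (0, alpha)).
  assert (Nexp := cexp_neq_0 (0%R, alpha)).
  assert (Hc : (Cmod c <= 1)%R).
  { unfold c. rewrite !Cmod_mult, Cmod_inv, Cmod_cexp, !Cmod_R by auto. simpl Re. rewrite exp_0, Rinv_1, !Rabs_right by lra.
    assert (G : (Cmod gamma * (2 * (1 - lambda)) <= 1)%R).
    { apply Rle_trans with (1 / (2 * (1 - lambda)) * (2 * (1 - lambda)))%R. apply Rmult_le_compat_r; lra.
      right; field; lra. }
    pose proof (COS_bound alpha) as [_ Cb]. pose proof (Cmod_ge_0 gamma).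
    assert (A <= 1 - lambda)%R. { unfold A. rewrite <- (Rmult_1_r (1 - lambda)) at 2. apply Rmult_le_compat_l; lra. }
    assert (Cmod gamma * A <= Cmod gamma * (1 - lambda))%R by (apply Rmult_le_compat_l; auto). lra. }
  apply (loewner_injective (Jgamma gamma h) E E1 (fun x => gamma * (x * h1 x)) (- (RtoC (r * r) * c)) r R1 r
     (/ M3) (M0 + M1 + M2)); try lra.
  - now apply Rinv_0_lt_compat.
  - intros x Hx. apply Did_Jgamma; auto.
  - intros x Hx. apply DE; auto.
  - intros x Hx. specialize (BM3 x Hx). unfold E.
    replace (- gamma * h x) with (- (gamma * h x)) in BM3 by ring. rewrite cexp_opp, Cmod_inv in BM3 by apply cexp_neq_0.
    assert (P : (0 < Cmod (cexp (gamma * h x)))%R) by (apply Cmod_gt_0, cexp_neq_0).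
    rewrite <- (Rinv_inv (Cmod (cexp (gamma * h x)))). apply Rinv_le_contravar; auto. now apply Rinv_0_lt_compat.
  - intros x Hx. specialize (BM0 x Hx). lra.
  - intros x Hx. specialize (BM1 x Hx). lra.
  - intros x y Hx Hy. apply (Did_mean_value E1 E2).
    + intros t Ht. apply DE1, D1, Cmod_seg_le; auto.
    + intros t Ht. specialize (BM2 (seg y x t) (Cmod_seg_le _ _ _ _ Ht Hy Hx)). lra.
  - intros x Hx. unfold E1. ring.
  - intros x tau Ht Hd.
    assert (Hxr : (Cmod x <= r)%R) by (apply (chain_dom_le r ltac:(lra) x tau); auto).
    pose proof (spirallike_log_derivative alpha lambda f h h1 Hl Ha Hsp Hlog Hh1 Hd1 x (D1 x ltac:(lra))) as Hv.
    cbv zeta in Hv. fold A in Hv. set (v := cexp (0, alpha) * (x * h1 x) / RtoC A) in *.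
    replace (gamma * (x * h1 x)) with (c / 2 * v) by (unfold c, v; field; auto).
    apply chain_bound with (Cmod x); auto. apply Cmod_ge_0.
  - unfold r; lra.
  - unfold r; lra.
  - exact Heq.
Qed.

(** * Necessity *)

Lemma Did_zero_const (g : C -> C) : (forall z, in_disk z -> Did g z 0) ->
  forall z, in_disk z -> g z = g 0.
Proof.
  intros H z Hz.
  assert (Q : (Cmod (g z - g 0) <= 0 * Cmod (z - 0))%R).
  { apply Did_mean_value with (df := fun _ => 0).
    - intros t Ht. apply H. apply in_disk_seg; auto using in_disk_0.
    - intros t _. rewrite Cmod_0. lra. }
  rewrite Rmult_0_l in Q.
  assert (Z : g z - g 0 = 0) by (apply Cmod_eq_0, Rle_antisym; auto; apply Cmod_ge_0).
  replace (g z) with (g z - g 0 + g 0) by ring. rewrite Z. ring.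
Qed.

(* The principal branch of [log (1 - z)]. *)
Definition log1m (z : C) : C :=
  (/ 2 * ln ((1 - fst z) * (1 - fst z) + snd z * snd z), atan (- snd z / (1 - fst z)))%R.

Lemma log1m_0 : log1m 0 = 0.
Proof.
  unfold log1m; simpl.
  replace ((1 - 0) * (1 - 0) + 0 * 0)%R with 1%R by ring. rewrite ln_1.
  replace (- 0 / (1 - 0))%R with 0%R by field. rewrite atan_0. unfold RtoC. f_equal; ring.
Qed.

Lemma in_disk_fst (z : C) : in_disk z -> (fst z < 1)%R.
Proof.
  unfold in_disk. intros H. pose proof (re_le_Cmod z) as H1. pose proof (Rle_abs (Re z)).
  unfold Re in *. lra.
Qed.

Lemma one_minus_neq_0 (z : C) : in_disk z -> 1 - z <> 0.
Proof.
  intros Hz. apply Cmod_gt_0. pose proof (Cmod_reverse_triangle 1 z). rewrite Cmod_1 in H.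
  unfold in_disk in Hz. lra.
Qed.

Lemma DR_log1m_line (z : C) (t : R) : in_disk (RtoC t * z) ->
  DR (fun s => log1m (RtoC s * z)) t (z * - / (1 - RtoC t * z)).
Proof.
  intros Hz. apply in_disk_fst in Hz. destruct z as [x y]. simpl in Hz.
  replace (t * x - 0 * y)%R with (t * x)%R in Hz by ring.
  assert (P : (0 < (1 - t * x) * (1 - t * x) + t * y * (t * y))%R) by nra.
  eapply D_eq; [|apply DR_of_components].
  2: { apply (is_derive_ext (fun s => / 2 * ln ((1 - s * x) * (1 - s * x) + s * y * (s * y)))%R).
       intros s. unfold log1m; simpl. f_equal. f_equal. ring.
       auto_derive. lra. reflexivity. }
  2: { apply (is_derive_ext (fun s => atan (- (s * y) / (1 - s * x)))%R).
       intros s. unfold log1m; simpl. f_equal. f_equal; [ring|f_equal; ring].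
       auto_derive. lra. reflexivity. }
  unfold Cinv, Cmult, Cminus, Cplus, Copp, RtoC; simpl. f_equal; field; repeat split; try lra; nra.
Qed.

(** The derivative along rays from 0 identifies [log1m] with the holomorphic primitive of -1 / (1 -
    z); this replaces a two-variable differentiation of its components. *)
Lemma Did_log1m (z : C) : in_disk z -> Did log1m z (- / (1 - z)).
Proof.
  set (g := fun w : C => - / (1 - w)).
  assert (Hg : derivable_disk g).
  { intros w Hw. eexists. apply D_opp, D_inv. apply D_minus. apply D_const. apply D_coord. now apply one_minus_neq_0. }
  assert (E : forall w, in_disk w -> log1m w = segint g 0 w).
  { intros w Hw.
    assert (Hs : forall t, (0 <= t <= 1)%R -> in_disk (RtoC t * w)).
    { intros t Ht. replace (RtoC t * w) with (seg 0 w t) by (unfold seg; ring). apply in_disk_seg; auto using in_disk_0. }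
    pose proof (is_Cint_FTC (fun s => log1m (RtoC s * w)) (fun s => w * g (RtoC s * w)) 0 1 ltac:(lra)) as H.
    cbv beta in H.
    assert (E0 : log1m (0 * w) = 0).
    { replace (0 * w) with (RtoC 0) by ring. apply log1m_0. }
    rewrite E0 in H. replace (log1m (1 * w) - 0) with (log1m w) in H by (rewrite Cmult_1_l; ring).
    assert (I := H (fun t Ht => DR_log1m_line w t (Hs t Ht))
      (fun t Ht => Ct_mult RtoC (fun _ => w) (fun s => g (RtoC s * w)) t (Ct_const _ _ _)
        (Ct_comp RtoC g (fun s => RtoC s * w) t (Ct_mult _ _ _ _ (Ct_coord RtoC t) (Ct_const _ _ _))
          (derivable_disk_Cid g Hg _ (Hs t Ht))))).
    pose proof (is_Cint_scal w _ _ _ _ (is_segint g (derivable_disk_Cid g Hg) 0 w in_disk_0 Hw)) as I2.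
    apply Cint_unique in I. rewrite <- I. unfold segint. replace (w - 0) with w by ring.
    apply Cint_unique. revert I2. apply is_Cint_ext. lra.
    intros t _. f_equal. f_equal. unfold seg. ring. }
  intros Hz. apply (D_ext_near _ (segint g 0) _ _ _ (1 - Cmod z)). unfold in_disk in Hz; lra.
  - intros s Hs. symmetry. apply E. now apply (in_disk_near z).
  - apply (Did_primitive g); auto. now apply derivable_disk_Cid.
Qed.

(** The function (1 - z) exp (- log1m z) has zero derivative and the value 1 at 0. *)
Lemma cexp_log1m (z : C) : in_disk z -> cexp (log1m z) = 1 - z.
Proof.
  intros Hz.
  assert (H : (1 - z) * cexp (- log1m z) = (1 - 0) * cexp (- log1m 0)).
  { apply (Did_zero_const (fun w => (1 - w) * cexp (- log1m w))); auto.
    intros w Hw. eapply D_eq. 2: { apply D_mult. apply D_minus. apply D_const. apply D_coord.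
      apply D_cexp, D_opp, Did_log1m, Hw. }
    cbv beta. field. now apply one_minus_neq_0. }
  rewrite log1m_0 in H. replace (- (0)) with (RtoC 0) in H by ring. rewrite cexp_0, cexp_opp in H.
  pose proof (cexp_neq_0 (log1m z)).
  replace (1 - z) with ((1 - z) * / cexp (log1m z) * cexp (log1m z)) by (field; auto).
  rewrite H. ring.
Qed.

(** The condition on [u] is |1 - e^(u + i v)|^2 = 1 - 2 e^u cos v + e^(2 u) < 1. The lemma describes
    which logarithms are available when looking for two points with equal powers. *)
Lemma log1m_cexp (u v : R) : (- (PI / 2) < v < PI / 2)%R -> (exp u < 2 * cos v)%R ->
  in_disk (1 - cexp (u, v)) /\ log1m (1 - cexp (u, v)) = (u, v).
Proof.
  intros Hv Hu. assert (Pc : (0 < cos v)%R) by (apply cos_gt_0; lra).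
  pose proof (exp_pos u) as Pe.
  assert (SC : (cos v * cos v = 1 - sin v * sin v)%R).
  { pose proof (sin2_cos2 v). unfold Rsqr in H. lra. }
  split.
  - unfold in_disk. apply Rnot_le_lt. intros H.
    assert (H2 : (1 <= Cmod (1 - cexp (u, v)) * Cmod (1 - cexp (u, v)))%R) by nra.
    rewrite Cmod_sq in H2. unfold cexp in H2; simpl in H2.
    replace ((1 + - (exp u * cos v)) * (1 + - (exp u * cos v)) + (0 + - (exp u * sin v)) * (0 + - (exp u * sin v)))%R
      with (1 - 2 * (exp u * cos v) + exp u * exp u * (cos v * cos v + sin v * sin v))%R in H2 by ring.
    rewrite SC in H2. nra.
  - unfold log1m, cexp; simpl. f_equal.
    + replace ((1 - (1 + - (exp u * cos v))) * (1 - (1 + - (exp u * cos v))) + (0 + - (exp u * sin v)) * (0 + - (exp u * sin v)))%R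
        with (exp u * exp u * (cos v * cos v + sin v * sin v))%R by ring.
      rewrite SC. replace (exp u * exp u * (1 - sin v * sin v + sin v * sin v))%R with (exp (u + u)) by (rewrite exp_plus; ring).
      rewrite ln_exp. field.
    + rewrite <- (atan_tan v) at 3 by lra. f_equal. unfold tan.
      assert (0 < exp u * cos v)%R by (apply Rmult_lt_0_compat; auto). field. repeat split; lra.
Qed.

(** For this function e^(i alpha) z f' / f = e^(i alpha) + 2 (1 - lambda) cos alpha z / (1 - z).
    Since z / (1 - z) maps the disk into Re > -1/2, the real part exceeds cos alpha - (1 - lambda)
    cos alpha = lambda cos alpha. *)
Lemma classS_lambda_power (lambda alpha : R) (b := 2 * RtoC ((1 - lambda) * cos alpha) * / cexp (0, alpha)) :
  (lambda < 1)%R -> (- (PI / 2) < alpha < PI / 2)%R ->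
  classS_lambda lambda (fun z => z * cexp (- b * log1m z)) /\
  log_branch (fun z => z * cexp (- b * log1m z)) (fun z => - b * log1m z).
Proof.
  intros Hl Ha.
  assert (Pcos : (0 < cos alpha)%R) by (apply cos_gt_0; lra).
  set (f := fun z => z * cexp (- b * log1m z)).
  assert (Df : forall z, in_disk z -> Did f z (cexp (- b * log1m z) * (1 + b * (z / (1 - z))))).
  { intros z Hz. eapply D_eq. 2: { apply D_mult. apply D_coord. apply D_cexp, D_scal, Did_log1m, Hz. }
    cbv beta. field. now apply one_minus_neq_0. }
  assert (Nexp := cexp_neq_0 (0%R, alpha)).
  split.
  - exists alpha. split; auto. split; [split; [|split]|split].
    + intros z Hz. eexists. now apply is_derive_Did, Df.
    + unfold f. ring.
    + apply is_derive_Did. eapply D_eq. 2: apply Df, in_disk_0.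
      rewrite log1m_0. replace (- b * 0) with (RtoC 0) by ring. rewrite cexp_0. replace (1 - 0) with (RtoC 1) by ring. field.
    + intros z Hz Hz0 Z. unfold f in Z. apply (Cmult_neq_0 _ _ Hz0 (cexp_neq_0 (- b * log1m z)) Z).
    + intros z l Hz Hz0 Hd. apply is_derive_Did in Hd.
      rewrite (D_unique f z _ _ Hd (Df z Hz)).
      pose proof (one_minus_neq_0 z Hz) as N1.
      set (q := z / (1 - z)).
      replace (z * (cexp (- b * log1m z) * (1 + b * q)) / f z) with (1 + b * q).
      2: { unfold f. field. split; auto. apply cexp_neq_0. }
      replace (cexp (0, alpha) * (1 + b * q)) with (cexp (0, alpha) + RtoC (2 * ((1 - lambda) * cos alpha)) * q).
      2: { unfold b. rewrite RtoC_mult. field. auto. }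
      assert (Hq : (- / 2 < Re q)%R).
      { assert (Eq : q = (/ (1 - z)) - 1) by (unfold q; field; auto).
        assert (Hm : (Cmod z * Cmod z < 1)%R). { unfold in_disk in Hz. pose proof (Cmod_ge_0 z). nra. }
        rewrite Cmod_sq in Hm. rewrite Eq.
        pose proof (proj1 (Cmod_gt_0 _) N1) as P1. assert (P2 : (0 < Cmod (1 - z) * Cmod (1 - z))%R) by nra.
        rewrite Cmod_sq in P2.
        destruct z as [x y]. unfold Re, Cinv, Cminus, Cplus, Copp, RtoC in *; simpl in *.
        apply Rmult_lt_reg_r with ((1 + - x) * (1 + - x) + (0 + - y) * (0 + - y))%R; auto.
        match goal with |- (_ < ?p)%R => replace p with ((1 + - x) - ((1 + - x) * (1 + - x) + (0 + - y) * (0 + - y)))%R by (field; nra) end.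
        nra. }
      destruct q as [q1 q2]. unfold cexp, Re, Im in *; simpl in *. rewrite exp_0.
      assert (0 < (1 - lambda) * cos alpha)%R by (apply Rmult_lt_0_compat; lra).
      assert ((1 - lambda) * cos alpha * (- / 2) < (1 - lambda) * cos alpha * q1)%R by (apply Rmult_lt_compat_l; auto).
      nra.
  - split; [|split].
    + apply analytic_derivable. intros z Hz. eexists. apply D_scal, Did_log1m, Hz.
    + rewrite log1m_0. ring.
    + intros z Hz Hz0. unfold f. field. auto.
Qed.

(** Both sides vanish at 0 and have the derivative (1 - z)^(a - 1). *)
Lemma Jgamma_power (b g : C) (z : C) (a := 1 - g * b) : a <> 0 -> in_disk z ->
  Jgamma g (fun z => - b * log1m z) z = (1 - cexp (a * log1m z)) / a.
Proof.
  intros Na Hz. set (h := fun z => - b * log1m z).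
  assert (Hh : derivable_disk h). { intros w Hw. eexists. apply D_scal, Did_log1m, Hw. }
  assert (E : Jgamma g h z - (1 - cexp (a * log1m z)) * / a = Jgamma g h 0 - (1 - cexp (a * log1m 0)) * / a).
  { apply (Did_zero_const (fun w => Jgamma g h w - (1 - cexp (a * log1m w)) * / a)); auto.
    intros w Hw. eapply D_eq. 2: { apply D_minus. apply Did_Jgamma; auto. apply D_mult; [|apply D_const].
      apply D_minus. apply D_const. apply D_cexp, D_scal, Did_log1m, Hw. }
    cbv beta. pose proof (one_minus_neq_0 w Hw) as N.
    replace (cexp (g * h w)) with (cexp (a * log1m w) * / cexp (log1m w)).
    2: { rewrite <- cexp_opp, <- cexp_plus. f_equal. unfold a, h. ring. }
    rewrite (cexp_log1m w Hw). field. auto. }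
  rewrite Jgamma_0, log1m_0 in E by auto. replace (a * 0) with (RtoC 0) in E by ring. rewrite cexp_0 in E.
  replace (Jgamma g h z) with (Jgamma g h z - (1 - cexp (a * log1m z)) * / a + (1 - cexp (a * log1m z)) * / a) by ring.
  rewrite E. field. auto.
Qed.

(* The power [(1 - z)^a] identifies two points whose logarithms differ by [2 pi i / a];
   the strip [|Im log (1 - z)| < pi / 2] leaves room for them when [|a - 1| > 1] and [|a + 1| > 1]. *)
Lemma power_not_injective (a : C) : (1 < Cmod (a - 1))%R -> (1 < Cmod (a + 1))%R ->
  exists z w, in_disk z /\ in_disk w /\ z <> w /\ cexp (a * log1m z) = cexp (a * log1m w).
Proof.
  intros H1 H2.
  assert (S1 : (1 < Cmod (a - 1) * Cmod (a - 1))%R) by nra.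
  assert (S2 : (1 < Cmod (a + 1) * Cmod (a + 1))%R) by nra.
  rewrite Cmod_sq in S1, S2. destruct a as [a1 a2]. simpl in S1, S2.
  set (n := (a1 * a1 + a2 * a2)%R).
  assert (Hn1 : (2 * a1 < n)%R) by (unfold n; lra). assert (Hn2 : (- (2 * a1) < n)%R) by (unfold n; lra).
  assert (Pn : (0 < n)%R) by lra. pose proof PI_RGT_0 as PP.
  (* p + i q = 2 pi i / a. The bound |q| < pi is equivalent to 2 |a1| < |a|^2, which is what the two
     hypotheses on [a] say. *)
  set (p := (2 * PI * a2 / n)%R). set (q := (2 * PI * a1 / n)%R).
  assert (Hq : (- PI < q < PI)%R).
  { assert (Eq : (q * n = PI * (2 * a1))%R) by (unfold q; field; lra).
    split; apply Rmult_lt_reg_r with n; auto; rewrite Eq.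
    replace (- PI * n)%R with (PI * (- n))%R by ring. apply Rmult_lt_compat_l; lra. apply Rmult_lt_compat_l; lra. }
  assert (Pc : (0 < cos (q / 2))%R) by (apply cos_gt_0; lra).
  (* The logarithms will be u + p + i q / 2 and u - i q / 2. This [u] is negative enough for both to
     satisfy the condition of [log1m_cexp], whatever the sign of [p]. *)
  set (u := (ln (cos (q / 2)) - Rabs p)%R).
  assert (Hu : forall x, (x <= Rabs p)%R -> (exp (u + x) < 2 * cos (q / 2))%R).
  { intros x Hx. apply Rle_lt_trans with (exp (ln (cos (q / 2)))). apply exp_le_compat. unfold u. lra.
    rewrite exp_ln by auto. lra. }
  destruct (log1m_cexp (u + p) (q / 2)) as [D1 L1]. lra. apply Hu, Rle_abs.
  destruct (log1m_cexp u (- (q / 2))) as [D2 L2]. lra.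
  { rewrite cos_neg. replace u with (u + 0)%R by ring. apply Hu, Rabs_pos. }
  exists (1 - cexp (u + p, q / 2)%R), (1 - cexp (u, - (q / 2))%R).
  repeat split; auto.
  - intros E. rewrite E, L2 in L1. injection L1. intros Eq Ep.
    assert (p = 0)%R by lra. assert (q = 0)%R by lra.
    assert (p * n = 2 * PI * a2)%R by (unfold p; field; lra).
    assert (q * n = 2 * PI * a1)%R by (unfold q; field; lra).
    rewrite H, H0 in *. assert (a2 = 0)%R by nra. assert (a1 = 0)%R by nra. unfold n in Pn. subst. lra.
  - rewrite L1, L2.
    replace ((a1, a2) * (u + p, q / 2)%R) with ((a1, a2) * (u, (- (q / 2))%R) + (0%R, (2 * PI)%R)).
    2: { unfold Cmult, Cplus; simpl. f_equal; unfold p, q, n; field; unfold n in Pn; lra. }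
    rewrite cexp_plus. replace (cexp (0%R, (2 * PI)%R)) with (RtoC 1). ring.
    unfold cexp, Re, Im; simpl. rewrite exp_0, cos_2PI, sin_2PI. unfold RtoC. f_equal; ring.
Qed.

(* With [1 + t^2 = |G|] and [t] of sign opposite to [Im G], the point [G / (1 + i t)] has
   modulus [sqrt |G|] and distance at least [sqrt |G|] from [2]. *)
Lemma choose_angle (G : C) : (1 < Cmod G)%R -> exists alpha, (- (PI / 2) < alpha < PI / 2)%R /\
  (1 < Cmod (G * (RtoC (cos alpha) * / cexp (0, alpha))))%R /\
  (1 < Cmod (2 - G * (RtoC (cos alpha) * / cexp (0, alpha))))%R.
Proof.
  intros HG. set (rho := Cmod G) in *.
  assert (Ex : exists t, (t * t = rho - 1)%R /\ (snd G * t <= 0)%R).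
  { assert (P := sqrt_pos (rho - 1)). assert (Sq := sqrt_sqrt (rho - 1) ltac:(lra)).
    destruct (Rle_lt_dec 0 (snd G)). exists (- sqrt (rho - 1))%R. split; nra.
    exists (sqrt (rho - 1))%R. split; nra. }
  destruct Ex as (t & Ht & Hs). exists (atan t). pose proof (atan_bound t) as Ab. split. lra.
  assert (Sr := sqrt_sqrt rho ltac:(lra)). assert (Pr : (0 < sqrt rho)%R) by (apply sqrt_lt_R0; lra).
  assert (Er : (sqrt (1 + t²) = sqrt rho)%R). { f_equal. unfold Rsqr. lra. }
  assert (EC : RtoC (cos (atan t)) * / cexp (0, atan t) = (/ rho, - t / rho)%R).
  { rewrite <- cexp_opp. unfold cexp, Copp, Cmult, Re, Im; simpl. rewrite Ropp_0, exp_0, cos_neg, sin_neg.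
    rewrite cos_atan, sin_atan, Er.
    replace (/ rho, - t / rho)%R with (/ (sqrt rho * sqrt rho), - t / (sqrt rho * sqrt rho))%R by now rewrite Sr.
    f_equal; field; lra. }
  rewrite EC.
  assert (Gs := Cmod_sq G). fold rho in Gs. destruct G as [g1 g2]. simpl in Gs, Hs.
  assert (Hg1 : (g1 <= rho)%R). { pose proof (re_le_Cmod (g1, g2)) as H. pose proof (Rle_abs (Re (g1, g2))). unfold Re in *; simpl in *. fold rho in H. lra. }
  set (c := (g1, g2) * (/ rho, - t / rho)%R).
  assert (Fc : fst c = ((g1 + g2 * t) / rho)%R) by (unfold c; simpl; field; lra).
  assert (Sc : snd c = ((g2 - g1 * t) / rho)%R) by (unfold c; simpl; field; lra).
  assert (N1 : (fst c * fst c + snd c * snd c = rho)%R).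
  { rewrite Fc, Sc. replace ((g1 + g2 * t) / rho * ((g1 + g2 * t) / rho) + (g2 - g1 * t) / rho * ((g2 - g1 * t) / rho))%R
     with ((g1 * g1 + g2 * g2) * (1 + t * t) / (rho * rho))%R by (field; lra).
    rewrite <- Gs, Ht. field. lra. }
  (* Since |2 - c|^2 = |c|^2 + 4 (1 - Re c), the bound Re c <= 1 gives |2 - c| >= |c|. The sign of
     [t] ensures g2 t <= 0, so that Re c <= g1 / rho <= 1. *)
  assert (Fle : (fst c <= 1)%R).
  { rewrite Fc. apply Rmult_le_reg_r with rho. lra. replace ((g1 + g2 * t) / rho * rho)%R with (g1 + g2 * t)%R by (field; lra). lra. }
  split; apply Rnot_le_lt; intros Hle.
  - pose proof (Cmod_ge_0 c). assert (Cmod c * Cmod c <= 1)%R by nra. rewrite Cmod_sq in H0. lra.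
  - pose proof (Cmod_ge_0 (2 - c)). assert (Cmod (2 - c) * Cmod (2 - c) <= 1)%R by nra. rewrite Cmod_sq in H0.
    destruct c as [c1 c2]. simpl in *. nra.
Qed.

Lemma J_bound_necessary (lambda : R) (gamma : C) : (lambda < 1)%R ->
  (forall f : C -> C, classS_lambda lambda f -> J_in_S gamma f) ->
  (Cmod gamma <= 1 / (2 * (1 - lambda)))%R.
Proof.
  intros Hl H. apply Rnot_lt_le. intros Hg.
  set (G := RtoC (2 * (1 - lambda)) * gamma).
  assert (HG : (1 < Cmod G)%R).
  { unfold G. rewrite Cmod_mult, Cmod_R, Rabs_right by lra.
    apply Rmult_lt_compat_l with (r := (2 * (1 - lambda))%R) in Hg; [|lra].
    replace (2 * (1 - lambda) * (1 / (2 * (1 - lambda))))%R with 1%R in Hg by (field; lra). auto. }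
  destruct (choose_angle G HG) as (alpha & Ha & C1 & C2).
  set (b := 2 * RtoC ((1 - lambda) * cos alpha) * / cexp (0, alpha)).
  destruct (classS_lambda_power lambda alpha Hl Ha) as [Hf Hb]. fold b in Hf, Hb.
  destruct (H _ Hf _ Hb) as [_ Hinj].
  assert (Eb : gamma * b = G * (RtoC (cos alpha) * / cexp (0, alpha))).
  { unfold b, G. rewrite !RtoC_mult. ring. }
  rewrite <- Eb in C1, C2. set (a := 1 - gamma * b).
  assert (A1 : (1 < Cmod (a - 1))%R).
  { replace (a - 1) with (- (gamma * b)) by (unfold a; ring). now rewrite Cmod_opp. }
  assert (A2 : (1 < Cmod (a + 1))%R).
  { replace (a + 1) with (2 - gamma * b) by (unfold a; ring). auto. }
  assert (Na : a <> 0). { intros Z. rewrite Z in A1. replace (0 - 1) with (- (1)) in A1 by ring. rewrite Cmod_m1 in A1. lra. }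
  destruct (power_not_injective a A1 A2) as (z & w & Hz & Hw & Hne & He).
  apply Hne. apply Hinj; auto. rewrite !Jgamma_power by auto. fold a. now rewrite He.
Qed.

Close Scope C_scope.

Theorem theorem2p4 (lambda : R) (hl : lambda < 1) :
  forall gamma : C,
    (forall f : C -> C, classS_lambda lambda f -> J_in_S gamma f) <->
    Cmod gamma <= 1 / (2 * (1 - lambda)).
Proof.
  intros gamma. split.
  - now apply J_bound_necessary.
  - intros Hg f Hf h Hh. now apply (J_univalent lambda gamma f).
Qed.
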